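(* Suppose there is an $\varepsilon>0$ such that for no computable function $f$ can \textsc{Densest $k$-Subgraph} be approximated within ratio $1-\varepsilon$ in time $f(k)\cdot n^{O(1)}$. Then for every ratio $r$, \textsc{Odd Set} does not have an FPA algorithm with ratio $r$.
   Context: \textsc{Densest $k$-Subgraph}: given a graph $G=(V,E)$ on $n$ vertices and an integer $k$, find $S\subseteq V$ with $|S|=k$ maximizing the number of edges of $G[S]$; approximating within ratio $1-\varepsilon$ means returning $k$ vertices inducing at least $(1-\varepsilon)$ times the optimum number of edges. \textsc{Odd Set}: given a set system $\{S_1,\dots,S_m\}$ over a universe $U$, find a minimum-size $T\subseteq U$ with $|S_i\cap T|$ odd for every $i$. An FPA algorithm with ratio $r$ for a minimization problem: an algorithm that, given an instance of size $n$ and integer $k$, in time $f(k)\cdot n^{O(1)}$ ($f$ computable) either returns a feasible solution of cost at most $r\cdot k$ or correctly states that no solution of cost at most $k$ exists. *)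

(* Defs.v *)
From Stdlib Require Import Rdefinitions Raxioms RIneq.
From mathcomp Require Import all_boot.

Set Implicit Arguments.
Unset Strict Implicit.
Unset Printing Implicit Defensive.

(* Machine model: single-tape Turing machines over the tape alphabet  *)
(* {blank, 0, 1} = option bool.  States are 'I_(nq.+1); the start     *)
(* state is ord0 and the (unique) halting state is ord_max.           *)

Inductive move := MLeft | MRight | MStay.

Record TM := mkTM {
  tm_nq : nat;
  tm_delta : 'I_tm_nq.+1 -> option bool -> 'I_tm_nq.+1 * option bool * move
}.

Definition tm_halt (M : TM) : 'I_(tm_nq M).+1 := ord_max.

(* configuration: state, left part of tape (nearest cell first),
   scanned symbol, right part of tape (nearest cell first) *)
Record config (M : TM) := Config {
  c_state : 'I_(tm_nq M).+1;
  c_left  : seq (option bool);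
  c_head  : option bool;
  c_right : seq (option bool)
}.

Definition tm_init (M : TM) (x : seq bool) : config M :=
  match x with
  | [::] => @Config M ord0 [::] None [::]
  | a :: r => @Config M ord0 [::] (Some a) (map Some r)
  end.

Definition tm_step (M : TM) (c : config M) : config M :=
  let: Config q l h r := c in
  if q == tm_halt M then c else
  let: (q', w, mv) := tm_delta q h in
  match mv with
  | MLeft => match l with
             | [::] => @Config M q' [::] None (w :: r)
             | a :: l' => @Config M q' l' a (w :: r)
             end
  | MRight => match r with
              | [::] => @Config M q' (w :: l) None [::]
              | a :: r' => @Config M q' (w :: l) a r'
              end
  | MStay => @Config M q' l w r
  end.

Fixpoint read_out (s : seq (option bool)) : seq bool :=
  match s with
  | Some b :: s' => b :: read_out s'
  | _ => [::]
  end.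

Definition tm_output (M : TM) (c : config M) : seq bool :=
  read_out (c_head c :: c_right c).

(* M on input x has halted after at most t steps, with output y
   (a halted configuration is fixed by tm_step) *)
Definition halts_within (M : TM) (x : seq bool) (t : nat) (y : seq bool) : Prop :=
  let c := iter t (@tm_step M) (tm_init M x) in
  c_state c = tm_halt M /\ tm_output c = y.

Definition computes (M : TM) (f : nat -> nat) : Prop :=
  forall k, exists t, halts_within M (nseq k true) t (nseq (f k) true).

Definition computable (f : nat -> nat) : Prop := exists M, computes M f.

Definition enc_nat (m : nat) : seq bool := rcons (nseq m true) false.

Definition enc_seq (s : seq nat) : seq bool :=
  enc_nat (size s) ++ flatten (map enc_nat s).

Definition enc_pairs (l : seq (nat * nat)) : seq bool :=
  enc_nat (size l) ++ flatten (map (fun p => enc_nat p.1 ++ enc_nat p.2) l).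

(* Densest k-Subgraph.  A graph on vertex set {0,..,n-1} is given by  *)
(* n and a list l of edges (u,v) with u <> v; {u,v} is an edge iff    *)
(* (u,v) or (v,u) occurs in l.                                        *)

Definition graph_valid (n : nat) (l : seq (nat * nat)) : bool :=
  all (fun p => [&& p.1 < n, p.2 < n & p.1 != p.2]) l.

Definition adj (l : seq (nat * nat)) (u v : nat) : bool :=
  ((u, v) \in l) || ((v, u) \in l).

Definition induced_edges (n : nat) (l : seq (nat * nat)) (S : seq nat) : nat :=
  \sum_(u < n) \sum_(v < n | u < v) [&& (val u \in S), (val v \in S) & adj l u v].

Definition k_subset (n k : nat) (S : seq nat) : bool :=
  [&& uniq S, size S == k & all (fun v => v < n) S].

Definition dks_input (n : nat) (l : seq (nat * nat)) (k : nat) : seq bool :=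
  enc_nat n ++ enc_pairs l ++ enc_nat k.

Definition dks_fpt_approx (eps : R) : Prop :=
  exists (M : TM) (f : nat -> nat) (c : nat),
    computable f /\
    forall (n : nat) (l : seq (nat * nat)) (k : nat),
      graph_valid n l -> k <= n ->
      let x := dks_input n l k in
      exists S : seq nat,
        [/\ k_subset n k S,
            halts_within M x (f k * size x ^ c) (enc_seq S)
          & forall T, k_subset n k T ->
              Rle (Rmult (Rminus 1 eps) (INR (induced_edges n l T)))
                  (INR (induced_edges n l S))].

(* Odd Set.  Universe {0,..,u-1}; the set system is a list F of       *)
(* duplicate-free lists of elements of the universe.                  *)

Definition setsys_valid (u : nat) (F : seq (seq nat)) : bool :=
  all (fun s => uniq s && all (fun x => x < u) s) F.

Definition odd_set_feasible (u : nat) (F : seq (seq nat)) (T : seq nat) : bool :=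
  [&& uniq T, all (fun x => x < u) T
    & all (fun s => odd (count (fun x => x \in T) s)) F].

Definition oddset_input (u : nat) (F : seq (seq nat)) (k : nat) : seq bool :=
  enc_nat u ++ enc_nat (size F) ++ flatten (map enc_seq F) ++ enc_nat k.

Definition oddset_fpa (r : R) : Prop :=
  exists (M : TM) (f : nat -> nat) (c : nat),
    computable f /\
    forall (u : nat) (F : seq (seq nat)) (k : nat),
      setsys_valid u F ->
      let x := oddset_input u F k in
      exists y : seq bool,
        halts_within M x (f k * size x ^ c) y /\
        ((exists T, [/\ odd_set_feasible u F T,
                        Rle (INR (size T)) (Rmult r (INR k))
                      & y = true :: enc_seq T])
         \/
         (y = [:: false] /\ forall T, odd_set_feasible u F T -> k < size T)).

(* Main.v *)
(* Guess a coloring of the vertices and the set H of color pairs joined by an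
   optimal k-set S with x induced edges.  Vertices get distinct bit words of
   length about log n, and some k of the bit positions separate the words of S,
   so that the colorings "restrict the word to a mask" suffice; there are only
   O(n) masks.  Over the ground set of the edges whose color pair is in H,
   demand an odd number of edges of each color pair, and equal parities at every
   vertex for any two pairs sharing its color.  The edges of S are a solution of
   size x.  Conversely, in a solution X at most (|X| - x) / 2 color pairs have
   more than one edge, and the lone edges of the other pairs fit together to a
   subgraph on at most k vertices.

   Ratio r is turned into ratio 1 + 1/m by composing the instance with itself:
   elements are words of length at most D + 1, the words extending a chosen word
   p must solve the instance below p, and planted solutions have size
   x + x^2 + ... + x^(D+1).  An r-approximate solution contains a node with at
   most (1 + 1/m) x children as soon as r (D+1) < (1 + 1/m)^(D+1).

   To obtain Turing machines, functions on binary trees are shown to be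
   polynomial in a measure of the argument that may exceed its size.  Giving the
   DkS input a measure that also counts the exponential enumeration in k and the
   running time of the Odd Set machine on the parameters in use makes the whole
   reduction, oracle calls included, polynomial in that sense. *)
Require Import Defs.
From Stdlib Require Import Rdefinitions Raxioms RIneq ZArith Lia Lra.
From mathcomp Require Import all_boot.
From mathcomp Require Import zify.

Set Implicit Arguments.
Unset Strict Implicit.
Unset Printing Implicit Defensive.

(** * Structured programs over a tape *)

(** The constraints force every class of [H] to hold an odd number of chosen edges, so a class is a
    single edge or costs at least 3. Summing over the classes gives [3 * x <= |X| + 2 * (number of
    lone edges)]. This is empty once [|X| >= 3 * x], so a large ratio must be brought close to 1
    before the bound is used; hence the amplification. The parities at the vertices make the lone
    edges fit together: end vertices of lone edges that share a color coincide, and only the [k]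
    colors of [S] occur.

    No guess has to be verified. Every answer of the oracle, meaningful or not, is turned into sets
    of exactly [k] vertices and the best of them is kept; only the right guess matters for the
    ratio.

    The time factor of the resulting algorithm has to be computable as well. This is obtained by the
    same method, with the running time of the machine for [f] made part of the measure of a unary
    input. *)

Definition tape := Z -> option bool.

Definition shift (d : move) (p : Z) : Z :=
  match d with MLeft => Z.pred p | MRight => Z.succ p | MStay => p end.

Definition upd (f : tape) (p : Z) (a : option bool) : tape :=
  fun x => if Z.eqb x p then a else f x.

Inductive tprog :=
  | TMove of move
  | TWrite of option bool
  | TSkip
  | TSeq of tprog & tprog
  | TCase of tprog & tprog & tprog
  | TWhile of pred (option bool) & tprog.

Definition branch3 T (x y z : T) (a : option bool) : T :=
  match a with None => x | Some false => y | Some true => z end.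

(** The step counts are exactly those of the machine code: a case pays a jump in and a jump out, a
    loop pays one step for each test and one for each return. *)
Inductive tev : tprog -> tape -> Z -> nat -> tape -> Z -> Prop :=
  | tev_move d f p : tev (TMove d) f p 1 f (shift d p)
  | tev_write a f p : tev (TWrite a) f p 1 (upd f p a) p
  | tev_skip f p : tev TSkip f p 0 f p
  | tev_seq c1 c2 f p t1 f1 p1 t2 f2 p2 :
      tev c1 f p t1 f1 p1 -> tev c2 f1 p1 t2 f2 p2 ->
      tev (TSeq c1 c2) f p (t1 + t2) f2 p2
  | tev_case c0 c1 c2 f p t f' p' :
      tev (branch3 c0 c1 c2 (f p)) f p t f' p' ->
      tev (TCase c0 c1 c2) f p t.+2 f' p'
  | tev_stop (q : pred (option bool)) c f p :
      q (f p) = false -> tev (TWhile q c) f p 1 f p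
  | tev_loop (q : pred (option bool)) c f p t1 f1 p1 t2 f2 p2 :
      q (f p) -> tev c f p t1 f1 p1 -> tev (TWhile q c) f1 p1 t2 f2 p2 ->
      tev (TWhile q c) f p (t1 + t2).+2 f2 p2.

Fixpoint tsize (c : tprog) : nat :=
  match c with
  | TMove _ | TWrite _ => 1
  | TSkip => 0
  | TSeq c1 c2 => tsize c1 + tsize c2
  | TCase c0 c1 c2 => (tsize c0 + tsize c1 + tsize c2).+4
  | TWhile _ c => (tsize c).+2
  end.

(* The code of [c] occupies the states [s, ..., s + tsize c - 1] and exits to
   the state [s + tsize c]. *)
Fixpoint tdelta (c : tprog) (s q : nat) (a : option bool)
    : nat * option bool * move :=
  match c with
  | TMove d => (s.+1, a, d)
  | TWrite b => (s.+1, b, MStay)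
  | TSkip => (s, a, MStay)
  | TSeq c1 c2 =>
      if q < s + tsize c1 then tdelta c1 s q a
      else tdelta c2 (s + tsize c1) q a
  | TCase c0 c1 c2 =>
      let s0 := s.+1 in
      let s1 := (s0 + tsize c0).+1 in
      let s2 := (s1 + tsize c1).+1 in
      let e := (s2 + tsize c2).+1 in
      if q == s then (branch3 s0 s1 s2 a, a, MStay)
      else if q < s0 + tsize c0 then tdelta c0 s0 q a
      else if q == s0 + tsize c0 then (e, a, MStay)
      else if q < s1 + tsize c1 then tdelta c1 s1 q a
      else if q == s1 + tsize c1 then (e, a, MStay)
      else if q < s2 + tsize c2 then tdelta c2 s2 q a
      else (e, a, MStay)
  | TWhile p c =>
      if q == s then ((if p a then s.+1 else s + (tsize c).+2), a, MStay)
      else if q < s.+1 + tsize c then tdelta c s.+1 q a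
      else (s, a, MStay)
  end.

(** Reading both lists with default [None] supplies the blanks beyond their ends, so a finite
    configuration stands for the whole two-way infinite tape. *)
Definition tm_rep (M : TM) (c : config M) (q : nat) (f : tape) (p : Z) : Prop :=
  [/\ c_state c = q :> nat, c_head c = f p,
      (forall i, nth None (c_left c) i = f (p - 1 - Z.of_nat i)%Z) &
      (forall i, nth None (c_right c) i = f (p + 1 + Z.of_nat i)%Z)].

Lemma updE f p a x : upd f p a x = if Z.eqb x p then a else f x.
Proof. by []. Qed.

Lemma upd_same f p x : upd f p (f p) x = f x.
Proof. by rewrite /upd; case: Z.eqb_spec => [->|]. Qed.

Lemma tm_rep_ext M (c : config M) q f g p :
  (forall x, f x = g x) -> tm_rep c q f p -> tm_rep c q g p.
Proof.
by move=> e [h1 h2 h3 h4]; split=> // [|i|i]; rewrite -e.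
Qed.

Lemma tm_rep_step M (c : config M) q f p q' w d :
  tm_rep c q f p -> c_state c <> tm_halt M ->
  tm_delta (c_state c) (c_head c) = (q', w, d) ->
  tm_rep (tm_step c) q' (upd f p w) (shift d p).
Proof.
case: c => s l h r [/= h1 h2 h3 h4] /eqP/negbTE -> ->.
have updN x : x <> p -> upd f p w x = f x.
  by rewrite /upd; case: Z.eqb_spec.
have upd1 : upd f p w p = w by rewrite /upd Z.eqb_refl.
case: d; rewrite /=.
- case: l h3 => [|a l] h3; split=> //=.
  + by rewrite updN; [have := h3 0; rewrite /= => ->; congr f; lia | lia].
  + move=> i; rewrite nth_nil updN; last lia.
    by have := h3 i.+1; rewrite /= => ->; congr f; lia.
  + case=> [|i] /=; first by rewrite (_ : (_ + _)%Z = p) //; lia.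
    rewrite updN; last lia.
    by rewrite h4; congr f; lia.
  + by rewrite updN; [have := h3 0; rewrite /= => ->; congr f; lia | lia].
  + move=> i; rewrite updN; last lia.
    by have := h3 i.+1; rewrite /= => ->; congr f; lia.
  + case=> [|i] /=; first by rewrite (_ : (_ + _)%Z = p) //; lia.
    rewrite updN; last lia.
    by rewrite h4; congr f; lia.
- case: r h4 => [|a r] h4; split=> //=.
  + by rewrite updN; [have := h4 0; rewrite /= => ->; congr f; lia | lia].
  + case=> [|i] /=; first by rewrite (_ : (_ - _ - _)%Z = p) //; lia.
    rewrite updN; last lia.
    by rewrite h3; congr f; lia.
  + move=> i; rewrite nth_nil updN; last lia.
    by have := h4 i.+1; rewrite /= => ->; congr f; lia.
  + by rewrite updN; [have := h4 0; rewrite /= => ->; congr f; lia | lia].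
  + case=> [|i] /=; first by rewrite (_ : (_ - _ - _)%Z = p) //; lia.
    rewrite updN; last lia.
    by rewrite h3; congr f; lia.
  + move=> i; rewrite updN; last lia.
    by have := h4 i.+1; rewrite /= => ->; congr f; lia.
- by split=> [//||i|i] /=; rewrite ?upd1 ?updN //; lia.
Qed.

(** The function [dl] has to agree with the code of [c] only on the states that [c] occupies, so the
    induction can treat a part of a program inside the whole machine. The bound on [s + tsize c]
    keeps these states below the halting state. *)
Lemma tm_run (M : TM) (dl : nat -> option bool -> nat * option bool * move) :
  (forall (s : 'I_(tm_nq M).+1) a, s <> tm_halt M ->
     let r := tm_delta s a in ((r.1.1 : nat), r.1.2, r.2) = dl s a) ->
  forall c f p t f' p', tev c f p t f' p' ->
  forall s, s + tsize c <= tm_nq M ->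
    (forall q a, s <= q < s + tsize c -> dl q a = tdelta c s q a) ->
  forall g0 : config M, tm_rep g0 s f p ->
    tm_rep (iter t (@tm_step M) g0) (s + tsize c) f' p'.
Proof.
move=> dlE.
have step1 (g : config M) q q' w d f f' p :
    q < tm_nq M -> dl q (f p) = (q', w, d) -> (forall x, f' x = upd f p w x) ->
    tm_rep g q f p -> tm_rep (tm_step g) q' f' (shift d p).
  move=> ltq edl ef rep; have [e1 e2 _ _] := rep.
  have nh : c_state g <> tm_halt M.
    by move=> e; move: e1 ltq; rewrite e /= => <-; rewrite ltnn.
  have := dlE _ (c_head g) nh; rewrite /= [in RHS]e1 [in RHS]e2 edl.
  case ed: (tm_delta _ _) => [[r1 r2] r3] [= er1 er2 er3].
  apply: (@tm_rep_ext _ _ _ (upd f p w)); first by move=> x; rewrite ef.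
  by rewrite -er1 -er2 -er3; apply: tm_rep_step rep nh ed.
have jump (g : config M) q q' f p : q < tm_nq M -> dl q (f p) = (q', f p, MStay) ->
    tm_rep g q f p -> tm_rep (tm_step g) q' f p.
  move=> ltq e; apply: (step1 g q q' (f p) MStay f f p) => // x.
  by rewrite upd_same.
move=> c f p t f' p'; elim=> {c f p t f' p'}.
- move=> d f p s /= ss hd g0 rep; rewrite addn1.
  apply: (step1 g0 s s.+1 (f p) d f f p) => //; first lia.
    by rewrite hd //; lia.
  by move=> x; rewrite upd_same.
- move=> a f p s /= ss hd g0 rep; rewrite addn1.
  apply: (step1 g0 s s.+1 a MStay f (upd f p a) p) => //; first lia.
  by rewrite hd //; lia.
- by move=> f p s _ _ g0; rewrite addn0.
- move=> c1 c2 f p t1 f1 p1 t2 f2 p2 _ IH1 _ IH2 s /= ss hd g0 rep.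
  rewrite addnC iterD addnA; apply: IH2; first lia.
    move=> q a hq; rewrite hd; last lia.
    by rewrite ifF //; lia.
  apply: IH1 => //; first lia.
  move=> q a hq; rewrite hd; last lia.
  by rewrite ifT //; lia.
- move=> c0 c1 c2 f p t f' p' _ IH s /= ss hd g0 rep.
  rewrite -iterS iterSr.
  set q0 := branch3 s.+1 (s.+1 + tsize c0).+1 ((s.+1 + tsize c0).+1 + tsize c1).+1 (f p).
  have rep1 : tm_rep (tm_step g0) q0 f p.
    by apply: (jump _ s) => //; [lia | rewrite hd ?eqxx //; lia].
  apply: (jump _ (q0 + tsize (branch3 c0 c1 c2 (f p)))).
  + by rewrite /q0; case: (f p) => [[]|] /=; lia.
  + rewrite hd; last by rewrite /q0; case: (f p) => [[]|] /=; lia.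
    have -> : s + (tsize c0 + tsize c1 + tsize c2).+4
      = ((((s.+1 + tsize c0).+1 + tsize c1).+1) + tsize c2).+1 by lia.
    rewrite /q0; case: (f p) => [[]|] /=;
      by do ?[rewrite ifF; last lia | rewrite ifT; last lia].
  + apply: IH => //; rewrite /q0; first by case: (f p) => [[]|] /=; lia.
    move=> q a; case: (f p) => [[]|] /= hq; rewrite hd; try lia;
      by do ?[rewrite ifF; last lia | rewrite ifT; last lia].
- move=> q c f p hq s /= ss hd g0 rep.
  apply: (jump g0 s) => //; first lia.
  by rewrite hd /= ?eqxx ?hq //; lia.
- move=> q c f p t1 f1 p1 t2 f2 p2 hq _ IH1 _ IH2 s /= ss hd g0 rep.
  rewrite -!iterS (_ : (t1 + t2).+2 = t2 + (1 + (t1 + 1))); last lia.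
  rewrite !iterD /=; apply: IH2 => //.
  apply: (jump _ (s.+1 + tsize c)); first lia.
    by rewrite hd; [do ?[rewrite ifF; last lia] | lia].
  apply: IH1; first lia.
    by move=> q' a hq'; rewrite hd; [rewrite ifF ?ifT //; lia | lia].
  apply: (jump g0 s) => //; first lia.
  by rewrite hd ?eqxx ?hq //; lia.
Qed.

Definition tprog_tm (c : tprog) : TM :=
  @mkTM (tsize c) (fun q a =>
    let r := tdelta c 0 q a in (inord r.1.1, r.1.2, r.2)).

(** Jumps lead into the code or to its exit, so the [inord] in [tprog_tm] never alters a state. *)
Lemma tdelta_bound c s q a : s <= q < s + tsize c ->
  (tdelta c s q a).1.1 <= s + tsize c.
Proof.
elim: c s q => [d|b||c1 IH1 c2 IH2|c0 IH0 c1 IH1 c2 IH2|p c IH] s q /= hq; try lia.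
- case: ifP => h; first by have := IH1 s q; lia.
  by have := IH2 (s + tsize c1) q; lia.
- case: ifP => h1; first by case: a {IH0 IH1 IH2} => [[]|] /=; lia.
  case: ifP => h2; first by have := IH0 s.+1 q; lia.
  case: ifP => h3 /=; first by lia.
  case: ifP => h4; first by have := IH1 (s.+1 + tsize c0).+1 q; lia.
  case: ifP => h5 /=; first by lia.
  case: ifP => h6 /=; last by lia.
  by have := IH2 (((s.+1 + tsize c0).+1 + tsize c1).+1) q; lia.
- case: ifP => h1; first by case: ifP => /=; lia.
  case: ifP => h2 /=; last by lia.
  by have := IH s.+1 q; lia.
Qed.

Definition input_tape (x : seq bool) (h : Z) : tape := fun p =>
  if (p <? h)%Z then None else nth None (map Some x) (Z.to_nat (p - h)).

Lemma tm_rep_init c (x : seq bool) h :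
  tm_rep (tm_init (tprog_tm c) x) 0 (input_tape x h) h.
Proof.
have pos i : (h + 1 + Z.of_nat i <? h)%Z = false by lia.
have neg i : (h - 1 - Z.of_nat i <? h)%Z by lia.
have e i : Z.to_nat (h + 1 + Z.of_nat i - h) = i.+1 by lia.
case: x => [|b x]; split=> [||i|i]; rewrite /input_tape ?Z.ltb_irrefl ?Z.sub_diag
  ?neg ?pos ?e //= ?nth_nil //.
Qed.

Lemma tprog_tm_halts (c : tprog) x h t f p y :
  tev c (input_tape x h) h t f p ->
  (forall j, f (p + Z.of_nat j)%Z = nth None (map Some y) j) ->
  halts_within (tprog_tm c) x t y.
Proof.
move=> ev out; have := tm_run (M := tprog_tm c) (dl := tdelta c 0).
case/(_ _ _ _ _ _ _ _ ev 0 _ _ _ (tm_rep_init c x h)) => //=.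
  move=> s a /eqP ns; case: tdelta (@tdelta_bound c 0 s a) => [[q w] d] /= b.
  rewrite inordK // ltnS b // add0n.
  by rewrite ltn_neqAle -ltnS ltn_ord andbT; apply: contra ns => /eqP e; apply/eqP/val_inj.
rewrite add0n => e1 e2 _ e4; split; first exact/val_inj.
rewrite /tm_output e2.
have {}e4 i : nth None (f p :: c_right (iter t (@tm_step _) (tm_init (tprog_tm c) x))) i
   = nth None (map Some y) i.
  case: i => [|i] /=; first by rewrite -out Z.add_0_r.
  by rewrite e4 -out; congr f; lia.
elim: y (_ :: _) e4 {out ev e1 e2} => [|b y IH] s e4.
  by have /= := e4 0; case: s {e4} => //= a s ->.
case: s e4 => [|a s] e4; first by have /= := e4 0.
by have /= -> := e4 0; rewrite (IH s) // => i; have := e4 i.+1.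
Qed.

(** * Five-stack programs *)

(** [R] holds the input and the output of the machine, [A] the trees being computed with, [B] and
    [E] are scratch, and [C] is a counter. *)
Inductive var := VR | VA | VB | VE | VC.

Record store := Store { sR : seq bool; sA : seq bool; sB : seq bool;
                        sE : seq bool; sC : seq bool }.

Definition get (v : var) (s : store) : seq bool :=
  match v with VR => sR s | VA => sA s | VB => sB s | VE => sE s | VC => sC s end.

Definition put (v : var) (x : seq bool) (s : store) : store :=
  let: Store r a b e c := s in
  match v with
  | VR => Store x a b e c | VA => Store r x b e c | VB => Store r a x e c
  | VE => Store r a b x c | VC => Store r a b e x
  end.

Inductive sprog :=
  | Push of var & bool
  | Pop of var & sprog & sprog & sprog
  | Skip
  | Seq of sprog & sprog
  | While of var & pred (option bool) & sprog.

Inductive sev : sprog -> store -> nat -> store -> Prop :=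
  | sev_push v b s : sev (Push v b) s 1 (put v (b :: get v s) s)
  | sev_pop0 v c0 c1 c2 s t s' :
      get v s = [::] -> sev c0 s t s' -> sev (Pop v c0 c1 c2) s t.+1 s'
  | sev_pop v c0 c1 c2 s t s' b x :
      get v s = b :: x -> sev (if b then c2 else c1) (put v x s) t s' ->
      sev (Pop v c0 c1 c2) s t.+1 s'
  | sev_skip s : sev Skip s 0 s
  | sev_seq c1 c2 s t1 s1 t2 s2 : sev c1 s t1 s1 -> sev c2 s1 t2 s2 ->
      sev (Seq c1 c2) s (t1 + t2) s2
  | sev_stop v (q : pred (option bool)) c s :
      q (ohead (get v s)) = false -> sev (While v q c) s 1 s
  | sev_loop v (q : pred (option bool)) c s t1 s1 t2 s2 :
      q (ohead (get v s)) -> sev c s t1 s1 -> sev (While v q c) s1 t2 s2 ->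
      sev (While v q c) s (t1 + t2).+1 s2.

Lemma get_put v x s : get v (put v x s) = x.
Proof. by case: s v => ? ? ? ? ? []. Qed.

Lemma get_put_neq v w x s : v <> w -> get v (put w x s) = get v s.
Proof. by case: s v w => ? ? ? ? ? [] []. Qed.

Definition track (v : var) : nat :=
  match v with VR => 0 | VA => 1 | VB => 2 | VE => 3 | VC => 4 end.

(* Relative to the home cell 0: stack R occupies the cells 5, 6, ... from its
   bottom upwards.  The other stacks are interleaved to the left in blocks of
   five cells; the leftmost cell of a block marks that the block is in use.
   The cells 0, ..., 4 stay blank. *)
Definition addr (v : var) (j : Z) : Z :=
  match v with
  | VR => (5 + j)%Z
  | _ => (Z.of_nat (track v) - 5 * (j + 1))%Z
  end.

Definition cells (x : seq bool) (j : nat) : option bool :=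
  nth None (map Some (rev x)) j.

(** A pop leaves the mark of its block in place, so [J] bounds the heights without matching them.
    The blank cells 0 to 4 stop every scan towards home. *)
Definition store_rep (s : store) (J : nat) (f : tape) : Prop :=
  [/\ forall v (j : nat), f (addr v (Z.of_nat j)) = cells (get v s) j,
      forall j : nat, f (- 5 * (Z.of_nat j + 1))%Z = if j < J then Some true else None,
      forall p : Z, (0 <= p < 5)%Z -> f p = None &
      forall v, v <> VR -> size (get v s) <= J].

Definition moves (d : move) (n : nat) : tprog := iter n (TSeq (TMove d)) TSkip.

Definition scan (d : move) (n : nat) : tprog := TWhile isSome (moves d n).

(* [goto v] ends on the first free cell of [v], [peek v] on its top cell. *)
Definition goto (v : var) : tprog :=
  match v with
  | VR => TSeq (moves MRight 5) (scan MRight 1)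
  | _ => TSeq (moves MLeft (5 - track v)) (scan MLeft 5)
  end.

Definition peek (v : var) : tprog :=
  TSeq (goto v) (match v with VR => moves MLeft 1 | _ => moves MRight 5 end).

Definition home (v : var) : tprog :=
  match v with
  | VR => TSeq (scan MLeft 1) (moves MLeft 4)
  | _ => TSeq (moves MLeft (track v)) (scan MRight 5)
  end.

Definition tpush (v : var) (b : bool) : tprog :=
  TSeq (goto v) (TSeq (TWrite (Some b))
    (match v with
     | VR => home VR
     | _ => TSeq (moves MLeft (track v)) (TSeq (TWrite (Some true)) (scan MRight 5))
     end)).

Definition erase (v : var) : tprog :=
  TSeq (TWrite None) (match v with VR => TSeq (TMove MLeft) (home VR) | _ => home v end).

Fixpoint tcomp (c : sprog) : tprog :=
  match c with
  | Push v b => tpush v b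
  | Pop v c0 c1 c2 =>
      TSeq (peek v) (TCase (TSeq (home v) (tcomp c0)) (TSeq (erase v) (tcomp c1))
                           (TSeq (erase v) (tcomp c2)))
  | Skip => TSkip
  | Seq c1 c2 => TSeq (tcomp c1) (tcomp c2)
  | While v q c =>
      TSeq (peek v) (TSeq (TWhile q (TSeq (home v) (TSeq (tcomp c) (peek v)))) (home v))
  end.

Definition dir (d : move) : Z :=
  match d with MLeft => (-1)%Z | MRight => 1%Z | MStay => 0%Z end.

Lemma tev_eq c f p t f' p' t' q :
  tev c f p t f' p' -> t = t' -> p' = q -> tev c f p t' f' q.
Proof. by move=> h <- <-. Qed.

Lemma tev_moves d n f p : tev (moves d n) f p n f (p + dir d * Z.of_nat n)%Z.
Proof.
elim: n p => [|n IH] p.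
  by apply: (tev_eq (tev_skip f p)) => //; lia.
apply: (tev_eq (tev_seq (tev_move d f p) (IH _))) => //.
by case: d {IH}; rewrite /dir /shift; lia.
Qed.

Lemma tev_scan d n k f p :
  (forall i : nat, i < k -> isSome (f (p + dir d * Z.of_nat n * Z.of_nat i)%Z)) ->
  f (p + dir d * Z.of_nat n * Z.of_nat k)%Z = None ->
  tev (scan d n) f p (k * n.+2).+1 f (p + dir d * Z.of_nat n * Z.of_nat k)%Z.
Proof.
elim: k p => [|k IH] p some none.
  rewrite Z.mul_0_r Z.add_0_r in none *; apply: tev_stop.
  by rewrite none.
have some0 : isSome (f p).
  by have := some 0 isT; rewrite Z.mul_0_r Z.add_0_r.
have shiftE (i : nat) : (p + dir d * Z.of_nat n + dir d * Z.of_nat n * Z.of_nat i =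
    p + dir d * Z.of_nat n * Z.of_nat i.+1)%Z by lia.
apply: (tev_eq (tev_loop some0 (tev_moves d n f p) (IH _ _ _))); last exact: shiftE.
- by move=> i hi; rewrite shiftE; apply: some.
- by rewrite shiftE.
- by rewrite mulSn; lia.
Qed.

Lemma var_eq_dec (v w : var) : w = v \/ w <> v.
Proof. by case: v; case: w; (by left) || by right. Qed.

Lemma cells_some x j : j < size x -> isSome (cells x j).
Proof.
by move=> h; rewrite /cells (nth_map false) ?size_rev.
Qed.

Lemma cells_none x j : size x <= j -> cells x j = None.
Proof. by move=> h; rewrite /cells nth_default // size_map size_rev. Qed.

Lemma cells_cons b x j :
  cells (b :: x) j = if j == size x then Some b else cells x j.
Proof.
rewrite /cells rev_cons map_rcons nth_rcons size_map size_rev.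
by case: ltngtP => // h; rewrite nth_default // size_map size_rev ltnW.
Qed.

Lemma cells_top b x : cells (b :: x) (size x) = Some b.
Proof. by rewrite cells_cons eqxx. Qed.

(** The cells inspected by the scan in [home v]: the stack itself for [VR], the marks for the other
    stacks. Index -1 is the blank cell on which the scan ends. *)
Definition stop (v : var) (j : Z) : Z :=
  match v with VR => (5 + j)%Z | _ => (- 5 * (j + 1))%Z end.

Ltac addr_lia := lazy beta iota delta [addr dir track stop]; cbn [size]; lia.

Lemma addrS v j : addr v j = (addr v 0 + (if v is VR then 1 else -5) * j)%Z.
Proof. by case: v; addr_lia. Qed.

Lemma addr_inj v w (i j : nat) : addr v (Z.of_nat i) = addr w (Z.of_nat j) -> v = w /\ i = j.
Proof. by case: v; case: w => e; split=> //; move: e; addr_lia. Qed.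

Section Rep.

Variables (s : store) (J : nat) (f : tape).
Hypothesis rep : store_rep s J f.

Lemma goto_ok v : exists t, [/\ tev (goto v) f 0 t f (addr v (Z.of_nat (size (get v s))))
  & t <= 7 * (size (get v s)) + 6].
Proof.
have [h1 h2 h3 h4] := rep; set h := size _.
pose d := if v is VR then MRight else MLeft; pose n := if v is VR then 1 else 5.
have aE j : addr v j = (addr v 0 + dir d * Z.of_nat n * j)%Z.
  by rewrite addrS /d /n; case: (v); addr_lia.
have sc : tev (scan d n) f (addr v 0) (h * n.+2).+1 f (addr v (Z.of_nat h)).
  rewrite [addr v (Z.of_nat h)]aE; apply: tev_scan => [i hi|]; rewrite -aE h1.
    exact: cells_some.
  exact: cells_none.
exists ((if v is VR then 5 else 5 - track v) + (h * n.+2).+1); split.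
  have a0 : (addr v 0 = 0 + dir d * Z.of_nat (if v is VR then 5 else 5 - track v))%Z.
    by rewrite /d; case: (v).
  by move: sc; rewrite a0 /goto /d /n; case: (v) => sc; apply: tev_seq sc; apply: tev_moves.
by rewrite /n; case: (v) => /=; lia.
Qed.

Lemma peek_ok v : exists t,
  [/\ tev (peek v) f 0 t f (addr v (Z.of_nat (size (get v s)) - 1)),
      t <= 7 * (size (get v s)) + 11
    & f (addr v (Z.of_nat (size (get v s)) - 1)) = ohead (get v s)].
Proof.
have [h1 h2 h3 h4] := rep; have [t [ev tb]] := goto_ok v.
exists (t + (if v is VR then 1 else 5)); split.
- apply: tev_seq ev _; case: (v); set x := size _; apply: (tev_eq (tev_moves _ _ _ _)); addr_lia.
- by case: (v) tb => /=; lia.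
- case e: (get v s) => [|b x]; first by rewrite h3 //; case: (v); addr_lia.
  have -> : (Z.of_nat (size (b :: x)) - 1 = Z.of_nat (size x))%Z by addr_lia.
  by rewrite h1 e cells_top.
Qed.

Lemma store_rep_push v b :
  store_rep (put v (b :: get v s) s) (if v is VR then J else maxn J (size (get v s)).+1)
    (if v is VR then upd f (addr v (Z.of_nat (size (get v s)))) (Some b)
     else upd (upd f (addr v (Z.of_nat (size (get v s)))) (Some b))
              (- 5 * (Z.of_nat (size (get v s)) + 1)) (Some true)).
Proof.
have [h1 h2 h3 h4] := rep; set h := size _; set g := upd _ _ _.
have gE w (j : nat) : g (addr w (Z.of_nat j)) = cells (get w (put v (b :: get v s) s)) j.
  rewrite /g updE; case: Z.eqb_spec => [/addr_inj[-> ->]|ne].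
    by rewrite get_put cells_top.
  have [ew|nvw] := var_eq_dec v w.
    rewrite h1 ew get_put cells_cons ifF //.
    by apply/eqP => ej; case: ne; rewrite ew ej.
  by rewrite get_put_neq.
have gN (p : Z) : (forall w (j : nat), p <> addr w (Z.of_nat j)) -> g p = f p.
  by move=> np; rewrite /g updE; case: Z.eqb_spec => // /np.
have blank p : (0 <= p < 5)%Z -> g p = None.
  by move=> hp; rewrite gN ?h3 // => w j; case: w; addr_lia.
have mark (j : nat) : g (- 5 * (Z.of_nat j + 1))%Z = if j < J then Some true else None.
  by rewrite gN // => w i; case: w; addr_lia.
split.
- move=> w j; rewrite -gE -/h -/g; case: (v) => //;
    rewrite updE; case: Z.eqb_spec => // e; exfalso; move: e; case: w; addr_lia.
- move=> j; rewrite -/h -/g; have := mark j; have [ev|nv] := var_eq_dec VR v.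
    by rewrite [in if _ is VR then _ else _]ev [X in if X is VR then J else _]ev.
  have hJ := h4 v nv; rewrite -/h in hJ.
  have -> T (x y : T) : (if v is VR then x else y) = y by case: (v) nv.
  have -> T (x y : T) : (if v is VR then x else y) = y by case: (v) nv.
  rewrite updE => ->; case: Z.eqb_spec => e;
    case: (ltnP j (maxn J h.+1)) => h5; case: (ltnP j J) => h6 //; exfalso; lia.
- move=> p hp; rewrite -/h -/g; case: (v); rewrite ?updE ?blank //;
    by case: Z.eqb_spec => //; lia.
- move=> w nw; have := h4 w nw; have [ew|nvw] := var_eq_dec v w.
    by rewrite ew in nw *; rewrite get_put /= -/h; case: (v) nw => // _; lia.
  by rewrite get_put_neq //; case: (v) => //; lia.
Qed.

Lemma store_rep_pop v b x : get v s = b :: x ->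
  store_rep (put v x s) J (upd f (addr v (Z.of_nat (size x))) None).
Proof.
move=> e; have [h1 h2 h3 h4] := rep; split.
- move=> w j; rewrite updE; case: Z.eqb_spec => [/addr_inj[-> ->]|ne].
    by rewrite get_put cells_none.
  have [ew|nvw] := var_eq_dec v w.
    rewrite h1 ew get_put e cells_cons ifF //.
    by apply/eqP => ej; case: ne; rewrite ew ej.
  by rewrite get_put_neq.
- move=> j; rewrite updE; case: Z.eqb_spec => //.
  by case: (v); addr_lia.
- move=> p hp; rewrite updE h3 //; by case: Z.eqb_spec.
- move=> w nw; have := h4 w nw.
  have [->|nvw] := var_eq_dec v w.
    by rewrite get_put e /=; lia.
  by rewrite get_put_neq.
Qed.

(** Tape and height are free, because the head need not be on the top cell of the current store:
    after an erasure it is one cell above the new top. *)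
Lemma tev_home v g (j : nat) :
  (forall i : nat, i < j -> isSome (g (stop v (Z.of_nat i)))) ->
  g (stop v (-1)) = None ->
  exists t, [/\ tev (home v) g (addr v (Z.of_nat j - 1)) t g 0 & t <= 7 * j + 10].
Proof.
move=> some none.
have [ev|nv] := var_eq_dec VR v.
  rewrite ev in some none *; exists ((j * 3).+1 + 4); split; last lia.
  have sc : tev (scan MLeft 1) g (addr VR (Z.of_nat j - 1)) (j * 3).+1 g 4.
    apply: (tev_eq (@tev_scan MLeft 1 j g _ _ _)) => // [i hi||]; last addr_lia.
      have := some (j - i.+1); rewrite (_ : stop _ _ = (addr VR (Z.of_nat j - 1) +
         dir MLeft * Z.of_nat 1 * Z.of_nat i)%Z); first by apply; lia.
      addr_lia.
    by rewrite -none; congr g; addr_lia.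
  apply: tev_seq sc _; apply: (tev_eq (tev_moves _ _ _ _)) => //.
exists (track v + (j * 7).+1); split; last by case: (v) => /=; lia.
have h1 : tev (moves MLeft (track v)) g (addr v (Z.of_nat j - 1)) (track v) g
     (- 5 * Z.of_nat j).
  by apply: (tev_eq (tev_moves _ _ _ _)) => //; case: (v) nv => // _; addr_lia.
have h2 : tev (scan MRight 5) g (- 5 * Z.of_nat j) (j * 7).+1 g 0.
  apply: (tev_eq (@tev_scan MRight 5 j g _ _ _)) => // [i hi||]; last addr_lia.
    have := some (j - i.+1); rewrite (_ : stop _ _ = (- 5 * Z.of_nat j +
         dir MRight * Z.of_nat 5 * Z.of_nat i)%Z); first by apply; lia.
    by case: (v) nv => // _; addr_lia.
  by rewrite -none; congr g; case: (v) nv => // _; addr_lia.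
by have := tev_seq h1 h2; case: (v) nv.
Qed.

Lemma stop_some v i : i < size (get v s) -> isSome (f (stop v (Z.of_nat i))).
Proof.
move=> hi; have [h1 h2 _ h4] := rep; have [ev|nv] := var_eq_dec VR v.
  by rewrite ev in hi *; rewrite [f _](h1 VR i) cells_some.
have -> : stop v (Z.of_nat i) = (- 5 * (Z.of_nat i + 1))%Z by case: (v) nv.
by rewrite h2 ifT //; apply: leq_trans hi (h4 v nv).
Qed.

Lemma stop_none v : f (stop v (-1)) = None.
Proof. by have [_ _ h3 _] := rep; rewrite h3 // /stop; case: v. Qed.

Lemma home_ok v : exists t,
  [/\ tev (home v) f (addr v (Z.of_nat (size (get v s)) - 1)) t f 0
    & t <= 7 * size (get v s) + 10].
Proof. by apply: tev_home => [i|]; [apply: stop_some | apply: stop_none]. Qed.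

End Rep.

(** * Simulation of stack programs on the tape *)

Lemma tpush_ok s J f v b : store_rep s J f ->
  exists f' t, [/\ tev (tpush v b) f 0 t f' 0,
    store_rep (put v (b :: get v s) s) (if v is VR then J else maxn J (size (get v s)).+1) f'
    & t <= 14 * size (get v s) + 40].
Proof.
move=> rep; have rep' := store_rep_push rep v b; move: rep'.
have [t1 [ev1 b1]] := goto_ok rep v; set h := size _ in ev1 b1 *.
set g := upd f _ _ => rep'.
have hg w (j : nat) : g (addr w (Z.of_nat j)) = cells (get w (put v (b :: get v s) s)) j.
  have [h1 _ _ _] := rep'; rewrite -h1; case: (v) => //;
    rewrite updE; case: Z.eqb_spec => // e; exfalso; move: e; case: w; addr_lia.
have predE : Z.of_nat h = (Z.of_nat h.+1 - 1)%Z by lia.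
have [ev|nv] := var_eq_dec VR v.
  exists g; have [||t2 [ev2 b2]] := @tev_home VR g h.+1.
  - by move=> i hi; rewrite [g _](hg VR i) -ev get_put cells_some.
  - have [_ _ h3 _] := rep'; have := h3 4%Z; rewrite ev; exact.
  exists (t1 + (1 + t2)); split; last lia.
    have vE T (x y : T) : (if v is VR then x else y) = x by rewrite ev.
    rewrite /tpush vE; apply: (tev_seq ev1); apply: (tev_seq (tev_write _ _ _)).
    by rewrite -predE -[X in addr X _]ev in ev2.
  by move: rep'; rewrite ev.
have vE T (x y : T) : (if v is VR then x else y) = y by case: (v) nv.
rewrite !vE in rep' *; set g' := upd g _ _ in rep'.
exists g'; exists (t1 + (1 + (track v + (1 + (h.+1 * 7).+1)))); split=> //; last first.
  by case: (v) => /=; lia.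
rewrite /tpush vE; apply: (tev_seq ev1); apply: (tev_seq (tev_write _ _ _)).
have ev2 : tev (moves MLeft (track v)) g (addr v (Z.of_nat h)) (track v) g
    (- 5 * (Z.of_nat h + 1)).
  by apply: (tev_eq (tev_moves _ _ _ _)) => //; case: (v) nv => // _; addr_lia.
apply: (tev_seq ev2); apply: (tev_seq (tev_write _ _ _)).
apply: (tev_eq (@tev_scan MRight 5 h.+1 _ _ _ _)) => [i hi|||]; try addr_lia.
  have [_ h2 _ _] := rep'; have := h2 (h - i); rewrite -/g'.
  rewrite ifT; last lia.
  have -> : (- 5 * (Z.of_nat (h - i) + 1) = - 5 * (Z.of_nat h + 1) +
    dir MRight * Z.of_nat 5 * Z.of_nat i)%Z by addr_lia.
  by move=> ->.
have [_ _ h3 _] := rep'; rewrite -/g' h3 //; addr_lia.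
Qed.

Lemma terase_ok s J f v b x : store_rep s J f -> get v s = b :: x ->
  exists f' t, [/\ tev (erase v) f (addr v (Z.of_nat (size x))) t f' 0,
    store_rep (put v x s) J f' & t <= 7 * size x + 20].
Proof.
move=> rep e; have rep' := store_rep_pop rep e; set g := upd _ _ _ in rep'.
have home' := home_ok rep' v; rewrite get_put in home'.
have [ev|nv] := var_eq_dec VR v.
  have [t [evh bt]] := home'; exists g, (1 + (1 + t)); split=> //; last lia.
  rewrite /erase; apply: (tev_seq (tev_write _ _ _)); rewrite -/g.
  have -> T (y z : T) : (match v with VR => y | _ => z end) = y by rewrite ev.
  apply: (tev_seq (tev_move _ _ _)).
  rewrite (_ : shift _ _ = addr VR (Z.of_nat (size x) - 1)); first by rewrite ev in evh.
  by rewrite ev /shift; addr_lia.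
have [||t [evh bt]] := @tev_home v g (size x).+1.
- move=> i hi; have [_ h2 _ _] := rep'; have [_ _ _ h4] := rep.
  have -> : stop v (Z.of_nat i) = (- 5 * (Z.of_nat i + 1))%Z by case: (v) nv.
  by rewrite h2 ifT //; apply: leq_trans hi _; have := h4 v nv; rewrite e.
- exact: stop_none rep' v.
exists g, (1 + t); split=> //; last lia.
rewrite (_ : Z.of_nat (size x) = (Z.of_nat (size x).+1 - 1)%Z); last lia.
rewrite /erase (_ : (match v with VR => _ | _ => _ end) = home v); last by case: (v) nv.
apply: (tev_seq (tev_write _ _ _)); move: evh; rewrite /g.
by rewrite (_ : (Z.of_nat (size x).+1 - 1)%Z = Z.of_nat (size x)) //; lia.
Qed.

Definition width (s : store) (J : nat) : nat := J + size (sR s).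

Lemma get_width s J f v : store_rep s J f -> size (get v s) <= width s J.
Proof.
case=> _ _ _ h; have [->|nv] := var_eq_dec VR v; first by rewrite /width leq_addl.
by apply: leq_trans (h v nv) _; rewrite /width leq_addr.
Qed.

Lemma tev_seqE c1 c2 f p t f' p' : tev (TSeq c1 c2) f p t f' p' ->
  exists t1 f1 p1 t2, [/\ tev c1 f p t1 f1 p1, tev c2 f1 p1 t2 f' p' & t = t1 + t2].
Proof.
move e : (TSeq c1 c2) => c h; case: h e => // c1' c2' f0 p0 t1 f1 p1 t2 f2 p2 h1 h2 [-> ->].
by exists t1, f1, p1, t2.
Qed.

(** One stack operation costs a walk over at most [width] many blocks or cells and raises the width
    by at most one. Hence [t] operations start from width at most [width s J + t], and the total is
    quadratic. *)
Lemma tcomp_ok c s t s' : sev c s t s' -> forall J f, store_rep s J f ->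
  exists f' J' T, [/\ tev (tcomp c) f 0 T f' 0, store_rep s' J' f',
    width s' J' <= width s J + t & T <= 60 * (width s J + t + 1) * t].
Proof.
elim=> {c s t s'}.
- move=> v b s J f rep; have [f' [T [ev rep' bT]]] := tpush_ok v b rep.
  have gw := get_width v rep; have [_ _ _ h4] := rep.
  exists f'; eexists; exists T; split; [exact: ev | exact: rep' | | lia].
  have [ev'|nv] := var_eq_dec VR v; first by rewrite /width ev'; case: (s) => * /=; lia.
  have vE A (x y : A) : (if v is VR then x else y) = y by case: (v) nv.
  have := h4 v nv; rewrite /width vE.
  have -> : sR (put v (b :: get v s) s) = sR s by case: (v) nv; case: (s).
  lia.
- move=> v c0 c1 c2 s t s' e _ IH J f rep.
  have [t1 [ev1 b1 top]] := peek_ok rep v; have [t2 [ev2 b2]] := home_ok rep v.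
  have [f' [J' [T [ev rep' bw bT]]]] := IH J f rep.
  exists f', J', (t1 + (t2 + T).+2); split=> //; last by rewrite e /= in b1 b2; nia.
    apply: (tev_seq ev1); apply: tev_case.
    rewrite top (_ : ohead (get v s) = None) ?e //; rewrite e in ev2; exact: tev_seq ev2 ev.
  lia.
- move=> v c0 c1 c2 s t s' b x e _ IH J f rep.
  have [t1 [ev1 b1 top]] := peek_ok rep v; have [f2 [t2 [ev2 rep2 b2]]] := terase_ok rep e.
  have [f' [J' [T [ev rep' bw bT]]]] := IH J f2 rep2.
  have gw := get_width v rep; rewrite e /= in gw.
  have wx : width (put v x s) J <= width s J.
    by rewrite /width leq_add2l; case: (v) e; case: (s) => //= ? ? ? ? ? ->.
  exists f', J', (t1 + (t2 + T).+2); split=> //; first 1 last.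
  + lia.
  + by rewrite e /= in b1; nia.
  apply: (tev_seq ev1); apply: tev_case; rewrite top e.
  have -> : (Z.of_nat (size (b :: x)) - 1 = Z.of_nat (size x))%Z by addr_lia.
  by case: (b) ev => ev; apply: tev_seq ev2 ev.
- by move=> s J f rep; exists f, J, 0; split=> //; [apply: tev_skip | lia..].
- move=> c1 c2 s t1 s1 t2 s2 _ IH1 _ IH2 J f rep.
  have [f1 [J1 [T1 [ev1 rep1 bw1 bT1]]]] := IH1 J f rep.
  have [f2 [J2 [T2 [ev2 rep2 bw2 bT2]]]] := IH2 J1 f1 rep1.
  exists f2, J2, (T1 + T2); split=> //; [exact: tev_seq ev1 ev2 | lia | nia].
- move=> v q c s hq J f rep.
  have [t1 [ev1 b1 top]] := peek_ok rep v; have [t2 [ev2 b2]] := home_ok rep v.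
  have gw := get_width v rep.
  exists f, J, (t1 + (1 + t2)); split=> //; [|lia|lia].
  apply: (tev_seq ev1); apply: tev_seq ev2; apply: tev_stop; by rewrite top.
- move=> v q c s t1 s1 t2 s2 hq _ IH1 _ IH2 J f rep.
  have [t0 [ev0 b0 top]] := peek_ok rep v; have [th [evh bh]] := home_ok rep v.
  have gw := get_width v rep.
  have [f1 [J1 [T1 [ev1 rep1 bw1 bT1]]]] := IH1 J f rep.
  have [f2 [J2 [T2 [ev2 rep2 bw2 bT2]]]] := IH2 J1 f1 rep1.
  (* The induction hypothesis covers peek, loop and return for the remaining rounds. It is taken
     apart because its peek is the last action of the present round. *)
  have [t3 [f3 [p3 [t4 [ev3 ev4 e2]]]]] := tev_seqE ev2.
  have [t5 [f5 [p5 [t6 [ev5 ev6 e4]]]]] := tev_seqE ev4.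
  exists f2, J2, (t0 + ((th + (T1 + t3) + t5).+2 + t6)); split=> //; [|lia|].
    apply: (tev_seq ev0); apply: tev_seq ev6; apply: tev_loop ev5; first by rewrite top.
    by apply: tev_seq evh _; apply: tev_seq ev1 ev3.
  have -> : t0 + ((th + (T1 + t3) + t5).+2 + t6) = t0 + th + 2 + T1 + T2 by lia.
  nia.
Qed.

Lemma iter_halted M (c : config M) t :
  c_state c = tm_halt M -> iter t (@tm_step M) c = c.
Proof.
by case: c => q l h r /= ->; elim: t => //= t ->; rewrite /= eqxx.
Qed.

Lemma halts_within_mono M x t t' y :
  halts_within M x t y -> t <= t' -> halts_within M x t' y.
Proof. by move=> [hs ho] /subnK <-; rewrite /halts_within iterD iter_halted. Qed.

(** The first input bit is taken to be cell 5, the bottom of [R]. The input then already is the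
    content of [R], with its last bit on top, and nothing needs to be loaded or copied out; the five
    moves lead to the home cell and back. *)
Definition main_prog (c : sprog) : tprog :=
  TSeq (moves MLeft 5) (TSeq (tcomp c) (moves MRight 5)).

Lemma main_prog_halts c x y t :
  sev c (Store (rev x) [::] [::] [::] [::]) t (Store (rev y) [::] [::] [::] [::]) ->
  halts_within (tprog_tm (main_prog c)) x (60 * (size x + t + 1) * t + 10) y.
Proof.
move=> ev; pose f := input_tape x 5.
have fneg p : (p < 5)%Z -> f p = None by rewrite /f /input_tape => h; rewrite ifT //; lia.
have rep : store_rep (Store (rev x) [::] [::] [::] [::]) 0 f.
  split=> [v j|j|p hp|[]//]; try by rewrite fneg //; lia.
  case: v; last 4 first.
  1-4: rewrite fneg; [by rewrite /cells /= nth_nil | addr_lia].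
  rewrite /cells revK /f /input_tape /addr (_ : (_ <? _)%Z = false); last lia.
  by congr nth; lia.
have [f' [J' [T [ev' rep' _ bT]]]] := tcomp_ok ev rep.
have [h1 _ _ _] := rep'.
have hw : halts_within (tprog_tm (main_prog c)) x (5 + (T + 5)) y.
  apply: (@tprog_tm_halts _ _ 5 _ f' 5).
    apply: tev_seq; first by apply: (tev_eq (tev_moves MLeft 5 _ _)).
    by apply: tev_seq ev' _; apply: (tev_eq (tev_moves MRight 5 _ _)).
  by move=> j; have /= := h1 VR j; rewrite /cells revK.
rewrite /width size_rev /= in bT.
apply: halts_within_mono hw _; lia.
Qed.

(** * Trees on a stack *)

Inductive tree := Lf | Nd of tree & tree.

(* A prefix code, so that several trees can share a stack without separators. *)
Fixpoint flat (t : tree) : seq bool :=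
  match t with Lf => [:: false] | Nd a b => true :: flat a ++ flat b end.

Definition runs (c : sprog) (s : store) (t : nat) (s' : store) : Prop :=
  exists2 t', t' <= t & sev c s t' s'.

Lemma runs_le c s t t' s' : runs c s t s' -> t <= t' -> runs c s t' s'.
Proof. by move=> [u h1 h2] h3; exists u => //; apply: leq_trans h1 h3. Qed.

Lemma runs_seq c1 c2 s t1 s1 t2 s2 :
  runs c1 s t1 s1 -> runs c2 s1 t2 s2 -> runs (Seq c1 c2) s (t1 + t2) s2.
Proof.
by move=> [u1 h1 e1] [u2 h2 e2]; exists (u1 + u2); [lia | apply: sev_seq e1 e2].
Qed.

Lemma runs_push v b s : runs (Push v b) s 1 (put v (b :: get v s) s).
Proof. by exists 1 => //; constructor. Qed.

Lemma runs_skip s : runs Skip s 0 s.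
Proof. by exists 0 => //; constructor. Qed.

Lemma runs_pop v c0 c1 c2 s t s' b x : get v s = b :: x ->
  runs (if b then c2 else c1) (put v x s) t s' -> runs (Pop v c0 c1 c2) s t.+1 s'.
Proof. by move=> e [u h1 h2]; exists u.+1 => //; apply: sev_pop e h2. Qed.

Section StorePop.

Variables (c0 c1 c2 : sprog) (r a b e c : seq bool) (x : bool) (t : nat) (s : store).

Let k := if x then c2 else c1.

Lemma runs_popR : runs k (Store r a b e c) t s ->
  runs (Pop VR c0 c1 c2) (Store (x :: r) a b e c) t.+1 s.
Proof. exact: (@runs_pop VR c0 c1 c2 (Store (x :: r) a b e c) t s x r erefl). Qed.

Lemma runs_popA : runs k (Store r a b e c) t s ->
  runs (Pop VA c0 c1 c2) (Store r (x :: a) b e c) t.+1 s.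
Proof. exact: (@runs_pop VA c0 c1 c2 (Store r (x :: a) b e c) t s x a erefl). Qed.

Lemma runs_popB : runs k (Store r a b e c) t s ->
  runs (Pop VB c0 c1 c2) (Store r a (x :: b) e c) t.+1 s.
Proof. exact: (@runs_pop VB c0 c1 c2 (Store r a (x :: b) e c) t s x b erefl). Qed.

Lemma runs_popC : runs k (Store r a b e c) t s ->
  runs (Pop VC c0 c1 c2) (Store r a b e (x :: c)) t.+1 s.
Proof. exact: (@runs_pop VC c0 c1 c2 (Store r a b e (x :: c)) t s x c erefl). Qed.

End StorePop.

Lemma runs_stop v (q : pred (option bool)) c s :
  q (ohead (get v s)) = false -> runs (While v q c) s 1 s.
Proof. by exists 1 => //; constructor. Qed.

Lemma runs_loop v (q : pred (option bool)) c s t1 s1 t2 s2 : q (ohead (get v s)) ->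
  runs c s t1 s1 -> runs (While v q c) s1 t2 s2 ->
  runs (While v q c) s (t1 + t2).+1 s2.
Proof.
by move=> hq [u1 h1 e1] [u2 h2 e2]; exists (u1 + u2).+1; [lia | apply: sev_loop e2].
Qed.

Definition is_true_top : pred (option bool) := fun a => if a is Some true then true else false.

Definition transfer (v w : var) : sprog :=
  While v isSome (Pop v Skip (Push w false) (Push w true)).

(* The counter C holds the number of trees still to be read. *)
Definition unload (w : var) : sprog :=
  Seq (Push VC true) (While VC is_true_top (Seq (Pop VC Skip Skip Skip)
    (Pop VA Skip (Push w false) (Seq (Push w true) (Seq (Push VC true) (Push VC true)))))).

Lemma transfer_ok v w s : v <> w ->
  runs (transfer v w) s (3 * size (get v s)).+1
    (put w (rev (get v s) ++ get w s) (put v [::] s)).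
Proof.
move=> nvw; move e: (get v s) => x; elim: x s e => [|b x IH] s e.
  have -> : put w (rev [::] ++ get w s) (put v [::] s) = s.
    by case: s e => ? ? ? ? ?; case: v w nvw => [] [] // _ /= ->.
  by apply: runs_stop; rewrite e.
have r1 : runs (Pop v Skip (Push w false) (Push w true)) s 2
    (put w (b :: get w s) (put v x s)).
  apply: runs_pop e _; rewrite -[get w s](@get_put_neq w v x s); last by move/esym.
  by case: (b); apply: runs_push.
have := IH (put w (b :: get w s) (put v x s)).
rewrite get_put_neq // get_put => /(_ erefl) r2.
have -> : put w (rev (b :: x) ++ get w s) (put v [::] s) =
    put w (rev x ++ get w (put w (b :: get w s) (put v x s)))
      (put v [::] (put w (b :: get w s) (put v x s))).
  rewrite get_put rev_cons cat_rcons.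
  by case: s {e IH r1 r2} => ? ? ? ? ?; case: v w nvw => [] [].
apply: runs_le; first by apply: runs_loop r1 r2; rewrite e.
by rewrite /=; lia.
Qed.

Lemma unload_ok w t r0 r b e : w = VB \/ w = VE ->
  runs (unload w) (Store r0 (flat t ++ r) b e [::]) (7 * size (flat t) + 2)
    (put w (rev (flat t) ++ get w (Store r0 r b e [::])) (Store r0 r b e [::])).
Proof.
move=> hw; rewrite /unload; set body := Seq (Pop _ _ _ _) _.
have leaf b1 e1 c1 r1 : runs body (Store r0 (false :: r1) b1 e1 (true :: c1)) 3
    (put w (false :: get w (Store r0 r1 b1 e1 c1)) (Store r0 r1 b1 e1 c1)).
  apply: (runs_seq (t1 := 1)); first by apply: runs_popC; apply: runs_skip.
  by apply: runs_popA; case: hw => ->; apply: runs_push.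
have node b1 e1 c1 r1 : runs body (Store r0 (true :: r1) b1 e1 (true :: c1)) 5
    (put w (true :: get w (Store r0 r1 b1 e1 c1)) (Store r0 r1 b1 e1 (true :: true :: c1))).
  apply: (runs_seq (t1 := 1)); first by apply: runs_popC; apply: runs_skip.
  apply: runs_popA; apply: (runs_seq (t1 := 1)); first exact: runs_push.
  apply: (runs_seq (t1 := 1)); first exact: runs_push.
  by case: hw => -> /=; apply: runs_push.
(* The rest of the run is a hypothesis, so the loop need not stop between the two subtrees of a node
   and the induction hypotheses can be chained. *)
have main T s' : forall r b e c, runs (While VC is_true_top body)
      (put w (rev (flat t) ++ get w (Store r0 r b e c)) (Store r0 r b e c)) T s' ->
    runs (While VC is_true_top body) (Store r0 (flat t ++ r) b e (true :: c))
      (7 * size (flat t) + T) s'.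
  elim: t {r b e} T => [|t1 IH1 t2 IH2] T r b e c h.
    by apply: runs_le (runs_loop _ (leaf _ _ _ _) h) _ => //; rewrite /=; lia.
  have {}h : runs (While VC is_true_top body)
      (put w (rev (flat t2) ++ rev (flat t1) ++ true :: get w (Store r0 r b e c))
         (Store r0 r b e c)) T s'.
    by move: h; rewrite /= rev_cons rev_cat cat_rcons -catA.
  have {}h : runs (While VC is_true_top body)
      (put w (true :: get w (Store r0 (flat t1 ++ flat t2 ++ r) b e c))
        (Store r0 (flat t1 ++ flat t2 ++ r) b e (true :: true :: c)))
      (7 * size (flat t1) + (7 * size (flat t2) + T)) s'.
    by case: hw IH1 IH2 h => -> /= IH1 IH2 h; apply: IH1; apply: IH2.
  rewrite /= -catA; apply: runs_le (runs_loop _ (node _ _ _ _) h) _ => //.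
  by rewrite size_cat; lia.
have -> : 7 * size (flat t) + 2 = 1 + (7 * size (flat t) + 1) by lia.
apply: runs_seq (runs_push _ _ _) _; apply: main.
by case: hw => ->; apply: runs_stop.
Qed.

(** The arbitrary [z] and [r] are a frame: a program for the top tree may run on a stack with more
    trees below. The scratch stacks start and end empty. *)
Definition tree_runs (P : sprog) (x y : seq bool) (t : nat) : Prop :=
  forall r z, runs P (Store r (x ++ z) [::] [::] [::]) t (Store r (y ++ z) [::] [::] [::]).

Lemma tree_runs_le P x y t t' : tree_runs P x y t -> t <= t' -> tree_runs P x y t'.
Proof. by move=> h le r z; apply: runs_le le. Qed.

Lemma tree_runs_seq P Q x y z t u :
  tree_runs P x y t -> tree_runs Q y z u -> tree_runs (Seq P Q) x z (t + u).
Proof. by move=> h1 h2 r w; apply: runs_seq. Qed.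

Lemma tree_runs_frame P x y z t :
  tree_runs P x y t -> tree_runs P (x ++ z) (y ++ z) t.
Proof. by move=> h r w; rewrite -!catA; apply: h. Qed.

Definition drop_tree : sprog := Seq (unload VB) (While VB isSome (Pop VB Skip Skip Skip)).

Lemma drop_tree_ok t : tree_runs drop_tree (flat t) [::] (10 * size (flat t) + 3).
Proof.
move=> r z; set n := size _.
have -> : 10 * n + 3 = (7 * n + 2) + (3 * n + 1) by lia.
apply: runs_seq; first by apply: unload_ok; left.
rewrite /= cats0 -[n]size_rev; elim: (rev (flat t)) => [|b x IH].
  by apply: runs_stop.
apply: runs_le; first by apply: runs_loop IH => //; apply: runs_popB; case: (b); apply: runs_skip.
by rewrite /=; lia.
Qed.

Definition swap_tree : sprog :=
  Seq (unload VB) (Seq (unload VE) (Seq (transfer VB VA) (transfer VE VA))).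

Lemma swap_tree_ok t u : tree_runs swap_tree (flat t ++ flat u) (flat u ++ flat t)
  (10 * (size (flat t) + size (flat u)) + 6).
Proof.
move=> r z; rewrite -!catA.
apply: runs_le.
  apply: runs_seq; first by apply: unload_ok; left.
  apply: runs_seq; first by rewrite /= cats0; apply: unload_ok; right.
  apply: runs_seq; first exact: transfer_ok.
  rewrite /= cats0 revK.
  have := @transfer_ok VE VA (Store r (flat t ++ z) [::] (rev (flat u)) [::]).
  by rewrite /= revK; apply.
by rewrite /= !size_rev; lia.
Qed.

Definition dup_tree : sprog :=
  Seq (unload VB) (Seq (While VB isSome (Pop VB Skip (Seq (Push VA false) (Push VE false))
                                                     (Seq (Push VA true) (Push VE true))))
                       (Seq (transfer VE VB) (transfer VB VA))).

Lemma dup_tree_ok t : tree_runs dup_tree (flat t) (flat t ++ flat t)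
  (20 * size (flat t) + 5).
Proof.
move=> r z; rewrite -!catA.
have copy x : forall a e, runs (While VB isSome (Pop VB Skip (Seq (Push VA false) (Push VE false))
    (Seq (Push VA true) (Push VE true)))) (Store r a x e [::]) (4 * size x + 1)
    (Store r (rev x ++ a) [::] (rev x ++ e) [::]).
  elim: x => [|b x IH] a e; first exact: runs_stop.
  rewrite !rev_cons !cat_rcons.
  apply: runs_le; first apply: runs_loop (IH _ _) => //.
    apply: runs_popB; case: b;
      apply: (runs_seq (t1 := 1) (t2 := 1) (s1 := Store _ (_ :: a) x e [::])); exact: runs_push.
  by rewrite /=; lia.
apply: runs_le.
  apply: runs_seq; first by apply: unload_ok; left.
  apply: runs_seq; first by rewrite /= cats0; apply: copy.
  apply: runs_seq; first exact: transfer_ok.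
  rewrite /= !cats0 !revK.
  have := @transfer_ok VB VA (Store r (flat t ++ z) (rev (flat t)) [::] [::]).
  by rewrite /= revK; apply.
by rewrite /= ?cats0 !size_rev; lia.
Qed.

(** * Functions computed in polynomial time *)

(** The base is at least 2, so the single exponent also absorbs constants and coefficients. *)
Definition bdd A (r : A -> nat) (g : A -> nat) : Prop :=
  exists c, forall a, g a <= (r a + 2) ^ c.

Lemma leq_expl m n e : m <= n -> m ^ e <= n ^ e.
Proof. by case: e => // e h; rewrite leq_exp2r. Qed.

Section Bounds.

Variables (A : Type) (r : A -> nat).

Lemma bdd_le g h : bdd r h -> (forall a, g a <= h a) -> bdd r g.
Proof. by move=> [c hc] le; exists c => a; apply: leq_trans (le a) (hc a). Qed.

Lemma bdd_const k : bdd r (fun=> k).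
Proof.
exists k => a; apply: leq_trans (ltnW (ltn_expl k (ltnSn 1))) _.
by rewrite leq_expl // leq_addl.
Qed.

Lemma bdd_rho : bdd r r.
Proof. by exists 1 => a; rewrite expn1 leq_addr. Qed.

Lemma bdd_add g h : bdd r g -> bdd r h -> bdd r (fun a => g a + h a).
Proof.
move=> [c hc] [d hd]; exists (c + d).+1 => a; have x2 : 1 < r a + 2 by lia.
have h1 : g a <= (r a + 2) ^ (c + d).
  by apply: leq_trans (hc a) _; rewrite leq_exp2l // leq_addr.
have h2 : h a <= (r a + 2) ^ (c + d).
  by apply: leq_trans (hd a) _; rewrite leq_exp2l // leq_addl.
by rewrite expnS; nia.
Qed.

Lemma bdd_mul g h : bdd r g -> bdd r h -> bdd r (fun a => g a * h a).
Proof.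
by move=> [c hc] [d hd]; exists (c + d) => a; rewrite expnD leq_mul.
Qed.

Lemma bdd_exp g k : bdd r g -> bdd r (fun a => g a ^ k).
Proof.
move=> hg; elim: k => [|k IH]; first exact: bdd_const.
by apply: bdd_le (bdd_mul hg IH) _ => a; rewrite expnS.
Qed.

Lemma bdd_comp B (s : B -> nat) h (f : A -> B) :
  bdd s h -> bdd r (fun a => s (f a)) -> bdd r (fun a => h (f a)).
Proof.
move=> [c hc] hf.
apply: bdd_le (fun a => hc (f a)); apply: bdd_exp.
exact: bdd_add hf (bdd_const 2).
Qed.

End Bounds.

(* [rho] is at least the size of the code; a larger [rho] allows more time. *)
Class code (A : Type) := Code {
  cod : A -> tree;
  rho : A -> nat;
  rho_ge : forall a, size (flat (cod a)) <= rho a }.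

(** The last condition makes composition possible: [rho] may exceed the size of the code by any
    amount, so the running time alone would not bound the measure of the result. *)
Definition poly A B (cA : code A) (cB : code B) (f : A -> B) : Prop :=
  exists P g, [/\ bdd rho g,
    forall a, tree_runs P (flat (cod a)) (flat (cod (f a))) (g a) &
    bdd rho (fun a => rho (f a))].

Arguments poly {A B cA cB} f.

Lemma poly_ext A B (cA : code A) (cB : code B) (f g : A -> B) :
  poly f -> (forall a, f a = g a) -> poly g.
Proof.
move=> [P [t [h1 h2 h3]]] e; exists P, t; split=> // [a|]; first by rewrite -e.
by apply: bdd_le h3 _ => a; rewrite e.
Qed.

Lemma poly_rho A B (cA : code A) (cB : code B) (f : A -> B) :
  poly f -> bdd rho (fun a => rho (f a)).
Proof. by case=> P [g []]. Qed.

Section Basic.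

Context {A B C : Type} {cA : code A} {cB : code B} {cC : code C}.

Lemma poly_comp (g : B -> C) (f : A -> B) : poly g -> poly f -> poly (fun a => g (f a)).
Proof.
move=> [Q [u [bu hu ru]]] [P [t [bt ht rt]]].
exists (Seq P Q), (fun a => t a + u (f a)); split.
- exact: bdd_add bt (bdd_comp bu rt).
- by move=> a; apply: tree_runs_seq.
- exact: bdd_comp ru rt.
Qed.

Lemma poly_recode (f : A -> B) :
  (forall a, cod (f a) = cod a) -> bdd rho (fun a => rho (f a)) -> poly f.
Proof.
move=> e rf; exists Skip, (fun=> 0); split=> //; first exact: bdd_const.
by move=> a r z; rewrite e; apply: runs_skip.
Qed.

Fixpoint push_seq (x : seq bool) : sprog :=
  if x is b :: x' then Seq (push_seq x') (Push VA b) else Skip.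

Lemma push_seq_ok x : tree_runs (push_seq x) [::] x (size x).
Proof.
elim: x => [|b x IH] r z; first exact: runs_skip.
rewrite /= -addn1; apply: runs_seq (IH r z) _.
exact: (runs_push VA b (Store r (x ++ z) _ _ _)).
Qed.

Lemma poly_const (b : B) : poly (fun _ : A => b).
Proof.
exists (Seq drop_tree (push_seq (flat (cod b)))),
  (fun a => 10 * size (flat (cod a)) + 3 + size (flat (cod b))); split.
- apply: bdd_add (bdd_const _ _); apply: bdd_add (bdd_const _ _).
  apply: bdd_mul; first exact: bdd_const.
  by apply: bdd_le (bdd_rho _) _ => a; apply: rho_ge.
- by move=> a; apply: tree_runs_seq (drop_tree_ok _) (push_seq_ok _).
- exact: bdd_const.
Qed.

End Basic.

Lemma poly_id A (cA : code A) : poly (fun a : A => a).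
Proof. by apply: poly_recode => //; apply: bdd_rho. Qed.

Lemma rho_flat A (cA : code A) : bdd (rho (A := A)) (fun a => size (flat (cod a))).
Proof. by apply: bdd_le (bdd_rho _) _ => a; apply: rho_ge. Qed.

Lemma poly_flat A B (cA : code A) (cB : code B) (f : A -> B) :
  poly f -> bdd rho (fun a => size (flat (cod (f a)))).
Proof. by move=> pf; apply: (bdd_comp (f := f) (@rho_flat _ _) (poly_rho pf)). Qed.

(** * Codes of data types *)

#[global] Program Instance code_unit : code unit := {| cod _ := Lf; rho _ := 1 |}.

#[global] Program Instance code_bool : code bool :=
  {| cod b := if b then Nd Lf Lf else Lf; rho _ := 3 |}.
Next Obligation. by case: a. Qed.

#[global] Program Instance code_prod A B (cA : code A) (cB : code B) : code (A * B) :=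
  {| cod p := Nd (cod p.1) (cod p.2); rho p := rho p.1 + rho p.2 + 1 |}.
Next Obligation. by rewrite /= size_cat addn1 ltnS leq_add ?rho_ge. Qed.

(** Numbers are unary, as in the inputs of both problems, and a successor is coded like a pair whose
    first component is [tt]. *)
Fixpoint cod_nat (n : nat) : tree := if n is m.+1 then Nd Lf (cod_nat m) else Lf.

#[global] Program Instance code_nat : code nat := {| cod := cod_nat; rho n := n.*2.+1 |}.
Next Obligation. by elim: a => //= a IH; rewrite doubleS; lia. Qed.

Fixpoint cod_seq A (cA : code A) (s : seq A) : tree :=
  if s is x :: s' then Nd (cod x) (cod_seq cA s') else Lf.

#[global] Program Instance code_seq A (cA : code A) : code (seq A) :=
  {| cod := cod_seq cA; rho s := (sumn (map (fun x => (rho x).+1) s)).+1 |}.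
Next Obligation.
elim: a => //= x s IH; rewrite size_cat addSn ltnS -addnS.
by apply: leq_add IH; apply: rho_ge.
Qed.

Ltac bdd_tac := lazymatch goal with
  | |- bdd _ (fun a => addn (@?f a) (@?g a)) =>
      apply: (@bdd_add _ _ f g); bdd_tac
  | |- bdd _ (fun a => muln (@?f a) (@?g a)) =>
      apply: (@bdd_mul _ _ f g); bdd_tac
  | |- bdd _ (fun a => expn (@?f a) ?k) =>
      apply: (@bdd_exp _ _ f k); bdd_tac
  | |- _ => first [ assumption | exact: bdd_const | exact: bdd_rho | exact: rho_flat
                  | by apply: poly_rho; assumption | by apply: poly_flat; assumption | idtac ]
  end.

Section Pairs.

Context {X A B C : Type} {cX : code X} {cA : code A} {cB : code B} {cC : code C}.

(** A node is coded by [true] followed by its subtrees, so one push completes the pair. The program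
    for [g] runs first because its result has to lie below that of [f]. *)
Lemma poly_pair (f : X -> A) (g : X -> B) : poly f -> poly g -> poly (fun x => (f x, g x)).
Proof.
move=> pf pg; have [P [t [bt ht rt]]] := pf; have [Q [u [bu hu ru]]] := pg.
exists (Seq dup_tree (Seq Q (Seq swap_tree (Seq P (Push VA true))))),
  (fun x => (20 * size (flat (cod x)) + 5) + (u x +
     ((10 * (size (flat (cod (g x))) + size (flat (cod x))) + 6) + (t x + 1)))).
split; first by bdd_tac.
  move=> x; apply: tree_runs_seq (dup_tree_ok _) _.
  apply: tree_runs_seq; first exact: tree_runs_frame (hu x).
  apply: tree_runs_seq (swap_tree_ok _ _) _.
  apply: tree_runs_seq; first exact: tree_runs_frame (ht x).
  move=> r z; exact: (runs_push VA true (Store r (_ ++ z) _ _ _)).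
by apply: bdd_add; bdd_tac; apply: bdd_add; bdd_tac.
Qed.

Definition pop_top : sprog := Pop VA Skip Skip Skip.

Lemma pop_top_ok b x : tree_runs pop_top (b :: x) x 1.
Proof. by move=> r z; apply: runs_popA; case: b; apply: runs_skip. Qed.

Lemma poly_fst (f : X -> A * B) : poly f -> poly (fun x => (f x).1).
Proof.
apply: poly_comp; exists (Seq pop_top (Seq swap_tree drop_tree)),
  (fun x => 1 + ((10 * (size (flat (cod x.1)) + size (flat (cod x.2))) + 6) +
                 (10 * size (flat (cod x.2)) + 3))).
have r1 : bdd rho (fun x : A * B => rho x.1).
  by apply: bdd_le (bdd_rho _) _ => x /=; lia.
have r2 : bdd rho (fun x : A * B => rho x.2).
  by apply: bdd_le (bdd_rho _) _ => x /=; lia.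
have s1 := bdd_comp (f := fst) (@rho_flat _ _) r1.
have s2 := bdd_comp (f := snd) (@rho_flat _ _) r2.
split=> //; first by bdd_tac.
move=> x /=; apply: tree_runs_seq (pop_top_ok _ _) _.
apply: tree_runs_seq (swap_tree_ok _ _) _.
by have := tree_runs_frame (flat (cod x.1)) (drop_tree_ok (cod x.2)).
Qed.

Lemma poly_snd (f : X -> A * B) : poly f -> poly (fun x => (f x).2).
Proof.
apply: poly_comp; exists (Seq pop_top drop_tree),
  (fun x => 1 + (10 * size (flat (cod x.1)) + 3)).
have r1 : bdd rho (fun x : A * B => rho x.1).
  by apply: bdd_le (bdd_rho _) _ => x /=; lia.
have r2 : bdd rho (fun x : A * B => rho x.2).
  by apply: bdd_le (bdd_rho _) _ => x /=; lia.
have s1 := bdd_comp (f := fst) (@rho_flat _ _) r1.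
split=> //; first by bdd_tac.
move=> x /=; apply: tree_runs_seq (pop_top_ok _ _) _.
by have := tree_runs_frame (flat (cod x.2)) (drop_tree_ok (cod x.1)).
Qed.

(* Branching on whether the code of [c x] is a leaf; otherwise it is also the
   code of some [d], on which the other branch may depend. *)
Lemma poly_match D (cD : code D) (c : X -> A) (g : X -> B) (f : X * D -> B) (h : X -> B) :
  poly c -> poly g -> poly f ->
  (forall x, (cod (c x) = Lf /\ h x = g x) \/
     exists d, [/\ cod (c x) = cod d, cod d <> Lf, rho d <= rho (c x) & h x = f (x, d)]) ->
  poly h.
Proof.
move=> pc pg pf hE; have [PC [tc [btc htc rtc]]] := pc.
have [PG [tg [btg htg rtg]]] := pg.
have [PF [tf [[ef btf] htf [rf rtf]]]] := pf.
exists (Seq dup_tree (Seq PC (Pop VA Skip PG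
  (Seq (Push VA true) (Seq swap_tree (Seq (Push VA true) PF)))))),
  (fun x => (20 * size (flat (cod x)) + 5) + (tc x + (1 + tg x + (1 +
    ((10 * (size (flat (cod (c x))) + size (flat (cod x))) + 6) +
     (1 + (rho x + rho (c x) + 1 + 2) ^ ef)))))).
split.
- by bdd_tac.
- move=> x; apply: tree_runs_seq (dup_tree_ok _) _.
  apply: tree_runs_seq; first exact: tree_runs_frame (htc x).
  move=> r z; rewrite -!catA; case: (hE x) => [[-> ->]|[d [ed nd rd ->]]].
    apply: runs_le; first by apply: runs_popA; apply: (htg x).
    lia.
  have [y ey] : exists y, flat (cod d) = true :: y by case: (cod d) nd => //= a b _; eexists.
    have le1 : tf (x, d) <= (rho x + rho (c x) + 1 + 2) ^ ef.
      by apply: leq_trans (btf (x, d)) _; rewrite leq_expl //= !leq_add2r leq_add2l.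
    apply: (runs_le (t := (1 + ((10 * (size (flat (cod d)) + size (flat (cod x))) + 6) +
                                (1 + tf (x, d)))).+1)); last by rewrite ed; lia.
    rewrite ed {1}ey; apply: runs_popA.
    (* The test has consumed the root bit of the code of [d]. It is put back, and after the swap a
       second [true] yields the code of [(x, d)]. *)
    apply: runs_seq; first exact: (runs_push VA true (Store r (y ++ _) _ _ _)).
    rewrite [put _ _ _]/= -cat_cons -ey catA.
    apply: runs_seq; first exact: swap_tree_ok.
    apply: runs_seq; first exact: (runs_push VA true (Store r _ _ _ _)).
    exact: (htf (x, d)).
- apply: bdd_le (_ : bdd rho (fun x => rho (g x) + (rho x + rho (c x) + 1 + 2) ^ rf)) _.
    by bdd_tac.
  move=> x; case: (hE x) => [[_ ->]|[d [_ _ rd ->]]]; first exact: leq_addr.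
  apply: leq_trans (leq_addl _ _); apply: leq_trans (rtf (x, d)) _ => /=.
  by rewrite leq_expl // !leq_add2r leq_add2l.
Qed.

End Pairs.

Section Loops.

Context {X F S : Type} {cX : code X} {cF : code F} {cS : code S}.

(** The state is kept without the root bit of its pair, so the test sees the first bit of the
    control component, and a leaf ends the loop. The bound on all intermediate measures has to be
    assumed: a polynomial-time step may square the measure in each round. *)
Lemma poly_while (h : F * S -> F * S) (s0 : X -> F * S) (out : X -> S) (N : X -> nat) :
  poly h -> poly s0 -> bdd rho N ->
  (forall x, exists n, [/\ n <= N x, forall i, i < n -> cod (iter i h (s0 x)).1 <> Lf,
     cod (iter n h (s0 x)).1 = Lf, (iter n h (s0 x)).2 = out x &
     forall i, i <= n -> rho (iter i h (s0 x)) <= N x]) ->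
  poly out.
Proof.
move=> [H [th [[e bth] hth _]]] [P [tp [btp htp rtp]]] bN hn.
exists (Seq P (Seq pop_top (Seq (While VA is_true_top
    (Seq (Push VA true) (Seq H pop_top))) pop_top))),
  (fun x => tp x + (1 + ((N x * ((N x + 2) ^ e + 3) + 1) + 1))); split.
- by bdd_tac.
- move=> x; apply: tree_runs_seq (htp x) _; apply: tree_runs_seq (pop_top_ok _ _) _.
  have [n [nN nl lf <- hN]] := hn x.
  have loop K : forall i st, (forall j, j < i -> cod (iter j h st).1 <> Lf) ->
      (forall j, j <= i -> th (iter j h st) <= K) -> cod (iter i h st).1 = Lf ->
      tree_runs (While VA is_true_top (Seq (Push VA true) (Seq H pop_top)))
        (flat (cod st.1) ++ flat (cod st.2))
        (flat (cod (iter i h st).1) ++ flat (cod (iter i h st).2)) (i * (K + 3) + 1).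
    elim=> [|i IH] st hj hK hl r z; first by rewrite /= in hl *; rewrite hl; apply: runs_stop.
    have [y ey] : exists y, flat (cod st.1) = true :: y.
      by have := hj 0 isT; rewrite /=; case: (cod st.1) => //= a b _; eexists.
    apply: runs_le.
      apply: runs_loop; first by rewrite ey.
        apply: runs_seq; first exact: runs_push.
        apply: runs_seq; first by have := hth st r z; rewrite /= -catA; apply.
        exact: (pop_top_ok true (flat (cod (h st).1) ++ flat (cod (h st).2)) r z).
      rewrite iterSr; apply: (IH (h st)); last by rewrite -iterSr.
        by move=> j ji; rewrite -iterSr; apply: hj.
      by move=> j ji; rewrite -iterSr; apply: hK.
    by rewrite mulSn; have := hK 0 isT; rewrite /=; lia.
  apply: (tree_runs_le (t := (n * ((N x + 2) ^ e + 3) + 1) + 1)).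
    apply: tree_runs_seq; first apply: (loop ((N x + 2) ^ e) n _ nl) => //.
      by move=> j ji; apply: leq_trans (bth _) _; rewrite leq_expl // leq_add2r hN.
    by rewrite lf; apply: pop_top_ok.
  by rewrite !leq_add2r leq_mul2r nN orbT.
- apply: bdd_le bN _ => x; have [n [_ _ _ <- hN]] := hn x.
  by apply: leq_trans (hN n (leqnn n)) => /=; lia.
Qed.

End Loops.

Section Data.

Context {X A B : Type} {cX : code X} {cA : code A} {cB : code B}.

Lemma poly_if (c : X -> bool) (f g : X -> B) :
  poly c -> poly f -> poly g -> poly (fun x => if c x then f x else g x).
Proof.
move=> pc pf pg; apply: (poly_match (D := bool) (f := fun p => f p.1) pc pg).
  by apply: poly_comp pf _; apply: poly_fst; apply: poly_id.
by move=> x; case: (c x); [right; exists true | left].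
Qed.

(** Nothing is computed: [n.+1] and [(tt, n)] have the same code. The same remark makes [poly_cons]
    a recoding. *)
Lemma poly_succ (n : X -> nat) : poly n -> poly (fun x => (n x).+1).
Proof.
move=> pn; have : poly (fun x => (tt, n x)) by apply: poly_pair pn; apply: poly_const.
apply: poly_comp (fun p : unit * nat => p.2.+1) _ _.
apply: poly_recode => [[[] m] //|]; apply: bdd_le (bdd_rho _) _ => -[[] m] /=; lia.
Qed.

Lemma poly_nat_case (n : X -> nat) (f : X * nat -> B) (g : X -> B) :
  poly n -> poly f -> poly g -> poly (fun x => if n x is m.+1 then f (x, m) else g x).
Proof.
move=> pn pf pg; apply: (poly_match (D := unit * nat) (f := fun p => f (p.1, p.2.2)) pn pg).
  apply: poly_comp pf _; apply: poly_pair; first by apply: poly_fst; apply: poly_id.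
  by do 2! apply: poly_snd; apply: poly_id.
move=> x; case: (n x) => [|m]; first by left.
by right; exists (tt, m); split=> //=; lia.
Qed.

Lemma poly_cons (a : X -> A) (l : X -> seq A) :
  poly a -> poly l -> poly (fun x => a x :: l x).
Proof.
move=> pa pl; apply: poly_comp (fun p : A * seq A => p.1 :: p.2) _ _ (poly_pair pa pl).
apply: poly_recode => [[]//|]; apply: bdd_le (bdd_rho _) _ => -[x y] /=; lia.
Qed.

Lemma poly_seq_case (l : X -> seq A) (f : X * (A * seq A) -> B) (g : X -> B) :
  poly l -> poly f -> poly g -> poly (fun x => if l x is a :: l' then f (x, (a, l')) else g x).
Proof.
move=> pl pf pg; apply: (poly_match (D := A * seq A) pl pg pf).
move=> x; case: (l x) => [|a l']; first by left.
by right; exists (a, l'); split=> //=; lia.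
Qed.

End Data.

Lemma rho_pair A B {cA : code A} {cB : code B} (a : A) (b : B) :
  rho (a, b) = rho a + rho b + 1.
Proof. by []. Qed.

Lemma rho_cons A {cA : code A} a (l : seq A) : rho (a :: l) = rho a + rho l + 1.
Proof. by rewrite addn1 /= addSn addnS. Qed.

Lemma rho_drop A {cA : code A} i (l : seq A) : rho (drop i l) <= rho l.
Proof. by elim: l i => [|a l IH] [|i] //=; have := IH i; rewrite /=; lia. Qed.

Lemma rho_take A {cA : code A} i (l : seq A) : rho (take i l) <= rho l.
Proof. by elim: l i => [|a l IH] [|i] //=; have := IH i; rewrite /=; lia. Qed.

Lemma size_rho A {cA : code A} (l : seq A) : size l < rho l.
Proof. by elim: l => //= a l IH; rewrite ltnS in IH *; lia. Qed.

Section Folds.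

Context {X A S : Type} {cX : code X} {cA : code A} {cS : code S}.
Variables (l : X -> seq A) (s0 : X -> S) (step : X -> S -> A -> S).
Hypotheses (pl : poly l) (ps : poly s0)
  (pstep : poly (fun p : X * S * A => step p.1.1 p.1.2 p.2)).

(** Only the empty list is coded by a leaf, so the list still to be read serves as the control
    component. The context [x] travels with the state because the step depends on it. *)
Lemma poly_foldl (N : X -> nat) : bdd rho N ->
  (forall x i, rho (foldl (step x) (s0 x) (take i (l x))) <= N x) ->
  poly (fun x => foldl (step x) (s0 x) (l x)).
Proof.
move=> bN hN.
pose h (st : seq A * (X * S)) : seq A * (X * S) :=
  if st.1 is a :: l' then (l', (st.2.1, step st.2.1 st.2.2 a)) else st.
have ph : poly h.
  apply: (poly_seq_case (l := fst)
    (f := fun p => (p.2.2, (p.1.2.1, step p.1.2.1 p.1.2.2 p.2.1))) (g := id)).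
  - by apply: poly_fst; apply: poly_id.
  - apply: poly_pair; first by do 2! apply: poly_snd; apply: poly_id.
    apply: poly_pair; first by apply: poly_fst; apply: poly_snd; apply: poly_fst; apply: poly_id.
    apply: (poly_comp pstep (f := fun p => (p.1.2, p.2.1))).
    apply: poly_pair; last by apply: poly_fst; apply: poly_snd; apply: poly_id.
    by apply: poly_snd; apply: poly_fst; apply: poly_id.
  - exact: poly_id.
have hE x i l' s : iter i h (l', (x, s)) =
    (drop i l', (x, foldl (step x) s (take i l'))).
  elim: i l' s => [|i IH] l' s; first by rewrite drop0 take0.
  by rewrite iterSr; case: l' => [|a l']; rewrite /= IH //= ?drop_nil.
have pw : poly (fun x => (x, foldl (step x) (s0 x) (l x))).
  apply: (poly_while (h := h) (s0 := fun x => (l x, (x, s0 x)))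
    (N := fun x => rho (l x) + (rho x + N x + 1) + 1)) => //.
  - by do 2!(apply: poly_pair => //); apply: poly_id.
  - by bdd_tac.
  move=> x; cbv beta; exists (size (l x)); split.
  - by apply: leq_trans (ltnW (size_rho _)) _; rewrite -addnA leq_addr.
  - move=> i hi; rewrite hE /=; case: drop (size_drop i (l x)) => //=; lia.
  - by rewrite hE /= drop_size.
  - by rewrite hE /= take_size.
  - by move=> i _; rewrite hE !rho_pair leq_add2r leq_add ?rho_drop // leq_add2r leq_add2l hN.
exact: poly_snd pw.
Qed.

(** The increment may depend on [x] but not on the state, which excludes repeated doubling. *)
Lemma poly_foldl_add (G : X -> nat) : bdd rho G ->
  (forall x s a, rho a <= rho (l x) -> rho (step x s a) <= rho s + G x) ->
  poly (fun x => foldl (step x) (s0 x) (l x)).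
Proof.
move=> bG hG; apply: (poly_foldl (N := fun x => rho (s0 x) + rho (l x) * G x)).
  by bdd_tac.
move=> x i.
have : rho (foldl (step x) (s0 x) (take i (l x))) <=
    rho (s0 x) + size (take i (l x)) * G x.
  have := @rho_take A cA i (l x); set l1 := take i _.
  elim: l1 (s0 x) => [|a l1 IH] s hl; first by rewrite addn0.
  rewrite (rho_cons a) in hl; have ha : rho a <= rho (l x).
    by apply: leq_trans hl; rewrite -addnA leq_addr.
  have hl1 : rho l1 <= rho (l x).
    by apply: leq_trans hl; rewrite addnAC leq_addl.
  apply: leq_trans (IH _ hl1) _; rewrite mulSn addnA leq_add2r.
  exact: hG ha.
move/leq_trans; apply; rewrite leq_add2l leq_mul2r; apply/orP; right.
by apply: leq_trans (ltnW (size_rho _)) (rho_take _ _).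
Qed.

End Folds.

(** * A library of polynomial-time functions *)

(* [ptac] proves [poly f] by recursion on the syntax of [f] and leaves the goals
   it does not recognize; [ptac_ext] is redefined as closure lemmas accumulate. *)
Ltac ptac_ext := fail.

Ltac ptac := intros; cbv beta; first
  [ assumption | exact: poly_id | simple apply poly_const
  | lazymatch goal with
    | |- poly (@fst _ _) => exact: (poly_fst (@poly_id _ _))
    | |- poly (@snd _ _) => exact: (poly_snd (@poly_id _ _))
    | |- poly (fun x => pair (@?f x) (@?g x)) => simple apply (poly_pair (f := f) (g := g)); ptac
    | |- poly (fun x => fst (@?f x)) => simple apply (poly_fst (f := f)); ptac
    | |- poly (fun x => snd (@?f x)) => simple apply (poly_snd (f := f)); ptac
    | |- poly (fun x => S (@?f x)) => simple apply (poly_succ (n := f)); ptac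
    | |- poly (fun x => cons (@?f x) (@?g x)) =>
        simple apply (poly_cons (a := f) (l := g)); ptac
    | |- _ => fail
    end
  | ptac_ext; ptac | simple apply poly_if; ptac
  | match goal with
    | H : @poly ?X ?B _ _ _ |- @poly (prod ?X _) ?B _ _ _ =>
        refine (poly_comp (f := fun p => fst p) H _); ptac
    | H : @poly ?X ?B _ _ _ |- @poly (prod (prod ?X _) _) ?B _ _ _ =>
        refine (poly_comp (f := fun p => fst (fst p)) H _); ptac
    end
  | idtac ].

Section NatOps.

Context {X S : Type} {cX : code X} {cS : code S}.

(** A number has the same code as the list of that many units; this reduces iteration to a fold. *)
Lemma poly_nseq_tt (n : X -> nat) : poly n -> poly (fun x => nseq (n x) tt).
Proof.
apply: poly_comp; apply: poly_recode => [n'|].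
  by rewrite /=; elim: n' => //= n' ->.
apply: bdd_le (bdd_rho _) _ => n'; rewrite /= ltnS.
by elim: n' => //= n' IH; rewrite doubleS !addSn add0n !ltnS.
Qed.

Lemma foldl_nseq n (f : S -> S) s : foldl (fun s _ => f s) s (nseq n tt) = iter n f s.
Proof. by elim: n s => //= n IH s; rewrite IH -iterS iterSr. Qed.

Lemma poly_iter (n : X -> nat) (s0 : X -> S) (f : X -> S -> S) (N : X -> nat) :
  poly n -> poly s0 -> poly (fun p : X * S => f p.1 p.2) -> bdd rho N ->
  (forall x i, i <= n x -> rho (iter i (f x) (s0 x)) <= N x) ->
  poly (fun x => iter (n x) (f x) (s0 x)).
Proof.
move=> pn ps pf bN hN.
apply: (poly_ext (f := fun x => foldl (fun s _ => f x s) (s0 x) (nseq (n x) tt))).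
  apply: (poly_foldl (l := fun x => nseq (n x) tt) (step := fun x s _ => f x s) _ ps _ bN).
  - exact: poly_nseq_tt.
  - by apply: (poly_comp pf (f := fun p => p.1)); ptac.
  move=> x i; rewrite (_ : take i _ = nseq (minn i (n x)) tt).
    by rewrite foldl_nseq hN // geq_minr.
  by elim: i (n x) => [|i IH] [|m] //=; rewrite IH minnSS.
by move=> x; rewrite foldl_nseq.
Qed.

Lemma poly_iter_add (n : X -> nat) (s0 : X -> S) (f : X -> S -> S) (G : X -> nat) :
  poly n -> poly s0 -> poly (fun p : X * S => f p.1 p.2) -> bdd rho G ->
  (forall x s, rho (f x s) <= rho s + G x) ->
  poly (fun x => iter (n x) (f x) (s0 x)).
Proof.
move=> pn ps pf bG hG.
apply: (poly_iter (N := fun x => rho (s0 x) + rho (n x) * G x)) => //; first by bdd_tac.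
move=> x i hi; apply: (@leq_trans (rho (s0 x) + i * G x)).
  elim: i {hi} => [|i IH]; first by rewrite addn0.
  by rewrite iterS mulSn addnCA addnC; apply: leq_trans (hG _ _) _; rewrite leq_add2r.
by rewrite leq_add2l leq_mul2r /=; apply/orP; right; lia.
Qed.

End NatOps.

Lemma poly_predn X (cX : code X) (n : X -> nat) : poly n -> poly (fun x => (n x).-1).
Proof.
move=> pn; apply: (poly_ext (f := fun x => if n x is m.+1 then (fun p => p.2) (x, m) else 0)).
  by apply: (poly_nat_case (f := fun p => p.2)) => //; ptac.
by move=> x; case: (n x).
Qed.

Lemma poly_addn X (cX : code X) (m n : X -> nat) : poly m -> poly n -> poly (fun x => m x + n x).
Proof.
move=> pm pn; apply: (poly_ext (f := fun x => iter (m x) succn (n x))).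
  apply: (poly_iter_add (f := fun _ => succn) (G := fun=> 2)) => //; first by ptac.
    exact: bdd_const.
  by move=> x s /=; lia.
by move=> x; rewrite iter_succn addnC.
Qed.

Lemma poly_subn X (cX : code X) (m n : X -> nat) : poly m -> poly n -> poly (fun x => m x - n x).
Proof.
move=> pm pn; apply: (poly_ext (f := fun x => iter (n x) predn (m x))).
  apply: (poly_iter_add (f := fun _ => predn) (G := fun=> 0)) => //.
  - by cbv beta; apply: poly_predn; ptac.
  - exact: bdd_const.
  - by move=> x s /=; lia.
by move=> x; rewrite iter_predn.
Qed.

Lemma poly_muln X (cX : code X) (m n : X -> nat) : poly m -> poly n -> poly (fun x => m x * n x).
Proof.
move=> pm pn; apply: (poly_ext (f := fun x => iter (m x) (addn (n x)) 0)).
  apply: (poly_iter_add (f := fun x => addn (n x)) (G := fun x => rho (n x))) => //.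
  - by ptac.
  - by cbv beta; apply: poly_addn; ptac; apply: (poly_comp pn (f := fun p => p.1)); ptac.
  - exact: poly_rho.
  - by move=> x s /=; lia.
by move=> x; rewrite iter_addn_0 mulnC.
Qed.

(** In unary, powers have exponential length, so the measure must already account for the result. *)
Lemma poly_expn X (cX : code X) (m n : X -> nat) :
  poly m -> poly n -> bdd rho (fun x => m x ^ n x) ->
  poly (fun x => m x ^ n x).
Proof.
move=> pm pn bN; apply: (poly_ext (f := fun x => iter (n x) (muln (m x)) 1)).
  apply: (poly_iter (f := fun x => muln (m x)) (N := fun x => 2 * (m x ^ n x) + 3)) => //.
  - by ptac.
  - by cbv beta; apply: poly_muln; ptac; apply: (poly_comp pm (f := fun p => p.1)); ptac.
  - exact: bdd_add (bdd_mul (bdd_const _ _) bN) (bdd_const _ _).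
  move=> x i hi; rewrite iter_muln muln1 /= -muln2; case: (m x) => [|b].
    (* For base 0 the first power [0 ^ 0] may exceed the final one; this is what the additive
       constant in the bound pays for. *)
    have : 0 ^ i <= 1 by case: (i) => // j; rewrite exp0n.
    by lia.
  have : b.+1 ^ i <= b.+1 ^ n x by rewrite leq_pexp2l.
  by lia.
by move=> x; rewrite iter_muln muln1.
Qed.

Lemma poly_eq0 X (cX : code X) (n : X -> nat) : poly n -> poly (fun x => n x == 0).
Proof.
move=> pn; apply: (poly_ext (f := fun x => if n x is m.+1 then (fun=> false) (x, m) else true)).
  by apply: (poly_nat_case (f := fun _ => false)) => //; ptac.
by move=> x; case: (n x).
Qed.

Lemma poly_leq X (cX : code X) (m n : X -> nat) : poly m -> poly n -> poly (fun x => m x <= n x).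
Proof. by move=> pm pn; apply: poly_eq0; apply: poly_subn. Qed.

Lemma poly_andb X (cX : code X) (a b : X -> bool) : poly a -> poly b -> poly (fun x => a x && b x).
Proof. by move=> pa pb; apply: poly_if => //; ptac. Qed.

Lemma poly_orb X (cX : code X) (a b : X -> bool) : poly a -> poly b -> poly (fun x => a x || b x).
Proof. by move=> pa pb; apply: poly_if => //; ptac. Qed.

Lemma poly_negb X (cX : code X) (a : X -> bool) : poly a -> poly (fun x => ~~ a x).
Proof.
move=> pa; apply: (poly_if (f := fun=> false) (g := fun=> true) pa); exact: poly_const.
Qed.

Lemma poly_addb X (cX : code X) (a b : X -> bool) : poly a -> poly b -> poly (fun x => a x (+) b x).
Proof.
move=> pa pb; apply: (poly_ext (f := fun x => if a x then ~~ b x else b x)).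
  by apply: poly_if => //; apply: poly_negb.
by move=> x; case: (a x).
Qed.

Lemma poly_eqn X (cX : code X) (m n : X -> nat) : poly m -> poly n -> poly (fun x => m x == n x).
Proof.
move=> pm pn; apply: (poly_ext (f := fun x => (m x <= n x) && (n x <= m x))).
  by apply: poly_andb; apply: poly_leq.
by move=> x; rewrite eqn_leq.
Qed.

Lemma poly_eqb X (cX : code X) (a b : X -> bool) : poly a -> poly b -> poly (fun x => a x == b x).
Proof.
move=> pa pb; apply: (poly_ext (f := fun x => ~~ (a x (+) b x))).
  by apply: poly_negb; apply: poly_addb.
by move=> x; rewrite negb_add.
Qed.

Lemma poly_odd X (cX : code X) (n : X -> nat) : poly n -> poly (fun x => odd (n x)).
Proof.
move=> pn; apply: (poly_ext (f := fun x => iter (n x) negb false)).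
  apply: (poly_iter_add (f := fun _ => negb) (G := fun=> 0)) => //; try by ptac.
  - by cbv beta; apply: poly_negb; ptac.
  - exact: bdd_const.
by move=> x; elim: (n x) => //= i ->.
Qed.

Lemma poly_minn X (cX : code X) (m n : X -> nat) :
  poly m -> poly n -> poly (fun x => minn (m x) (n x)).
Proof.
by move=> pm pn; apply: poly_if => //; apply: poly_leq => //; apply: poly_succ.
Qed.

Ltac ptac_ext ::= lazymatch goal with
  | |- poly (fun x => predn (@?f x)) => simple apply (poly_predn (n := f))
  | |- poly (fun x => addn (@?f x) (@?g x)) => simple apply (poly_addn (m := f) (n := g))
  | |- poly (fun x => subn (@?f x) (@?g x)) => simple apply (poly_subn (m := f) (n := g))
  | |- poly (fun x => muln (@?f x) (@?g x)) => simple apply (poly_muln (m := f) (n := g))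
  | |- poly (fun x => leq (@?f x) (@?g x)) => simple apply (poly_leq (m := f) (n := g))
  | |- poly (fun x => andb (@?f x) (@?g x)) => simple apply (poly_andb (a := f) (b := g))
  | |- poly (fun x => orb (@?f x) (@?g x)) => simple apply (poly_orb (a := f) (b := g))
  | |- poly (fun x => addb (@?f x) (@?g x)) => simple apply (poly_addb (a := f) (b := g))
  | |- poly (fun x => negb (@?f x)) => simple apply (poly_negb (a := f))
  | |- poly (fun x => odd (@?f x)) => simple apply (poly_odd (n := f))
  | |- poly (fun x => minn (@?f x) (@?g x)) => simple apply (poly_minn (m := f) (n := g))
  end.

Lemma rho_rev A (cA : code A) (s : seq A) : rho (rev s) = rho s.
Proof. by rewrite /= map_rev sumn_rev. Qed.

Lemma rho_cat A (cA : code A) (s t : seq A) : rho (s ++ t) + 1 = rho s + rho t.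
Proof. by rewrite /= map_cat sumn_cat; lia. Qed.

Lemma poly_rev X A (cX : code X) (cA : code A) (l : X -> seq A) :
  poly l -> poly (fun x => rev (l x)).
Proof.
move=> pl; apply: (poly_ext (f := fun x => foldl (fun s a => a :: s) [::] (l x))).
  apply: (@poly_foldl_add _ _ _ _ _ _ l (fun=> [::]) (fun x s a => a :: s) pl _ _
    (fun x => rho (l x) + 1)); try by ptac.
    by bdd_tac.
  by move=> x s a ha; rewrite rho_cons; lia.
move=> x; rewrite /rev; elim: (l x) [::] => //= a s IH t; exact: IH.
Qed.

Lemma poly_cat X A (cX : code X) (cA : code A) (l l' : X -> seq A) :
  poly l -> poly l' -> poly (fun x => l x ++ l' x).
Proof.
move=> pl pl'; apply: (poly_ext (f := fun x => foldl (fun s a => a :: s) (l' x) (rev (l x)))).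
  apply: (@poly_foldl_add _ _ _ _ _ _ (fun x => rev (l x)) l' (fun x s a => a :: s) _ pl' _
    (fun x => rho (l x) + 1)); try by ptac.
  - exact: poly_rev.
  - by bdd_tac.
  - by move=> x s a; rewrite rho_rev rho_cons; lia.
by move=> x; rewrite foldl_rev; elim: (l x) => //= a s ->.
Qed.

(* The step may increase the measure by a polynomial in the context and the
   current element. *)
Lemma poly_foldl_step X A B S (cX : code X) (cA : code A) (cB : code B) (cS : code S)
    (l : X -> seq A) (s0 : X -> S) (f : X -> A -> B) (step : X -> S -> A -> S) :
  poly l -> poly s0 -> poly (fun p : X * A => f p.1 p.2) ->
  poly (fun p : X * S * A => step p.1.1 p.1.2 p.2) ->
  (forall x s a, rho (step x s a) <= rho s + rho (f x a) + 1) ->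
  poly (fun x => foldl (step x) (s0 x) (l x)).
Proof.
move=> pl ps pf pstep hs; have [e be] := poly_rho pf.
apply: (@poly_foldl_add _ _ _ _ _ _ l s0 step pl ps pstep
  (fun x => (rho x + rho (l x) + 1 + 2) ^ e + 1)); first by bdd_tac.
move=> x s a ha; apply: leq_trans (hs x s a) _; rewrite -!addnA leq_add2l leq_add2r.
apply: leq_trans (be (x, a)) _; apply: leq_expl; rewrite rho_pair; lia.
Qed.

Lemma poly_map X A B (cX : code X) (cA : code A) (cB : code B)
    (l : X -> seq A) (f : X -> A -> B) :
  poly l -> poly (fun p : X * A => f p.1 p.2) -> poly (fun x => [seq f x a | a <- l x]).
Proof.
move=> pl pf.
apply: (poly_ext (f := fun x => rev (foldl (fun s a => f x a :: s) [::] (l x)))).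
  apply: poly_rev.
  apply: (poly_foldl_step (s0 := fun=> [::]) (step := fun x s a => f x a :: s) pl _ pf).
  - by ptac.
  - apply: poly_cons; last by ptac.
    by apply: (poly_comp pf (f := fun p => (p.1.1, p.2))); ptac.
  - by move=> x s a; rewrite rho_cons; lia.
move=> x; suff h s t : rev (foldl (fun s a => f x a :: s) t s) = rev t ++ [seq f x a | a <- s].
  exact: h.
elim: s t => [|a s IH] t /=; first by rewrite cats0.
by rewrite IH rev_cons cat_rcons.
Qed.

Lemma poly_filter X A (cX : code X) (cA : code A) (l : X -> seq A) (f : X -> A -> bool) :
  poly l -> poly (fun p : X * A => f p.1 p.2) -> poly (fun x => [seq a <- l x | f x a]).
Proof.
move=> pl pf.
apply: (poly_ext (f := fun x =>
    rev (foldl (fun s a => if f x a then a :: s else s) [::] (l x)))).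
  apply: poly_rev.
  apply: (poly_foldl_step (s0 := fun=> [::]) (f := fun x a => a)
    (step := fun x s a => if f x a then a :: s else s) pl); try by ptac.
  - apply: poly_if; try by ptac.
    by apply: (poly_comp pf (f := fun p => (p.1.1, p.2))); ptac.
  - by move=> x s a; case: ifP => _; rewrite ?rho_cons; lia.
move=> x; suff h s t : rev (foldl (fun s a => if f x a then a :: s else s) t s) =
    rev t ++ [seq a <- s | f x a] by exact: h.
elim: s t => [|a s IH] t /=; first by rewrite cats0.
by rewrite IH; case: ifP => _ //; rewrite rev_cons cat_rcons.
Qed.

Lemma poly_flatten X A (cX : code X) (cA : code A) (l : X -> seq (seq A)) :
  poly l -> poly (fun x => flatten (l x)).
Proof.
move=> pl; apply: (poly_ext (f := fun x => foldl cat [::] (l x))).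
  apply: (poly_foldl_step (s0 := fun=> [::]) (f := fun x a => a)
    (step := fun _ => cat) pl); try by ptac.
  - by cbv beta; apply: poly_cat; ptac.
  - by move=> x s a; have := rho_cat cA s a; lia.
move=> x; rewrite -[RHS]cat0s; elim: (l x) [::] => [|a s IH] t /=; first by rewrite cats0.
by rewrite IH catA.
Qed.

Lemma poly_size X A (cX : code X) (cA : code A) (l : X -> seq A) :
  poly l -> poly (fun x => size (l x)).
Proof.
move=> pl; apply: (poly_ext (f := fun x => foldl (fun n _ => n.+1) 0 (l x))).
  apply: (poly_foldl_step (s0 := fun=> 0) (f := fun _ _ => tt)
    (step := fun _ n _ => n.+1) pl); try by ptac.
  by move=> x s a /=; lia.
by move=> x; rewrite -[RHS]add0n; elim: (l x) 0 => [|a s IH] n /=; rewrite ?addn0 // IH addSnnS.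
Qed.

Lemma poly_sumn X (cX : code X) (l : X -> seq nat) : poly l -> poly (fun x => sumn (l x)).
Proof.
move=> pl; apply: (poly_ext (f := fun x => foldl addn 0 (l x))).
  apply: (poly_foldl_step (s0 := fun=> 0) (f := fun _ a => a)
    (step := fun _ => addn) pl); try by ptac.
  by move=> x s a /=; lia.
by move=> x; rewrite -[RHS]add0n; elim: (l x) 0 => [|a s IH] n /=; rewrite ?addn0 // IH addnA.
Qed.

Lemma poly_has X A (cX : code X) (cA : code A) (l : X -> seq A) (f : X -> A -> bool) :
  poly l -> poly (fun p : X * A => f p.1 p.2) -> poly (fun x => has (f x) (l x)).
Proof.
move=> pl pf; apply: (poly_ext (f := fun x => ~~ (size [seq a <- l x | f x a] == 0))).
  by apply: poly_negb; apply: poly_eq0; apply: poly_size; apply: poly_filter.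
by move=> x; rewrite has_count size_filter lt0n.
Qed.

Lemma poly_all X A (cX : code X) (cA : code A) (l : X -> seq A) (f : X -> A -> bool) :
  poly l -> poly (fun p : X * A => f p.1 p.2) -> poly (fun x => all (f x) (l x)).
Proof.
move=> pl pf; apply: (poly_ext (f := fun x => ~~ has (fun a => ~~ f x a) (l x))).
  by apply: poly_negb; apply: poly_has => //; apply: poly_negb.
by move=> x; rewrite has_predC negbK.
Qed.

Lemma poly_count X A (cX : code X) (cA : code A) (l : X -> seq A) (f : X -> A -> bool) :
  poly l -> poly (fun p : X * A => f p.1 p.2) -> poly (fun x => count (f x) (l x)).
Proof.
move=> pl pf; apply: (poly_ext (f := fun x => size [seq a <- l x | f x a])).
  by apply: poly_size; apply: poly_filter.
by move=> x; rewrite size_filter.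
Qed.

Lemma rho_iota m n : rho (iota m n) <= n * (2 * (m + n) + 2) + 1.
Proof.
rewrite /= addn1 ltnS; suff h k : sumn [seq (i.*2.+1).+1 | i <- iota m k] <= k * (2 * (m + k) + 2).
  exact: h.
elim: k => // k IH; rewrite -addn1 iotaD map_cat sumn_cat /= -muln2; nia.
Qed.

Lemma poly_iota X (cX : code X) (m n : X -> nat) :
  poly m -> poly n -> poly (fun x => iota (m x) (n x)).
Proof.
move=> pm pn.
apply: (poly_ext (f := fun x => rev (iter (n x) (fun s => m x + size s :: s) [::]))).
  apply: poly_rev.
  have iE x i : iter i (fun s => m x + size s :: s) [::] = rev (iota (m x) i).
    elim: i => // i IH.
    by rewrite iterS IH size_rev size_iota -[in RHS]addn1 iotaD rev_cat.
  apply: (poly_iter (f := fun x s => m x + size s :: s)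
    (N := fun x => rho (n x) * (2 * (rho (m x) + rho (n x)) + 2) + 1)) => //.
  - exact: poly_const.
  - apply: poly_cons; last by ptac.
    apply: poly_addn; first by apply: (poly_comp pm (f := fun p => p.1)); ptac.
    by apply: poly_size; ptac.
  - by bdd_tac.
  move=> x i hi; rewrite iE rho_rev; apply: leq_trans (rho_iota _ _) _.
  by rewrite leq_add2r leq_mul //=; lia.
move=> x; elim: (n x) => // i IH.
rewrite iterS rev_cons IH -[in RHS]addn1 iotaD cats1; congr (rcons _ (_ + _)).
by rewrite -(size_rev (iter _ _ _)) IH size_iota.
Qed.

Lemma poly_nseq X A (cX : code X) (cA : code A) (n : X -> nat) (a : X -> A) :
  poly n -> poly a -> poly (fun x => nseq (n x) (a x)).
Proof.
move=> pn pa; apply: (poly_ext (f := fun x => [seq a x | _ <- iota 0 (n x)])).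
  apply: (poly_map (f := fun x _ => a x)).
    by apply: poly_iota => //; ptac.
  by apply: (poly_comp pa (f := fun p => p.1)); ptac.
by move=> x; elim: (n x) 0 => //= m IH k; rewrite IH.
Qed.

Lemma poly_behead X A (cX : code X) (cA : code A) (l : X -> seq A) :
  poly l -> poly (fun x => behead (l x)).
Proof.
move=> pl; apply: (poly_ext (f := fun x =>
    if l x is a :: l' then (fun p : X * (A * seq A) => p.2.2) (x, (a, l')) else [::])).
  by apply: (poly_seq_case (f := fun p : X * (A * seq A) => p.2.2)) => //; ptac.
by move=> x; case: (l x).
Qed.

Lemma poly_head X A (cX : code X) (cA : code A) (d : X -> A) (l : X -> seq A) :
  poly d -> poly l -> poly (fun x => head (d x) (l x)).
Proof.
move=> pd pl; apply: (poly_ext (f := fun x =>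
    if l x is a :: l' then (fun p : X * (A * seq A) => p.2.1) (x, (a, l')) else d x)).
  by apply: (poly_seq_case (f := fun p : X * (A * seq A) => p.2.1)) => //; ptac.
by move=> x; case: (l x).
Qed.

Lemma poly_drop X A (cX : code X) (cA : code A) (n : X -> nat) (l : X -> seq A) :
  poly n -> poly l -> poly (fun x => drop (n x) (l x)).
Proof.
move=> pn pl; apply: (poly_ext (f := fun x => iter (n x) behead (l x))).
  apply: (poly_iter_add (f := fun _ => behead) (G := fun=> 0)) => //.
  - by cbv beta; apply: poly_behead; ptac.
  - exact: bdd_const.
  - by move=> x s; rewrite addn0 -drop1; apply: rho_drop.
by move=> x; elim: (n x) => [|i IH]; rewrite ?drop0 // iterS IH -drop1 drop_drop add1n.
Qed.

Lemma poly_take X A (cX : code X) (cA : code A) (n : X -> nat) (l : X -> seq A) :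
  poly n -> poly l -> poly (fun x => take (n x) (l x)).
Proof.
move=> pn pl; apply: (poly_ext (f := fun x => rev (drop (size (l x) - n x) (rev (l x))))).
  apply: poly_rev; apply: poly_drop; last exact: poly_rev.
  by apply: poly_subn => //; apply: poly_size.
move=> x; rewrite drop_rev revK (_ : _ - (_ - _) = minn (n x) (size (l x))).
  by rewrite take_min take_size.
by lia.
Qed.

Lemma poly_nth X A (cX : code X) (cA : code A) (d : X -> A) (l : X -> seq A) (n : X -> nat) :
  poly d -> poly l -> poly n -> poly (fun x => nth (d x) (l x) (n x)).
Proof.
move=> pd pl pn; apply: (poly_ext (f := fun x => head (d x) (drop (n x) (l x)))).
  by apply: poly_head => //; apply: poly_drop.
by move=> x; rewrite -nth0 nth_drop addn0.
Qed.

Lemma poly_eqseq X (A : eqType) (cX : code X) (cA : code A) (d : A) (s t : X -> seq A) :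
  poly (fun p : A * A => p.1 == p.2) -> poly s -> poly t -> poly (fun x => s x == t x).
Proof.
move=> pe ps pt; apply: (poly_ext (f := fun x => (size (s x) == size (t x)) &&
    all (fun i => nth d (s x) i == nth d (t x) i) (iota 0 (size (s x))))).
  apply: poly_andb; first by apply: poly_eqn; apply: poly_size.
  apply: (poly_all (f := fun x i => nth d (s x) i == nth d (t x) i)).
    by apply: poly_iota; [apply: poly_const | apply: poly_size].
  apply: (poly_comp pe (f := fun p => (nth d (s p.1) p.2, nth d (t p.1) p.2))).
  by apply: poly_pair; apply: poly_nth; ptac.
move=> x; apply/andP/eqP => [[/eqP es /allP h]|->]; last first.
  by split=> //; apply/allP.
apply: (@eq_from_nth _ d) => // i hi.
by apply/eqP/h; rewrite mem_iota.
Qed.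

Lemma poly_eqpair X (A B : eqType) (cX : code X) (cA : code A) (cB : code B)
    (s t : X -> A * B) :
  poly (fun p : A * A => p.1 == p.2) -> poly (fun p : B * B => p.1 == p.2) ->
  poly s -> poly t -> poly (fun x => s x == t x).
Proof.
move=> pA pB ps pt.
apply: (poly_ext (f := fun x => ((s x).1 == (t x).1) && ((s x).2 == (t x).2))).
  apply: poly_andb.
    by apply: (poly_comp pA (f := fun x => ((s x).1, (t x).1))); ptac.
  by apply: (poly_comp pB (f := fun x => ((s x).2, (t x).2))); ptac.
by move=> x; case: (s x) (t x) => [a b] [c d].
Qed.

Lemma poly_mem X (A : eqType) (cX : code X) (cA : code A) (a : X -> A) (l : X -> seq A) :
  poly (fun p : A * A => p.1 == p.2) -> poly a -> poly l -> poly (fun x => a x \in l x).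
Proof.
move=> pe pa pl; apply: (poly_ext (f := fun x => has (fun b => b == a x) (l x))).
  apply: (poly_has (f := fun x b => b == a x)) => //.
  by apply: (poly_comp pe (f := fun p => (p.2, a p.1))); ptac.
by move=> x; rewrite has_pred1.
Qed.

Ltac ptac_lib := lazymatch goal with
  | |- poly (fun x => predn (@?f x)) => simple apply (poly_predn (n := f))
  | |- poly (fun x => addn (@?f x) (@?g x)) => simple apply (poly_addn (m := f) (n := g))
  | |- poly (fun x => subn (@?f x) (@?g x)) => simple apply (poly_subn (m := f) (n := g))
  | |- poly (fun x => muln (@?f x) (@?g x)) => simple apply (poly_muln (m := f) (n := g))
  | |- poly (fun x => leq (@?f x) (@?g x)) => simple apply (poly_leq (m := f) (n := g))
  | |- poly (fun x => andb (@?f x) (@?g x)) => simple apply (poly_andb (a := f) (b := g))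
  | |- poly (fun x => orb (@?f x) (@?g x)) => simple apply (poly_orb (a := f) (b := g))
  | |- poly (fun x => addb (@?f x) (@?g x)) => simple apply (poly_addb (a := f) (b := g))
  | |- poly (fun x => negb (@?f x)) => simple apply (poly_negb (a := f))
  | |- poly (fun x => odd (@?f x)) => simple apply (poly_odd (n := f))
  | |- poly (fun x => minn (@?f x) (@?g x)) => simple apply (poly_minn (m := f) (n := g))
  | |- poly (fun x => rev (@?f x)) => simple apply (poly_rev (l := f))
  | |- poly (fun x => @cat _ (@?f x) (@?g x)) => simple apply (poly_cat (l := f) (l' := g))
  | |- poly (fun x => map (@?f x) (@?l x)) => simple apply (poly_map (f := f) (l := l))
  | |- poly (fun x => filter (@?f x) (@?l x)) => simple apply (poly_filter (f := f) (l := l))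
  | |- poly (fun x => has (@?f x) (@?l x)) => simple apply (poly_has (f := f) (l := l))
  | |- poly (fun x => all (@?f x) (@?l x)) => simple apply (poly_all (f := f) (l := l))
  | |- poly (fun x => count (@?f x) (@?l x)) => simple apply (poly_count (f := f) (l := l))
  | |- poly (fun x => flatten (@?l x)) => simple apply (poly_flatten (l := l))
  | |- poly (fun x => size (@?l x)) => simple apply (poly_size (l := l))
  | |- poly (fun x => sumn (@?l x)) => simple apply (poly_sumn (l := l))
  | |- poly (fun x => iota (@?m x) (@?n x)) => simple apply (poly_iota (m := m) (n := n))
  | |- poly (fun x => nseq (@?n x) (@?a x)) => simple apply (poly_nseq (n := n) (a := a))
  | |- poly (fun x => behead (@?l x)) => simple apply (poly_behead (l := l))
  | |- poly (fun x => head (@?d x) (@?l x)) => simple apply (poly_head (d := d) (l := l))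
  | |- poly (fun x => drop (@?n x) (@?l x)) => simple apply (poly_drop (n := n) (l := l))
  | |- poly (fun x => take (@?n x) (@?l x)) => simple apply (poly_take (n := n) (l := l))
  | |- poly (fun x => nth (@?d x) (@?l x) (@?n x)) =>
      simple apply (poly_nth (d := d) (l := l) (n := n))
  | |- poly (fun x => @eq_op _ (@?m x) (@?n x)) =>
      first [ apply: (poly_eqn (m := m) (n := n)) | apply: (poly_eqb (a := m) (b := n))
            | apply: (poly_eqpair (s := m) (t := n))
            | apply: (poly_eqseq 0 (s := m) (t := n))
            | apply: (poly_eqseq false (s := m) (t := n))
            | apply: (poly_eqseq (0, 0) (s := m) (t := n)) ]
  | |- poly (fun x => in_mem (@?a x) (mem (@?l x))) => apply: (@poly_mem _ _ _ _ a l)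
  | H : poly (fun p => ?F p.1 p.2) |- poly (fun x => ?F (@?f x) (@?g x)) =>
      simple apply (poly_comp (g := fun p => F p.1 p.2) (f := fun x => (f x, g x)) H)
  | H : poly ?F |- poly (fun x => ?F (@?g x)) => simple apply (poly_comp (g := F) (f := g) H)
  | H : poly (fun a => ?F a) |- poly (fun x => ?F (@?g x)) =>
      simple apply (poly_comp (g := F) (f := g) H)
  end.

Ltac ptac_ext ::= ptac_lib.

(** * Simulating a Turing machine *)

#[global] Program Instance code_option A (cA : code A) : code (option A) :=
  {| cod o := if o is Some a then Nd (cod a) Lf else Lf;
     rho o := if o is Some a then rho a + 2 else 1 |}.
Next Obligation. by case: a => //= a; rewrite size_cat addn1 addn2 !ltnS rho_ge. Qed.

Lemma poly_some X A (cX : code X) (cA : code A) (a : X -> A) :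
  poly a -> poly (fun x => Some (a x)).
Proof.
move=> pa; apply: (poly_comp (g := fun p : A * unit => Some p.1) (f := fun x => (a x, tt))).
  apply: poly_recode => [[a' []]//|].
  by apply: bdd_le (bdd_rho _) _ => -[a' []] /=; lia.
by ptac.
Qed.

Lemma poly_option_case X A B (cX : code X) (cA : code A) (cB : code B)
    (o : X -> option A) (f : X * A -> B) (g : X -> B) :
  poly o -> poly f -> poly g -> poly (fun x => if o x is Some a then f (x, a) else g x).
Proof.
move=> po pf pg; apply: (poly_match (D := A * unit) (f := fun p => f (p.1, p.2.1)) po pg).
  by apply: (poly_comp pf (f := fun p => (p.1, p.2.1))); ptac.
move=> x; case: (o x) => [a|]; last by left.
by right; exists (a, tt); split=> //=; lia.
Qed.

(** No assumption on [f] is needed: only finitely many arguments occur, and the table is written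
    into the program as nested case distinctions. *)
Lemma poly_table X B (cX : code X) (cB : code B) (N : nat) (f : nat -> option bool -> B)
    (n : X -> nat) (o : X -> option bool) : poly n -> poly o ->
  poly (fun x => f (minn (n x) N) (o x)).
Proof.
move=> pn po.
have pN (g : nat -> B) : poly (fun n => g (minn n N)).
  elim: N g => [|N IH] g.
    by apply: (poly_ext (f := fun=> g 0)) => [|m]; [ptac | rewrite minn0].
  have {}IH := IH (fun m => g m.+1).
  apply: (poly_ext (f := fun n => if n is m.+1 then
      (fun p : nat * nat => g (minn p.2 N).+1) (n, m) else g 0)).
    apply: (poly_nat_case (n := fun n => n) (f := fun p => g (minn p.2 N).+1)); try by ptac.
    by apply: (poly_comp IH (f := snd)); ptac.
  by case=> [|m]; rewrite ?min0n ?minnSS.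
have pF a : poly (fun x => f (minn (n x) N) a).
  by apply: (poly_comp (pN (f^~ a)) (f := n)).
have pG a : poly (fun p : X * bool => f (minn (n p.1) N) a).
  by apply: (poly_comp (pF a) (f := fst)); ptac.
apply: (poly_ext (f := fun x => if o x is Some b then
    (fun p : X * bool => if p.2 then f (minn (n p.1) N) (Some true)
                         else f (minn (n p.1) N) (Some false)) (x, b)
    else f (minn (n x) N) None)).
  apply: (poly_option_case (f := fun p : X * bool => if p.2 then f (minn (n p.1) N) (Some true)
                         else f (minn (n p.1) N) (Some false))) => //.
  by apply: poly_if => //; ptac.
by move=> x; case: (o x) => [[]|].
Qed.

Section Simulation.

Variable M : TM.
Let N := tm_nq M.

Definition conf := (nat * (seq (option bool) * (option bool * seq (option bool))))%type.

Definition conf_of (c : config M) : conf :=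
  (nat_of_ord (c_state c), (c_left c, (c_head c, c_right c))).

Definition trans (q : nat) (a : option bool) : nat * (option bool * (bool * bool)) :=
  let r := tm_delta (inord q : 'I_(tm_nq M).+1) a in
  (nat_of_ord r.1.1, (r.1.2, (if r.2 is MLeft then true else false,
                              if r.2 is MRight then true else false))).

Definition move_conf (r : nat * (option bool * (bool * bool))) (c : conf) : conf :=
  (r.1, if r.2.2.1 then (behead c.2.1, (head None c.2.1, r.2.1 :: c.2.2.2))
        else if r.2.2.2 then (r.2.1 :: c.2.1, (head None c.2.2.2, behead c.2.2.2))
        else (c.2.1, (r.2.1, c.2.2.2))).

(** The flag is the control component for [poly_while]. The minimum with [N] changes no state of the
    machine; it makes the transition function a finite table for every argument. *)
Definition sim_step (s : bool * conf) : bool * conf :=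
  let c := move_conf (trans (minn s.2.1 N) s.2.2.2.1) s.2 in (~~ (c.1 == N), c).

Lemma poly_sim_step : poly sim_step.
Proof.
have pm : poly (fun p => move_conf p.1 p.2) by rewrite /move_conf; ptac.
have ps : poly (fun s : bool * conf =>
    move_conf (trans (minn s.2.1 N) s.2.2.2.1) s.2).
  apply: (poly_comp pm (f := fun s => (trans (minn s.2.1 N) s.2.2.2.1, s.2))).
  by apply: poly_pair; [apply: poly_table; ptac | ptac].
by apply: poly_pair => //; ptac.
Qed.

Lemma sim_stepE (c : config M) b : c_state c <> tm_halt M ->
  sim_step (b, conf_of c) = (~~ (c_state (tm_step c) == N :> nat), conf_of (tm_step c)).
Proof.
case: c => q l h r /= /eqP/negbTE nh; rewrite /sim_step /= nh.
rewrite (minn_idPl _); last by rewrite -ltnS ltn_ord.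
rewrite /move_conf /trans /= inord_val; case: (tm_delta q h) => [[q' w] mv] /=.
by case: mv => //=; [case: l => [|a l] | case: r => [|a r]].
Qed.

Lemma size_conf (c : config M) :
  size (c_left (tm_step c)) + size (c_right (tm_step c)) <=
  (size (c_left c) + size (c_right c)).+1.
Proof.
case: c => q l h r; rewrite /tm_step; case: (q == _); first exact: leqnSn.
case: tm_delta => [[q' w] mv]; case: mv => /=; last exact: leqnSn.
  by case: l => [|a l] /=; lia.
by case: r => [|a r] /=; lia.
Qed.

Lemma rho_conf (c : config M) :
  rho (conf_of c) <= 2 * N + 6 * (size (c_left c) + size (c_right c)) + 20.
Proof.
have ro (s : seq (option bool)) : rho s <= 6 * size s + 1.
  by elim: s => // a s IH; rewrite rho_cons; case: a => [[]|] /=; rewrite /= in IH; lia.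
rewrite !rho_pair; have := ro (c_left c); have := ro (c_right c).
have : rho (c_head c) <= 5 by case: (c_head c).
have : rho (nat_of_ord (c_state c)) <= 2 * N + 1.
  by rewrite /= -muln2; have := ltn_ord (c_state c); rewrite -/N; lia.
set a := rho _; set b := rho _; set d := rho _; set e := rho _; lia.
Qed.

(** The flag records that a blank has been met, which turns the truncation into a left fold. *)
Lemma read_outE s : read_out s =
  rev (foldl (fun p a => if p.1 then p else
         if a is Some b then (p.1, b :: p.2) else (true, p.2)) (false, [::]) s).2.
Proof.
set f := fun _ _ => _.
have fT t r : foldl f (true, r) t = (true, r) by elim: t.
suff h r : rev (foldl f (false, r) s).2 = rev r ++ read_out s by rewrite h.
elim: s r => [|[b|] s IH] r /=; rewrite ?cats0 //.
  by rewrite IH rev_cons cat_rcons.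
by rewrite fT.
Qed.

Lemma poly_read_out X (cX : code X) (s : X -> seq (option bool)) :
  poly s -> poly (fun x => read_out (s x)).
Proof.
move=> ps; pose f (p : bool * seq bool) (a : option bool) := if p.1 then p else
  if a is Some b then (p.1, b :: p.2) else (true, p.2).
apply: (poly_ext (f := fun x => rev (foldl f (false, [::]) (s x)).2)); last first.
  by move=> x; rewrite read_outE.
apply: poly_rev; apply: poly_snd.
apply: (poly_foldl_step (s0 := fun=> (false, [::])) (f := fun _ _ => true)
  (step := fun _ => f) ps); try by ptac.
- rewrite /f; apply: poly_if; try by ptac.
  apply: (poly_ext (f := fun x : X * (bool * seq bool) * option bool => if x.2 is Some b then
     (fun z : X * (bool * seq bool) * option bool * bool => (z.1.1.2.1, z.2 :: z.1.1.2.2)) (x, b)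
     else (true, x.1.2.2))) => [|[[x p] [b|]]] //.
  by apply: (poly_option_case (f := fun z : X * (bool * seq bool) * option bool * bool =>
    (z.1.1.2.1, z.2 :: z.1.1.2.2))); ptac.
move=> x p a; rewrite /f; case: ifP => _; first lia.
by case: a => [b|]; rewrite !rho_pair ?rho_cons /=; lia.
Qed.

(* A machine can be used as an oracle wherever the measure of the argument
   accounts for its running time. *)
Lemma poly_run X (cX : code X) (input out : X -> seq bool) (T : X -> nat) :
  poly input -> bdd rho T -> (forall x, halts_within M (input x) (T x) (out x)) -> poly out.
Proof.
move=> pI bT hM.
pose c0 x := tm_init M (input x).
have pc0 : poly (fun x => conf_of (c0 x)).
  have pS : poly (fun b : bool => Some b) by apply: poly_some; ptac.
  apply: (poly_ext (f := fun x => (0, ([::], (head None [seq Some b | b <- input x],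
      behead [seq Some b | b <- input x]))))); first by ptac.
  by move=> x; rewrite /c0; case: (input x).
pose s0 x := (~~ ((conf_of (c0 x)).1 == N), conf_of (c0 x)).
have pfin : poly (fun x => conf_of (iter (T x) (@tm_step M) (c0 x))).
  apply: (poly_while (h := sim_step) (s0 := s0)
    (N := fun x => T x + (2 * N + 6 * (rho (input x) + T x) + 24))).
  - exact: poly_sim_step.
  - by rewrite /s0; ptac.
  - by bdd_tac.
  move=> x; cbv beta; have [hT _] := hM x.
  pose halted i := c_state (iter i (@tm_step M) (c0 x)) == tm_halt M.
  have ex : exists i, halted i by exists (T x); apply/eqP.
  (* [T x] only bounds the halting time, whereas the loop must end at its first leaf; hence the
     least halting time. The halted configuration does not change afterwards. *)
  case: (ex_minnP ex) => n hn nmin.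
  have nT : n <= T x by apply: nmin; apply/eqP.
  have simE i : i <= n -> iter i sim_step (s0 x) =
      (~~ halted i, conf_of (iter i (@tm_step M) (c0 x))).
    elim: i => [|i IH] hi; first by rewrite /s0 /halted.
    rewrite iterS IH ?sim_stepE //; last exact: ltnW.
    by apply/eqP/negP => hh; have := nmin i hh; rewrite leqNgt hi.
  exists n; split.
  - by lia.
  - move=> i hi; rewrite simE ?[i <= n]ltnW //= ifT //.
    by apply/negP => hh; have := nmin i hh; rewrite leqNgt hi.
  - by rewrite simE //= hn.
  - by rewrite simE // -[in RHS](subnK nT) iterD (iter_halted _ (eqP hn)).
  - move=> i hi; rewrite simE // rho_pair.
    have size_i j : size (c_left (iter j (@tm_step M) (c0 x))) +
        size (c_right (iter j (@tm_step M) (c0 x))) <= size (input x) + j.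
      elim: j => [|j IH]; last by rewrite addnS; apply: leq_trans (size_conf _) _.
      by rewrite /c0; case: (input x) => //= _ y; rewrite size_map addn0.
    have := rho_conf (iter i (@tm_step M) (c0 x)); have := size_i i.
    have := @size_rho _ code_bool (input x).
    by set a := rho _; set b := rho _; have -> : rho (~~ halted i) = 3 by []; lia.
apply: (poly_ext (f := fun x => read_out ((conf_of (iter (T x) (@tm_step M) (c0 x))).2.2.1 ::
    (conf_of (iter (T x) (@tm_step M) (c0 x))).2.2.2))).
  by apply: poly_read_out; ptac.
by move=> x; have [_ <-] := hM x.
Qed.

End Simulation.

(** * From polynomial-time functions to Turing machines *)

Definition cons_bit (b : bool) : seq bool := true :: flat (cod b).

(** The stack [R] yields the input from its last bit on, so each bit can simply be put in front of
    the list built so far. *)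
Definition load : sprog :=
  Seq (Push VA false)
    (While VR isSome (Pop VR Skip (push_seq (cons_bit false)) (push_seq (cons_bit true)))).

Lemma load_ok x : runs load (Store (rev x) [::] [::] [::] [::]) (7 * size x + 2)
  (Store [::] (flat (cod x)) [::] [::] [::]).
Proof.
have loop z y : runs (While VR isSome (Pop VR Skip (push_seq (cons_bit false))
      (push_seq (cons_bit true)))) (Store z (flat (cod y)) [::] [::] [::]) (7 * size z + 1)
    (Store [::] (flat (cod (rev z ++ y))) [::] [::] [::]).
  elim: z y => [|b z IH] y; first by apply: runs_stop.
  rewrite rev_cons cat_rcons.
  have step : runs (Pop VR Skip (push_seq (cons_bit false)) (push_seq (cons_bit true)))
      (Store (b :: z) (flat (cod y)) [::] [::] [::]) 5
      (Store z (flat (cod (b :: y))) [::] [::] [::]).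
    apply: runs_popR.
    by case: b; [apply: runs_le (push_seq_ok (cons_bit true) z _) _
                |apply: runs_le (push_seq_ok (cons_bit false) z _) _].
  by apply: runs_le (runs_loop _ step (IH (b :: y))) _ => //=; lia.
have -> : 7 * size x + 2 = 1 + (7 * size (rev x) + 1) by rewrite size_rev; lia.
apply: runs_seq; first exact: runs_push.
by have := loop (rev x) [::]; rewrite revK cats0; apply.
Qed.

(** After the bit of the list constructor, [false] takes one bit and [true] takes three; the two
    extra pops remove the leaves in the code of [true]. *)
Definition unload_bits : sprog :=
  Seq (While VA is_true_top (Seq pop_top (Pop VA Skip (Push VR false)
         (Seq pop_top (Seq pop_top (Push VR true)))))) pop_top.

Lemma unload_bits_ok y : runs unload_bits (Store [::] (flat (cod y)) [::] [::] [::])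
  (6 * size y + 2) (Store (rev y) [::] [::] [::] [::]).
Proof.
have pop b r x : runs pop_top (Store r (b :: x) [::] [::] [::]) 1 (Store r x [::] [::] [::]).
  exact: (pop_top_ok b [::] r x).
have loop r : runs (While VA is_true_top (Seq pop_top (Pop VA Skip (Push VR false)
      (Seq pop_top (Seq pop_top (Push VR true))))))
    (Store r (flat (cod y)) [::] [::] [::]) (6 * size y + 1)
    (Store (rev y ++ r) [:: false] [::] [::] [::]).
  elim: y r => [|b y IH] r; first by apply: runs_stop.
  rewrite rev_cons cat_rcons.
  apply: (runs_le (t := (5 + (6 * size y + 1)).+1)); last by rewrite /=; lia.
  apply: runs_loop (IH _) => //.
  apply: (runs_seq (t1 := 1) (t2 := 4) (pop _ _ _)).
  case: b; apply: runs_popA; last exact: runs_le (runs_push _ _ _) _.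
  apply: (runs_seq (t1 := 1) (t2 := 2) (pop _ _ _)).
  apply: (runs_seq (t1 := 1) (t2 := 1) (pop _ _ _)).
  exact: runs_push.
have -> : 6 * size y + 2 = (6 * size y + 1) + 1 by lia.
by apply: runs_seq (pop _ _ _); rewrite -[rev y]cats0; apply: loop.
Qed.

(** [X] may carry a larger measure than the string that codes it. In this way costs depending on the
    parameter enter the time bound of a machine that sees only the string. *)
Lemma poly_halts X (cX : code X) (input f : X -> seq bool) :
  (forall x, cod x = cod (input x)) -> poly f ->
  exists M T, bdd rho T /\ forall x, halts_within M (input x) (T x) (f x).
Proof.
move=> hc pf; have [P [t [bt ht rt]]] := pf.
pose u x := (7 * size (input x) + 2) + (t x + (6 * size (f x) + 2)).
exists (tprog_tm (main_prog (Seq load (Seq P unload_bits)))),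
  (fun x => 60 * (size (input x) + u x + 1) * u x + 10); split.
  have b1 : bdd rho (fun x : X => size (input x)).
    apply: bdd_le (rho_flat _) _ => x; rewrite hc; elim: (input x) => //= b y IH.
    by rewrite size_cat; lia.
  have b2 : bdd rho (fun x : X => size (f x)).
    by apply: bdd_le rt _ => x; apply: ltnW; apply: size_rho.
  by rewrite /u; bdd_tac.
move=> x; have [T' leT ev] : runs (Seq load (Seq P unload_bits))
    (Store (rev (input x)) [::] [::] [::] [::]) (u x) (Store (rev (f x)) [::] [::] [::] [::]).
  apply: runs_seq; first exact: load_ok.
  apply: runs_seq; last exact: unload_bits_ok.
  by have := ht x [::] [::]; rewrite !cats0 hc.
apply: halts_within_mono (main_prog_halts ev) _.
by rewrite leq_add2r leq_mul // leq_mul2l; apply/orP; right; lia.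
Qed.

Lemma poly_enc_nat X (cX : code X) (n : X -> nat) : poly n -> poly (fun x => enc_nat (n x)).
Proof.
move=> pn; apply: (poly_ext (f := fun x => nseq (n x) true ++ [:: false])); first by ptac.
by move=> x; rewrite cats1.
Qed.

Lemma poly_enc_seq X (cX : code X) (s : X -> seq nat) :
  poly s -> poly (fun x => enc_seq (s x)).
Proof.
move=> ps; rewrite /enc_seq; apply: poly_cat; first by apply: poly_enc_nat; ptac.
apply: poly_flatten; apply: (poly_map (f := fun _ => enc_nat)) => //.
by apply: poly_enc_nat; ptac.
Qed.

Definition tokens (x : seq bool) : seq nat :=
  rev (foldl (fun p (b : bool) => if b then (p.1.+1, p.2) else (0, p.1 :: p.2))
    (0, [::]) x).2.

Lemma poly_tokens : poly tokens.
Proof.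
apply: poly_rev; apply: poly_snd.
apply: (poly_foldl_step (s0 := fun=> (0, [::])) (f := fun _ _ => tt) (l := fun x => x)
  (step := fun _ p (b : bool) => if b then (p.1.+1, p.2) else (0, p.1 :: p.2))); try by ptac.
by move=> x [n s] b; case: b; rewrite !rho_pair ?rho_cons /=; lia.
Qed.

Lemma tokensE s : tokens (flatten [seq enc_nat n | n <- s]) = s.
Proof.
rewrite /tokens; set f := fun _ _ => _.
have fn n k r t : foldl f (k, r) (nseq n true ++ t) = foldl f (n + k, r) t.
  by elim: n k => //= n IH k; rewrite /f /= -/f IH addnS.
suff h r : foldl f (0, r) (flatten [seq enc_nat n | n <- s]) = (0, rev s ++ r).
  by rewrite h cats0 revK.
elim: s r => //= n s IH r; rewrite /enc_nat -cats1 -catA fn addn0 /=.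
by rewrite IH rev_cons cat_rcons.
Qed.

(** * Words *)

Definition words_step (A : Type) (s : seq A) (L : seq (seq A)) : seq (seq A) :=
  flatten [seq [seq a :: w | w <- L] | a <- s].

Definition words (A : Type) (s : seq A) (d : nat) : seq (seq A) :=
  iter d (words_step s) [:: [::]].

Arguments words : simpl never.

Lemma size_words_step A (s : seq A) L : size (words_step s L) = size s * size L.
Proof. by rewrite /words_step; elim: s => //= a s IH; rewrite size_cat size_map IH mulSn. Qed.

Lemma size_words A (s : seq A) d : size (words s d) = size s ^ d.
Proof. by elim: d => // d IH; rewrite /words iterS size_words_step IH expnS. Qed.

Lemma mem_words_step (A : eqType) (s : seq A) L w :
  (w \in words_step s L) = if w is a :: w' then (a \in s) && (w' \in L) else false.
Proof.
apply/flatten_mapP/idP => [[a ha /mapP[w' hw ->]]|]; first by rewrite ha.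
by case: w => // a w /andP[ha hw]; exists a => //; apply: map_f.
Qed.

Lemma mem_words (A : eqType) (s : seq A) d w :
  (w \in words s d) = (size w == d) && all (mem s) w.
Proof.
elim: d w => [|d IH] w; first by rewrite inE -size_eq0; case: w.
by rewrite /words iterS mem_words_step; case: w => // a w; rewrite IH /= eqSS andbCA.
Qed.

Lemma uniq_words_step (A : eqType) (s : seq A) L :
  uniq s -> uniq L -> uniq (words_step s L).
Proof.
move=> us uL; have := @allpairs_uniq _ _ _ cons s L us uL.
by apply=> -[a x] [b y] _ _ [-> ->].
Qed.

Lemma uniq_words (A : eqType) (s : seq A) d : uniq s -> uniq (words s d).
Proof. by move=> us; elim: d => // d IH; rewrite /words iterS uniq_words_step. Qed.

Fixpoint upto (A : Type) (D : nat) (s : seq A) : seq (seq A) :=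
  if D is D'.+1 then upto D' s ++ words s D else [:: [::]].

Lemma mem_upto (A : eqType) (s : seq A) D w :
  (w \in upto D s) = (size w <= D) && all (mem s) w.
Proof.
elim: D => [|D IH]; first by rewrite inE; case: w.
by rewrite /= mem_cat IH mem_words [size w <= D.+1]leq_eqVlt ltnS andb_orl orbC.
Qed.

Lemma uniq_upto (A : eqType) (s : seq A) D : uniq s -> uniq (upto D s).
Proof.
move=> us; elim: D => //= D IH; rewrite cat_uniq IH uniq_words // andbT.
apply/hasPn => w; rewrite mem_words mem_upto => /andP[/eqP -> _].
by rewrite ltnn.
Qed.

Lemma size_upto A (s : seq A) D : size (upto D s) = sumn [seq size s ^ i | i <- iota 0 D.+1].
Proof.
elim: D => // D IH; rewrite -[D.+2]addn1 iotaD map_cat sumn_cat -IH.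
by rewrite [LHS]size_cat size_words; congr (_ + _); rewrite /= addn0.
Qed.

(** Parity is linear over the field with two elements, so constraints can be assembled as symmetric
    differences of simpler sets. *)
Lemma odd_count_addb A (a b : pred A) s :
  odd (count (fun x => a x (+) b x) s) = odd (count a s) (+) odd (count b s).
Proof.
elim: s => //= x s IH; rewrite !oddD !oddb IH.
by case: (a x) (b x) (odd (count a s)) (odd (count b s)) => [] [] [] [].
Qed.

(** * Amplification *)

Section Amplification.

Variables (E : eqType) (e0 : E) (U : seq E) (I : eqType) (B : seq I) (S : I -> pred E) (D : nat).

Hypothesis uniqU : uniq U.

(* The children of the node [p] are the words [e :: p]. *)
Definition child (p w : seq E) : bool := (w != [::]) && (behead w == p).

(* The parity of the elements over [p] in the base set [s], plus the parity of
   the word [p] itself; since Odd Set has no even constraints, the odd root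
   constraint for [s] is added when [p] is not empty. *)
Definition inset (p : seq E) (s : I) (w : seq E) : bool :=
  (child [::] w && S s (head e0 w)) (+)
  ((p != [::]) && ((w == p) (+) (child p w && S s (head e0 w)))).

Let W := upto D.+1 U.

Definition amp_sets : seq (seq nat) :=
  flatten [seq [seq [seq i <- iota 0 (size W) | inset p s (nth [::] W i)] | s <- B]
          | p <- upto D U].

Definition over (TW : seq (seq E)) (p : seq E) : seq E := [seq e <- U | (e :: p) \in TW].

Lemma count_child TW p s : uniq TW -> {subset TW <= W} ->
  count (fun w => child p w && S s (head e0 w)) TW = count (S s) (over TW p).
Proof.
move=> uT sT; rewrite -!size_filter -(size_map (cons^~ p)); apply/perm_size/uniq_perm.
- exact: filter_uniq.
- by rewrite map_inj_uniq ?filter_uniq // => a b [].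
move=> w; rewrite mem_filter; apply/andP/mapP => [[/andP[/andP[w0 /eqP ew] sw] wT]|[e]].
  case: w w0 ew sw wT => // e w _ /= -> sw wT; exists e => //.
  rewrite mem_filter sw mem_filter wT /=.
  by have := sT _ wT; rewrite mem_upto => /andP[_ /andP[]].
by rewrite !mem_filter => /and3P[se eT eU] ->; rewrite /child /= eqxx.
Qed.

(** Once the count at the root is odd, the constraint at a nonempty [p] says that [p] is chosen iff
    its children have odd count in [S s]. So a chosen node must carry a solution of the base
    instance, while an unchosen one may stay without children. *)
Lemma odd_inset TW p s : uniq TW -> {subset TW <= W} ->
  odd (count (inset p s) TW) = odd (count (S s) (over TW [::])) (+)
    ((p != [::]) && ((p \in TW) (+) odd (count (S s) (over TW p)))).
Proof.
move=> uT sT; rewrite odd_count_addb count_child //; congr (_ (+) _).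
case: (p == [::]) => /=; first by rewrite count_pred0.
by rewrite odd_count_addb count_child // count_uniq_mem //; case: (p \in TW).
Qed.

Definition wordsof (T : seq nat) : seq (seq E) := [seq nth [::] W i | i <- T].

Lemma wordsofP T : uniq T -> all (fun x => x < size W) T ->
  [/\ uniq (wordsof T), {subset wordsof T <= W} &
   forall (a : pred (seq E)),
     count (fun x => x \in T) [seq i <- iota 0 (size W) | a (nth [::] W i)] =
     count a (wordsof T)].
Proof.
move=> uT /allP aT; split.
- rewrite map_inj_in_uniq // => i j hi hj /eqP.
  by rewrite nth_uniq ?aT ?uniq_upto // => /eqP.
- by move=> w /mapP[i hi ->]; rewrite mem_nth // aT.
move=> a; rewrite count_map -!size_filter; apply/perm_size/uniq_perm.
- by rewrite !filter_uniq // iota_uniq.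
- exact: filter_uniq.
move=> i; rewrite !mem_filter mem_iota /= add0n; case hi: (i \in T); rewrite ?andbF //=.
by rewrite aT ?andbT.
Qed.

Lemma amp_feasibleP T : uniq T -> all (fun x => x < size W) T ->
  all (fun s => odd (count (fun x => x \in T) s)) amp_sets =
  all (fun p => all (fun s => odd (count (inset p s) (wordsof T))) B) (upto D U).
Proof.
move=> uT aT; have [_ _ h] := wordsofP uT aT.
rewrite /amp_sets; elim: (upto D U) => //= p P IH; rewrite all_cat IH; congr (_ && _).
by rewrite all_map; apply: eq_all => s /=; rewrite h.
Qed.

Lemma amp_valid : setsys_valid (size W) amp_sets.
Proof.
apply/allP => s /flatten_mapP[p _ /mapP[b _ ->]].
rewrite filter_uniq ?iota_uniq //=; apply/allP => i.
by rewrite mem_filter mem_iota => /and3P[].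
Qed.

Definition geom (x : nat) : nat := sumn [seq x ^ i | i <- iota 1 D.+1].

(** The witness consists of the nonempty words over [X] of length at most [D + 1]. A node over [X]
    then has exactly [X] below it, and a node with a letter outside [X] is not chosen and has no
    children. *)
Lemma amp_solution X : uniq X -> {subset X <= U} ->
  (forall s, s \in B -> odd (count (S s) X)) ->
  exists T, odd_set_feasible (size W) amp_sets T /\ size T = geom (size X).
Proof.
(* The empty word comes first in [upto] and is dropped, which is why the exponents in [geom] start
   at 1. *)
move=> uX sX hX; pose Y := behead (upto D.+1 X).
have uptoE : upto D.+1 X = [::] :: Y by rewrite /Y; elim: (D) => //= D' ->.
have uY : uniq Y by have := uniq_upto D.+1 uX; rewrite uptoE => /andP[].
have memY w : (w \in Y) = [&& w != [::], size w <= D.+1 & all (mem X) w].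
  have := mem_upto X D.+1 w; rewrite uptoE inE; case: eqP => [->|] //= _.
  have := uniq_upto D.+1 uX; rewrite uptoE => /= /andP[/negbTE -> //].
have sY : {subset Y <= W}.
  move=> w; rewrite memY mem_upto => /and3P[_ -> /allP h]; apply/allP => e /h; exact: sX.
pose T := [seq index w W | w <- Y].
have YE : wordsof T = Y.
  rewrite /wordsof -map_comp -[RHS]map_id; apply/eq_in_map => w hw /=.
  by rewrite nth_index // sY.
have uT : uniq T.
  rewrite map_inj_in_uniq // => v w hv hw e.
  by rewrite -(nth_index [::] (sY v hv)) e nth_index // sY.
have aT : all (fun x => x < size W) T.
  by apply/allP => i /mapP[w hw ->]; rewrite index_mem sY.
exists T; split; last first.
  rewrite size_map; apply/eqP; rewrite -(eqn_add2l 1) add1n -[(size Y).+1]/(size ([::] :: Y)).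
  by rewrite -uptoE size_upto /= expn0.
rewrite /odd_set_feasible uT aT amp_feasibleP // YE /=.
apply/allP => p pU; apply/allP => s sB; rewrite odd_inset //.
have overE q : size q <= D -> all (mem X) q -> odd (count (S s) (over Y q)).
  move=> sq aq; suff /permP -> : perm_eq (over Y q) X by apply: hX.
  apply: uniq_perm => //; first exact: filter_uniq.
  move=> e; rewrite mem_filter memY /= ltnS sq aq andbT.
  by apply/andP/idP => [[]//|eX]; split=> //; apply: sX.
rewrite overE //; case: (altP (p =P [::])) => //= p0; rewrite memY p0 /=.
have : size p <= D by move: pU; rewrite mem_upto => /andP[].
move=> sp; rewrite ltnW ?ltnS //=; case ap: (all (mem X) p); first by rewrite overE.
rewrite (_ : over Y p = [::]) //; apply/eqP; rewrite -size_eq0 size_filter -leqn0 leqNgt -has_count.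
by apply/hasPn => e _; rewrite memY /= ap !andbF.
Qed.

(** The root and all chosen nodes of length at most [D] solve the base instance. If each of them had
    at least [a] children, level [d + 1] would contain at least [a ^ (d + 1)] chosen words, and the
    last level alone would be larger than [T]. *)
Lemma amp_extract T a : odd_set_feasible (size W) amp_sets T -> size T < a ^ D.+1 ->
  exists p, [/\ p \in upto D U, size (over (wordsof T) p) < a &
    forall s, s \in B -> odd (count (S s) (over (wordsof T) p))].
Proof.
case/and3P=> uT aT; rewrite amp_feasibleP // => /allP feas lt.
have [uTW sTW _] := wordsofP uT aT; set TW := wordsof T in uTW sTW feas *.
have node p s : p \in upto D U -> (p == [::]) || (p \in TW) -> s \in B ->
    odd (count (S s) (over TW p)).
  move=> pU act sB; have := allP (feas _ pU) s sB; rewrite odd_inset //.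
  have nilU : [::] \in upto D U by rewrite mem_upto.
  have := allP (feas _ nilU) s sB; rewrite odd_inset //=.
  rewrite addbF => h0 /=; rewrite h0; case: (altP (p =P [::])) act => [-> //|_ /= ->] /=.
  by case: odd.
case: (boolP (has (fun p => ((p == [::]) || (p \in TW)) && (size (over TW p) < a)) (upto D U))).
  case/hasP=> p pU /andP[act la]; exists p; split=> // s sB; exact: node.
move/hasPn => big; exfalso; move: lt; rewrite ltnNge => /negP; apply.
have lev d : d <= D -> a ^ d.+1 <= count (fun w => size w == d.+1) TW.
  elim: d => [|d IH] hd.
    have := big [::]; rewrite mem_upto /= => /(_ isT).
    rewrite -leqNgt expn1 => /leq_trans; apply.
    rewrite -size_filter -(size_map (cons^~ [::])); apply: uniq_leq_size.
      by rewrite map_inj_uniq ?filter_uniq // => x y [].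
    move=> w /mapP[e]; rewrite !mem_filter => /andP[eT _] ->.
    by rewrite eT.
  rewrite expnS mulnC; apply: leq_trans (leq_mul (IH (ltnW hd)) (leqnn a)) _.
  pose Lv := [seq w <- TW | size w == d.+1].
  rewrite -[count _ TW]size_filter -/Lv.
  have h p : p \in Lv -> a <= size (over TW p).
    rewrite mem_filter => /andP[/eqP sp pT]; have := big p.
    rewrite mem_upto sp hd pT orbT /= -leqNgt; apply.
    by have := sTW p pT; rewrite mem_upto => /andP[].
  apply: (@leq_trans (size [seq e :: p | p <- Lv, e <- over TW p])).
    rewrite size_allpairs_dep; elim: (Lv) h => //= p L' IHL h.
    by rewrite mulSn leq_add ?h ?mem_head // IHL // => q hq; rewrite h // inE hq orbT.
  rewrite -size_filter; apply: uniq_leq_size.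
    apply: allpairs_uniq_dep; first exact: filter_uniq.
      by move=> p _; apply: filter_uniq.
    by move=> [p e] [q f] _ _ /= [-> ->].
  move=> w /allpairsPdep[p [e [pL]]]; rewrite mem_filter => /andP[eT _] ->.
  by rewrite mem_filter eT /= andbT; move: pL; rewrite mem_filter => /andP[/eqP ->].
apply: leq_trans (lev D (leqnn D)) _; apply: leq_trans (count_size _ _) _.
by rewrite size_map.
Qed.

End Amplification.

(** * From dense subgraphs to odd sets *)

Definition bits := [:: false; true].

Definition extend (n : nat) (C : seq (seq bool)) : seq (seq bool) :=
  if size C < n then words_step bits C else C.

(* All words of some length, at least [n] and at most [2 * n + 1] of them. *)
Definition codes (n : nat) : seq (seq bool) := iter n (extend n) [:: [::]].

(** Either every round has doubled the list or there are already [n] words. Doubling happens only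
    below [n]; the summand 1 in [2 * n + 1] is for [n = 0], where the empty word remains. *)
Lemma iter_extend n i : exists2 L, L <= i &
  iter i (extend n) [:: [::]] = words bits L /\
  (L = i \/ n <= 2 ^ L) /\ 2 ^ L <= 2 * n + 1.
Proof.
elim: i => [|i [L Li [e [h1 h2]]]]; first by exists 0 => //; split=> //; split; [left | lia].
rewrite iterS e /extend size_words /=; case: ltnP => h.
  exists L.+1 => //; split=> //; split; last by rewrite expnS; lia.
  by case: h1 => [->|h1]; [left | lia].
by exists L; [lia | split=> //; split; [right|]].
Qed.

Lemma codesP n : exists2 L, L <= n & codes n = words bits L /\ n <= size (codes n).
Proof.
have [L Ln [e [h1 h2]]] := iter_extend n n; exists L => //; rewrite /codes e size_words.
by split=> //; case: h1 => // ->; apply: ltnW; apply: ltn_expl.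
Qed.

Definition sel (b w : seq bool) : seq bool :=
  [seq nth false w i | i <- iota 0 (size w) & nth false b i].

Lemma size_sel b w : size b = size w -> size (sel b w) = count id b.
Proof.
move=> e; rewrite size_map size_filter -e -[b in RHS](mkseq_nth false) count_map.
by apply: eq_count.
Qed.

Lemma sel_eqP b v w : size v = size w ->
  sel b v = sel b w <-> forall i, i < size w -> nth false b i -> nth false v i = nth false w i.
Proof.
move=> e; rewrite /sel e; split=> [/eq_in_map h i hi bi|h].
  by apply: h; rewrite mem_filter bi mem_iota.
by apply/eq_in_map => i; rewrite mem_filter mem_iota => /andP[bi hi]; apply: h.
Qed.

(* Adding one bit separates a new word from the only word it may collide with. *)
Lemma separating_mask L (s : seq (seq bool)) : uniq s -> all (fun w => size w == L) s ->
  exists b, [/\ size b = L, count id b <= size s & {in s &, injective (sel b)}].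
Proof.
elim: s => [|w s IH] /=.
  by exists (nseq L false); rewrite size_nseq count_nseq mul0n.
case/andP=> ws us /andP[/eqP sw als]; have [b [sb cb inj]] := IH us als.
have sz v : v \in w :: s -> size v = L.
  by rewrite inE => /predU1P[->//|vs]; apply/eqP/(allP als).
have ext b' : {in s &, injective (sel b')} ->
    (forall v, v \in s -> sel b' v <> sel b' w) -> {in w :: s &, injective (sel b')}.
  move=> ij h u v; rewrite !inE => /predU1P[->|us'] /predU1P[->|vs'] //; last exact: ij.
    by move/esym/(h _ vs').
  by move/(h _ us').
case: (boolP (has (fun v => sel b v == sel b w) s)) => [/hasP[v vs /eqP evw]|/hasPn nb].
  have nvw : v <> w by move=> e; rewrite -e vs in ws.
  have [i hi ni] : exists2 i, i < L & nth false v i != nth false w i.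
    have /allPn[i] : ~~ all (fun i => nth false v i == nth false w i) (iota 0 L).
      apply/negP => /allP h; apply: nvw; apply: (@eq_from_nth _ false).
        by rewrite sz ?inE ?vs ?orbT // sw.
      move=> i; rewrite sz ?inE ?vs ?orbT // => hi.
      by apply/eqP/h; rewrite mem_iota.
    by rewrite mem_iota => hi ni; exists i.
  pose b' := mkseq (fun j => nth false b j || (j == i)) L.
  have nb' j : j < L -> nth false b' j = nth false b j || (j == i).
    by move=> hj; rewrite nth_mkseq.
  have coarse x y : x \in w :: s -> y \in w :: s -> sel b' x = sel b' y ->
      sel b x = sel b y /\ nth false x i = nth false y i.
    move=> xs ys; have exy : size x = size y by rewrite !sz.
    move/(sel_eqP _ exy); rewrite (sz y) // => h; split; last first.
      by apply: h => //; rewrite nb' // eqxx orbT.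
    by apply/(sel_eqP _ exy) => j; rewrite (sz y) // => hj bj; apply: h => //; rewrite nb' ?bj.
  exists b'; split; first by rewrite size_mkseq.
    rewrite count_map (eq_count (a2 := predU (nth false b) (pred1 i))) //.
    apply: (@leq_trans (count (nth false b) (iota 0 L) + count (pred1 i) (iota 0 L))).
      by rewrite -count_predUI leq_addr.
    rewrite -addn1; apply: leq_add; last by rewrite count_uniq_mem ?iota_uniq ?leq_b1.
    by rewrite -[b](mkseq_nth false) sb count_map in cb.
  apply: ext => [x y xs ys e|x xs e].
    by apply: inj => //; have [] := coarse x y _ _ e; rewrite ?inE ?xs ?ys ?orbT.
  (* A word [x] of [s] that collides with [w] under the new mask does so under the old one, so [x]
     is [v]; but bit [i] separates [v] from [w]. *)
  have [e1 e2] := coarse x w (mem_behead (s := w :: s) xs) (mem_head _ _) e.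
  by move: ni; rewrite -e2 (inj x v xs vs) ?eqxx // e1 evw.
exists b; split=> //; first exact: leqW.
by apply: ext inj _ => v vs /eqP; apply/negP/nb.
Qed.

Lemma sum_fibers (A B : eqType) (f : A -> B) (H : seq B) (Y : seq A) :
  uniq H -> {in Y, forall e, f e \in H} ->
  \sum_(h <- H) count (fun e => f e == h) Y = size Y.
Proof.
move=> uH; elim: Y => [|e Y IH] hY /=; first by rewrite big1.
rewrite big_split /= IH => [|x xY]; last by apply: hY; rewrite inE xY orbT.
rewrite (_ : \sum_(h <- H) _ = count_mem (f e) H).
  by rewrite count_uniq_mem // hY ?mem_head.
rewrite -sum1_count [RHS]big_mkcond; apply: eq_bigr => h _ /=.
by rewrite eq_sym; case: eqP.
Qed.

Lemma count1_unique (A : eqType) (P : pred A) (X : seq A) x y :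
  count P X = 1 -> x \in X -> P x -> y \in X -> P y -> x = y.
Proof.
rewrite -size_filter => c xX Px yX Py.
have : x \in filter P X by rewrite mem_filter Px.
have : y \in filter P X by rewrite mem_filter Py.
by case: (filter P X) c => [|z [|]] // _; rewrite !inE => /eqP -> /eqP ->.
Qed.

(** * Graphs, vertex colors and parity constraints *)

Section Graph.

Variables (n : nat) (l : seq (nat * nat)).

Definition pairs : seq (nat * nat) :=
  flatten [seq [seq (u, v) | v <- iota 0 n] | u <- iota 0 n].

(** Each edge appears once, smaller end first, whatever repetitions and orientations [l] contains;
    this gives it one well-defined ordered color pair. *)
Definition edges : seq (nat * nat) :=
  [seq e <- pairs | (e.1 < e.2) && (((e.1, e.2) \in l) || ((e.2, e.1) \in l))].

Definition induced (S : seq nat) : seq (nat * nat) :=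
  [seq e <- edges | (e.1 \in S) && (e.2 \in S)].

Lemma mem_pairs e : (e \in pairs) = (e.1 < n) && (e.2 < n).
Proof.
case: e => u v; apply/flatten_mapP/andP => /= [[a]|[hu hv]].
  by rewrite mem_iota => ha /mapP[b]; rewrite mem_iota => hb [-> ->].
by exists u; rewrite ?mem_iota //; apply: map_f; rewrite mem_iota.
Qed.

Lemma uniq_pairs : uniq pairs.
Proof.
have := @allpairs_uniq _ _ _ pair (iota 0 n) (iota 0 n) (iota_uniq _ _) (iota_uniq _ _).
by apply=> -[a x] [b y].
Qed.

Lemma induced_edgesE S : induced_edges n l S = size (induced S).
Proof.
rewrite /induced size_filter /edges count_filter /pairs count_flatten -map_comp sumnE big_map.
have iE : iota 0 n = index_iota 0 n by rewrite /index_iota subn0.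
rewrite [in RHS]iE big_mkord; apply: eq_bigr => u _; rewrite /=.
rewrite count_map -sum1_count big_mkord big_mkcond [RHS]big_mkcond.
apply: eq_bigr => v _ /=.
by rewrite /adj; case: (u < v); case: (val u \in S); case: (val v \in S); case: (_ || _).
Qed.

(** Padding and truncation give exactly [k] vertices for any predicate, so wrong guesses produce
    legal candidates too. *)
Definition cand (k : nat) (P : pred nat) : seq nat :=
  take k ([seq v <- iota 0 n | P v] ++ [seq v <- iota 0 n | ~~ P v]).

Lemma cand_subset k P : k <= n -> k_subset n k (cand k P).
Proof.
move=> kn; rewrite /k_subset /cand; set s := _ ++ _.
have ps : perm_eq s (iota 0 n) by apply/permPl/perm_filterC.
apply/and3P; split.
- by apply: take_uniq; rewrite (perm_uniq ps) iota_uniq.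
- by rewrite size_takel // (perm_size ps) size_iota.
apply/allP => v /mem_take; rewrite (perm_mem ps) mem_iota; exact.
Qed.

Lemma mem_cand k (P : pred nat) v : size [seq v <- iota 0 n | P v] <= k ->
  v < n -> P v -> v \in cand k P.
Proof.
move=> sk vn Pv; rewrite /cand take_cat ltnNge sk /= mem_cat mem_filter Pv mem_iota.
by rewrite vn.
Qed.

Section Colors.

Variable b : seq bool.

Definition vcol (v : nat) : seq bool := sel b (nth [::] (codes n) v).

Definition cls (e : nat * nat) : seq bool * seq bool := (vcol e.1, vcol e.2).

Definition ends (v : nat) (e : nat * nat) : bool := (v == e.1) || (v == e.2).

Definition touch (h : seq bool * seq bool) (v : nat) : bool :=
  (vcol v == h.1) || (vcol v == h.2).

Variable H : seq (seq bool * seq bool).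

Definition ground : seq (nat * nat) := [seq e <- edges | cls e \in H].

(* If [v] has a color of both or neither of [h] and [h'], and if the class [h] is
   odd, then this set is odd iff the classes [h] and [h'] have the same parity at
   [v].  Otherwise it is the class [h] itself. *)
Definition base_set (s : (seq bool * seq bool) * ((seq bool * seq bool) * nat))
    (e : nat * nat) : bool :=
  ((cls e == s.1) (+) ((cls e == s.1) && ends s.2.2 e)) (+)
  ((cls e == (if touch s.1 s.2.2 == touch s.2.1 s.2.2 then s.2.1 else s.1)) &&
   ends s.2.2 e).

Definition base_idx : seq ((seq bool * seq bool) * ((seq bool * seq bool) * nat)) :=
  flatten [seq flatten [seq [seq (h, (h', v)) | v <- iota 0 n] | h' <- H] | h <- H].

Lemma mem_base_idx s :
  (s \in base_idx) = [&& s.1 \in H, s.2.1 \in H & s.2.2 < n].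
Proof.
case: s => h [h' v] /=; apply/flatten_mapP/and3P => [[a ha /flatten_mapP[a' ha']]|[hh hh' hv]].
  by move=> /mapP[w]; rewrite mem_iota => hw [-> -> ->].
by exists h => //; apply/flatten_mapP; exists h' => //; apply: map_f; rewrite mem_iota.
Qed.

Definition lone (X : seq (nat * nat)) (v : nat) : bool :=
  has (fun e => ends v e && (count (fun e' => cls e' == cls e) X == 1)) X.

Lemma odd_base_set X h h' v : odd (count (base_set (h, (h', v))) X) =
  (odd (count (fun e => cls e == h) X) (+)
   odd (count (fun e => (cls e == h) && ends v e) X)) (+)
  odd (count (fun e => (cls e == (if touch h v == touch h' v then h' else h)) && ends v e) X).
Proof. by rewrite odd_count_addb odd_count_addb. Qed.

End Colors.

(** * Correctness of the base constraints for the guess made from [S] *)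

Section Planted.

Variables (k : nat) (S : seq nat) (b : seq bool).
Hypotheses (uS : uniq S) (sS : size S = k) (ltS : {in S, forall v, v < n}).
Hypothesis inj : {in S &, injective (vcol b)}.

Let H := [seq cls b e | e <- induced S].

Lemma mem_edges e : e \in edges -> [/\ e.1 < e.2, e.1 < n & e.2 < n].
Proof. by rewrite mem_filter mem_pairs => /and3P[/andP[-> _] -> ->]. Qed.

Lemma mem_induced e : e \in induced S -> [/\ e.1 \in S, e.2 \in S & e.1 < e.2].
Proof. by rewrite mem_filter => /andP[/andP[-> ->] /mem_edges[]]. Qed.

Lemma uniq_induced T : uniq (induced T).
Proof. by do 2 apply: filter_uniq; apply: uniq_pairs. Qed.

Lemma cls_inj : {in induced S &, injective (cls b)}.
Proof.
move=> [u v] [u' v'] /mem_induced[/= u1 v1 _] /mem_induced[/= u2 v2 _] [e1 e2].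
by rewrite (inj u1 u2 e1) (inj v1 v2 e2).
Qed.

Lemma uniq_planted : uniq H.
Proof. by rewrite map_inj_in_uniq ?uniq_induced //; apply: cls_inj. Qed.

Lemma induced_ground : {subset induced S <= ground b H}.
Proof.
move=> e eS; rewrite mem_filter map_f //.
by move: eS; rewrite mem_filter => /andP[].
Qed.

(** Colors are injective on [S], so every class of [H] contains exactly one edge of [induced S], and
    [v] is an end of it iff [v] lies in [S] and its color is in the pair. Classes that agree on the
    color of [v] therefore have equal parity at [v]. *)
Lemma planted_solution s : s \in base_idx H -> odd (count (base_set b s) (induced S)).
Proof.
case: s => h [h' v]; rewrite mem_base_idx => /and3P[/= hH h'H vn].
have one g : g \in H -> exists2 e, e \in induced S & cls b e = g /\
    forall P : pred (nat * nat), count (fun e' => (cls b e' == g) && P e') (induced S) = P e.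
  move=> /mapP[e eS ->]; exists e => //; split=> // P.
  rewrite (eq_in_count (a2 := fun e' => (e' == e) && P e)); last first.
    move=> e' eS'; have -> : (cls b e' == cls b e) = (e' == e).
      by apply/eqP/eqP => [/cls_inj->|->].
    by case: eqP => // ->.
  case: (P e); last by rewrite (eq_count (a2 := pred0)) ?count_pred0 // => x; rewrite andbF.
  by rewrite (eq_count (a2 := pred1 e)) ?count_uniq_mem ?uniq_induced ?eS // => x; rewrite andbT.
have endsE g e : e \in induced S -> cls b e = g -> ends v e = touch b g v && (v \in S).
  move=> /mem_induced[e1 e2 _] <-; rewrite /ends /touch /=.
  apply/orP/andP => [[/eqP->|/eqP->]|[/orP[/eqP ev|/eqP ev] vS]]; rewrite ?eqxx ?orbT //.
    by left; apply/eqP/inj.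
  by right; apply/eqP/inj.
rewrite odd_base_set; set g := if _ then _ else _.
have gH : g \in H by rewrite /g; case: ifP.
have gt : touch b g v = touch b h v by rewrite /g; case: ifP => // /eqP ->.
have [e eS [ee ce]] := one h hH; have [f fS [ef cf]] := one g gH.
rewrite (eq_count (a2 := fun e' => (cls b e' == h) && predT e')); last by move=> x; rewrite andbT.
rewrite !ce cf /= (endsE h e) // (endsE g f) // gt.
by case: (_ && _).
Qed.

(** A class of odd size has one edge or at least three. The lone edges of the classes of size one
    have all their ends in the candidate set, because these ends have distinct colors among the [k]
    colors of [S]. *)
Lemma planted_extract X : uniq X -> {subset X <= ground b H} ->
  (forall s, s \in base_idx H -> odd (count (base_set b s) X)) ->
  3 * size (induced S) <= size X + 2 * size (induced (cand k (lone b X))).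
Proof.
move=> uX sX hX; set C := cand _ _.
pose G := [seq e <- X | count (fun e' => cls b e' == cls b e) X == 1].
have XE e : e \in X -> [/\ e \in edges, cls b e \in H, e.1 < n & e.2 < n].
  by move/sX; rewrite mem_filter => /andP[-> he]; have [_ -> ->] := mem_edges he.
have nH h : h \in H -> n > 0.
  move=> /mapP[e]; rewrite mem_filter => /andP[_ /mem_edges[_ h1 _]] _; lia.
(* With [h' = h] the two parities at the vertex cancel and the size of the class remains. Vertex 0
   exists because [H] comes from edges. *)
have odd_cls h : h \in H -> odd (count (fun e => cls b e == h) X).
  move=> hH; have := hX (h, (h, 0)).
  rewrite mem_base_idx hH (nH h hH) => /(_ isT).
  by rewrite odd_base_set eqxx; case: odd; case: odd.
(* The class of [e] has size 1 and its edge is at [v], so the constraint for this class and [h]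
   leaves odd parity of [h] at [v]. *)
have lone_eq e v h : e \in G -> v < n -> h \in H -> touch b h v -> touch b (cls b e) v ->
    count (fun e' => cls b e' == h) X = 1 -> ends v e ->
    odd (count (fun e' => (cls b e' == h) && ends v e') X).
  rewrite mem_filter => /andP[/eqP c1 eX] vn hH th te ch ve; have [_ eH _ _] := XE e eX.
  have := hX (cls b e, (h, v)); rewrite mem_base_idx eH hH vn => /(_ isT).
  rewrite odd_base_set te th eqxx c1.
  suff -> : count (fun e' => (cls b e' == cls b e) && ends v e') X = 1 by [].
  apply/eqP; rewrite eqn_leq; apply/andP; split.
    by rewrite -c1; apply: sub_count => e' /andP[].
  by rewrite -has_count; apply/hasP; exists e; rewrite ?eqxx.
have sizeC : size [seq v <- iota 0 n | lone b X v] <= k.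
  have ends_touch v e : ends v e -> touch b (cls b e) v.
    by rewrite /ends /touch /= => /orP[/eqP->|/eqP->]; rewrite eqxx ?orbT.
  have colE v : lone b X v -> vcol b v \in map (vcol b) S.
    case/hasP => e eX /andP[ve _]; have [_ /mapP[f fS ef] _ _] := XE e eX.
    have [f1 f2 _] := mem_induced fS; case: ef => ef1 ef2.
    by move: ve => /orP[/eqP->|/eqP->]; rewrite ?ef1 ?ef2 map_f.
  rewrite -sS -(size_map (vcol b)) -(size_map (vcol b) S); apply: uniq_leq_size; last first.
    by move=> c /mapP[v]; rewrite mem_filter => /andP[/colE cv _] ->.
  (* Let [v] and [w] have the same color and lone edges [e] and [f]. The class of [f] touches the
     color of [v], so it has an edge at [v], which can only be [f]. Both vertices are then ends of
     [f], whose ends have distinct colors; hence [v = w]. *)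
  rewrite map_inj_in_uniq ?filter_uniq ?iota_uniq // => v w.
  rewrite !mem_filter !mem_iota /= add0n => /andP[/hasP[e eX /andP[ve ce]] vn].
  move=> /andP[/hasP[f fX /andP[wf /eqP cf]] wn] evw.
  have [_ fH _ _] := XE f fX.
  have tv : touch b (cls b f) v by have := ends_touch w f wf; rewrite /touch evw.
  have /odd_gt0 : odd (count (fun e' => (cls b e' == cls b f) && ends v e') X).
    by apply: (lone_eq e) => //; [rewrite mem_filter ce | apply: ends_touch].
  rewrite -has_count => /hasP[f' f'X /andP[cf' vf']].
  have ef : f' = f by apply: (count1_unique cf).
  rewrite ef in vf'.
  have ne : vcol b f.1 <> vcol b f.2.
    have /mapP[g gS [-> ->]] := fH; have [g1 g2 lt] := mem_induced gS.
    by move/(inj g1 g2) => e12; rewrite e12 ltnn in lt.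
  move: vf' wf; rewrite /ends => /orP[/eqP v1|/eqP v1] /orP[/eqP w1|/eqP w1];
    rewrite v1 w1 // in evw *; by [case: (ne evw) | case: (ne (esym evw))].
have GC : {subset G <= induced C}.
  move=> e; rewrite mem_filter => /andP[ce eX]; have [eE _ e1 e2] := XE e eX.
  rewrite mem_filter eE andbT; apply/andP; split; apply: mem_cand => //;
    by apply/hasP; exists e => //; rewrite ce /ends eqxx ?orbT.
have sG : size G <= size (induced C).
  by apply: uniq_leq_size => //; apply: filter_uniq.
(* The comparison is made class by class: an odd count [c] satisfies [3 <= c + 2] if it is 1, and
   [3 <= c] otherwise. *)
apply: (@leq_trans (size X + 2 * size G)); last by rewrite leq_add2l leq_mul2l sG orbT.
rewrite -(size_map (cls b)) -/H -(@sum_fibers _ _ (cls b) H X uniq_planted); last first.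
  by move=> e /XE[].
rewrite -(@sum_fibers _ _ (cls b) H G uniq_planted); last first.
  by move=> e; rewrite mem_filter => /andP[_ /XE[]].
rewrite big_distrr -big_split /= -sum1_size big_distrr /= big_seq [leqRHS]big_seq.
apply: leq_sum => h hH; have oh := odd_cls h hH.
have -> : count (fun e => cls b e == h) G =
    if count (fun e => cls b e == h) X == 1 then 1 else 0.
  rewrite /G count_filter; case: ifP => [/eqP <-|ne].
    by apply: eq_count => e /=; case: eqP => //= ->; rewrite eqxx.
  rewrite (eq_count (a2 := pred0)) ?count_pred0 // => e /=.
  by case: eqP => //= ->; rewrite ne.
case: eqP => [->//|]; move: oh; case: (count _ X) => [|[|[|c]]] //= _ _; lia.
Qed.

End Planted.

End Graph.

(** * The search over all guesses *)

Section Algorithm.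

Variables (D n : nat) (l : seq (nat * nat)) (k : nat).

Definition guess := (seq bool * seq (seq bool * seq bool))%type.

Definition colpairs (c : nat) : seq (seq bool * seq bool) :=
  flatten [seq [seq (x, y) | y <- words bits c] | x <- words bits c].

(** The minima change nothing on the ranges enumerated here. They bound the lists of words for every
    value of the bound variables, as the polynomial-time closure lemmas require. *)
Definition guesses : seq guess :=
  flatten [seq flatten [seq [seq (b, H) |
                             H <- words (colpairs (minn (count id b) k)) (minn d (k * k))]
                       | d <- iota 0 (k * k).+1]
          | b <- codes n & count id b <= k].

(** The truncation leaves the enumerated guesses intact and ensures that for any guess whatsoever
    the oracle parameter takes one of [k * k + 1] values. *)
Definition ghint (g : guess) : seq (seq bool * seq bool) := take (k * k) g.2.

Definition gground (g : guess) : seq (nat * nat) := ground n l g.1 (ghint g).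

Definition gsize (g : guess) : nat := size (upto D.+1 (gground g)).

Definition gsets (g : guess) : seq (seq nat) :=
  amp_sets (0, 0) (gground g) (base_idx n (ghint g)) (base_set n g.1) D.

Definition gcost (g : guess) : nat := geom D (size (ghint g)).

Definition gcands (g : guess) (T : seq nat) : seq (seq nat) :=
  [seq cand n k (lone n g.1 (over (gground g) (wordsof (gground g) D T) p))
  | p <- upto D (gground g)].

Definition better (S C : seq nat) : seq nat :=
  if size (induced n l S) < size (induced n l C) then C else S.

Definition search (ans : guess -> seq nat) : seq nat :=
  foldl better (iota 0 k) (flatten [seq gcands g (ans g) | g <- guesses]).

Lemma foldl_better (P : pred (seq nat)) S L : P S -> all P L ->
  P (foldl better S L) /\ forall C, C = S \/ C \in L ->
    size (induced n l C) <= size (induced n l (foldl better S L)).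
Proof.
elim: L S => [|C L IH] S PS /=; first by move=> _; split=> // C [->|].
case/andP=> PC PL; have Pb : P (better S C) by rewrite /better; case: ifP.
have [h1 h2] := IH _ Pb PL; split=> // C' hC'.
have hb := h2 _ (or_introl erefl).
have lS : size (induced n l S) <= size (induced n l (better S C)).
  by rewrite /better; case: ifP => // /ltnW.
have lC : size (induced n l C) <= size (induced n l (better S C)).
  by rewrite /better; case: ltnP.
case: hC' => [->|]; first exact: leq_trans lS hb.
rewrite inE => /predU1P[->|CL]; first exact: leq_trans lC hb.
by apply: h2; right.
Qed.

Lemma search_subset ans : k <= n -> k_subset n k (search ans).
Proof.
move=> kn; have [] := @foldl_better (k_subset n k) (iota 0 k)
  (flatten [seq gcands g (ans g) | g <- guesses]); try by [].
  rewrite /k_subset iota_uniq size_iota eqxx /=; apply/allP => v.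
  by rewrite mem_iota /=; lia.
apply/allP => C /flatten_mapP[g _ /mapP[p _ ->]]; exact: cand_subset.
Qed.

Lemma search_max ans g p : g \in guesses -> p \in upto D (gground g) -> k <= n ->
  size (induced n l (cand n k (lone n g.1 (over (gground g) (wordsof (gground g) D (ans g)) p))))
  <= size (induced n l (search ans)).
Proof.
move=> hg hp kn; have [] := @foldl_better predT (iota 0 k)
  (flatten [seq gcands g (ans g) | g <- guesses]); rewrite ?all_predT //.
move=> _; apply; right; apply/flatten_mapP; exists g => //.
by apply/mapP; exists p.
Qed.

Lemma guess_exists S : uniq S -> size S = k -> {in S, forall v, v < n} ->
  exists b, [/\ {in S &, injective (vcol n b)}, size (induced n l S) <= k * k &
    (b, [seq cls n b e | e <- induced n l S]) \in guesses].
Proof.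
move=> uS sS ltS; have [L Ln [cE sC]] := codesP n.
have szc v : v < n -> nth [::] (codes n) v \in words bits L.
  by move=> hv; rewrite -cE mem_nth //; apply: leq_trans hv sC.
pose s := [seq nth [::] (codes n) v | v <- S].
have us : uniq s.
  rewrite map_inj_in_uniq // => v w vS wS /eqP; rewrite nth_uniq ?cE ?uniq_words // -?cE.
  - by move/eqP.
  - exact: leq_trans (ltS v vS) sC.
  - exact: leq_trans (ltS w wS) sC.
have as_ : all (fun w => size w == L) s.
  by apply/allP => w /mapP[v /ltS/szc hv ->]; move: hv; rewrite mem_words => /andP[].
have [b [sb cb inj]] := separating_mask us as_; rewrite size_map sS in cb.
have inB (w : seq bool) : all (mem bits) w by apply/allP => -[].
have injv : {in S &, injective (vcol n b)}.
  move=> v w vS wS e; have := inj _ _ (map_f _ vS) (map_f _ wS) e.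
  move/eqP; rewrite nth_uniq ?cE ?uniq_words // -?cE; first by move/eqP.
    exact: leq_trans (ltS v vS) sC.
  exact: leq_trans (ltS w wS) sC.
have sz : size (induced n l S) <= k * k.
  have -> : k * k = size [seq (u, v) | u <- S, v <- S] by rewrite size_allpairs sS.
  apply: uniq_leq_size; first exact: uniq_induced.
  by move=> [u v] /mem_induced[uS' vS' _]; apply: allpairs_f.
exists b; split=> //.
have colw v : v \in S -> vcol n b v \in words bits (count id b).
  move=> /ltS/szc; rewrite !mem_words !inB !andbT => /eqP sv.
  by rewrite size_sel ?sv.
(* The mask is as long as the words of the vertices, and [codes n] contains all words of that
   length; so it is among the masks tried. *)
apply/flatten_mapP; exists b.
  by rewrite mem_filter cb cE mem_words sb eqxx inB.
apply/flatten_mapP; exists (size (induced n l S)); first by rewrite mem_iota /= add0n ltnS.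
apply: map_f; rewrite mem_words size_map (minn_idPl sz) eqxx (minn_idPl cb) /=.
apply/allP => h /mapP[e /mem_induced[e1 e2 _] ->].
by apply/flatten_mapP; exists (vcol n b e.1); rewrite ?colw //; apply: map_f; apply: colw.
Qed.

(** Since [geom D x <= (D + 1) * x ^ (D + 1)], the hypothesis on [D] makes an [r]-approximate answer
    too small for every node to have more than [(1 + 1/m) * x] children. *)
Lemma search_approx (ans : guess -> seq nat) (r m : nat) : k <= n -> 0 < m ->
  r * D.+1 * m ^ D.+1 < m.+1 ^ D.+1 ->
  (forall g, odd_set_feasible (gsize g) (gsets g) (ans g) /\ size (ans g) <= r * gcost g \/
     forall T, odd_set_feasible (gsize g) (gsets g) T -> gcost g < size T) ->
  forall S, k_subset n k S ->
    m.-1 * induced_edges n l S <= m * induced_edges n l (search ans).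
Proof.
move=> kn m0 hD hans S /and3P[uS /eqP sS /allP ltS].
have [b [inj sz hg]] := guess_exists uS sS ltS.
rewrite !induced_edgesE; set x := size (induced n l S).
have [->|x0] := posnP x; first by rewrite muln0.
set H := [seq cls n b e | e <- induced n l S] in hg; set g := (b, H) in hg.
have gH : ghint g = H by rewrite /ghint take_oversize // size_map.
have gU : gground g = ground n l b H by rewrite /gground gH.
have gK : gcost g = geom D x by rewrite /gcost gH size_map.
have uU : uniq (gground g) by rewrite gU; do 2 apply: filter_uniq; apply: uniq_pairs.
(* A negative reply is impossible for the right guess: the planted solution has size exactly
   [gcost g]. *)
have [[feas cost]|no] := hans g; last first.
  have [|||T [fT sT]] :=
    @amp_solution _ (0, 0) _ _ (base_idx n H) (base_set n b) D uU (induced n l S).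
  - exact: uniq_induced.
  - by rewrite gU; apply: induced_ground.
  - by move=> s; apply: planted_solution.
  have := no T; rewrite /gsets /gsize gH => /(_ fT).
  by rewrite sT gK ltnn.
(* The least integer above [(1 + 1/m) * x], so that fewer than [a] children means at most
   [(1 + 1/m) * x]. *)
pose a := (m.+1 * x) %/ m + 1.
have am : m.+1 * x < a * m by rewrite /a addn1 ltn_ceil.
have small : size (ans g) < a ^ D.+1.
  have xm : 0 < m ^ D.+1 by rewrite expn_gt0 m0.
  rewrite -(ltn_pmul2r xm); apply: leq_ltn_trans (_ : r * (D.+1 * x ^ D.+1) * m ^ D.+1 < _).
    rewrite leq_mul2r; apply/orP; right; apply: leq_trans cost _.
    rewrite gK leq_mul2l; apply/orP; right; rewrite /geom.
    suff h d j : j + d <= D.+2 -> sumn [seq x ^ i | i <- iota j d] <= d * x ^ D.+1.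
      exact: h.
    elim: d j => // d IH j hj; rewrite /= mulSn leq_add ?IH ?leq_pexp2l //; lia.
  apply: (@leq_trans ((m.+1 * x) ^ D.+1)); last first.
    by rewrite -expnMn leq_exp2r // ltnW.
  rewrite expnMn mulnA -mulnA [x ^ _ * _]mulnC mulnA ltn_pmul2r // expn_gt0 x0 //.
rewrite /gsets /gsize gH in feas.
have [p [pU sp hp]] := amp_extract uU feas small.
have := search_max ans hg pU kn; set C := cand _ _ _ => hC.
have ext : 3 * x <= size (over (gground g) (wordsof (gground g) D (ans g)) p) +
    2 * size (induced n l C).
  apply: (planted_extract uS sS inj) => //; first exact: filter_uniq.
  by move=> e; rewrite -gU mem_filter => /andP[].
have : m * size (over (gground g) (wordsof (gground g) D (ans g)) p) <= m.+1 * x.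
  rewrite mulnC; apply: leq_trans (leq_trunc_div (m.+1 * x) m).
  by rewrite leq_mul2r; apply/orP; right; move: sp; rewrite /a addn1 ltnS.
move: ext; set y := size (over _ _ _); set z := size (induced n l C) in hC *.
(* From [3 * x <= y + 2 * z] and [m * y <= (m + 1) * x] follows [(2 * m - 1) * x <= 2 * m * z],
   which is a little more than claimed. *)
case: (m) m0 => // m' _ /= h1 h2.
apply: (@leq_trans (m'.+1 * z)); last by rewrite leq_mul2l hC orbT.
nia.
Qed.

End Algorithm.

(** * The reduction is computed in polynomial time *)

Ltac ptac_enc := lazymatch goal with
  | |- poly (fun x => enc_nat (@?n x)) => simple apply (poly_enc_nat (n := n))
  | |- poly (fun x => enc_seq (@?n x)) => simple apply (poly_enc_seq (s := n))
  | |- poly (fun x => tokens (@?n x)) => simple apply (poly_comp (g := tokens) (f := n) poly_tokens)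
  end.

Ltac ptac_ext ::= first [ptac_lib | ptac_enc].

Lemma poly_words_step X A (cX : code X) (cA : code A) (s : X -> seq A) (L : X -> seq (seq A)) :
  poly s -> poly L -> poly (fun x => words_step (s x) (L x)).
Proof. by move=> ps pL; rewrite /words_step; ptac. Qed.

(** The predecessor of the measure of a list is a plain sum over its members, which makes the
    equation exact. *)
Lemma rho_words_step A (cA : code A) (s : seq A) L :
  (rho (words_step s L)).-1 = size s * (rho L).-1 + size L * (rho s).-1.
Proof.
rewrite /words_step /=; elim: s => [|a s IH] /=; first by rewrite muln0.
rewrite map_cat sumn_cat IH mulnDr mulSn; set m := sumn _.
have -> : m = sumn [seq (rho w).+1 | w <- L] + size L * (rho a).+1.
  rewrite /m {m IH}; elim: L => //= w L ->; rewrite mulSn; lia.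
by rewrite /=; lia.
Qed.

Lemma rho_words A (cA : code A) (s : seq A) i :
  rho (words s i) <= size s ^ i * (i * rho s + 2) + 1.
Proof.
have : (rho (words s i)).-1 <= size s ^ i * (i * rho s + 2); last first.
  by move=> h; apply: leq_trans (leqSpred _) _; rewrite addn1 ltnS.
elim: i => [|i IH]; first by rewrite expn0 mul0n.
rewrite [words _ _]/(words_step s (words s i)) rho_words_step size_words expnS.
have [e0|s0] := posnP (size s).
  by rewrite e0 (size0nil e0) /= !mul0n ?muln0.
apply: (@leq_trans (size s * (size s ^ i * (i * rho s + 2)) + size s ^ i * rho s)).
  by rewrite leq_add ?leq_mul2l ?IH ?leq_pred ?orbT.
have : size s ^ i * rho s <= size s * size s ^ i * rho s by rewrite leq_mul // leq_pmull.
set u := _ ^ i; set v := rho s; nia.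
Qed.

Lemma poly_words X A (cX : code X) (cA : code A) (s : X -> seq A) (d : X -> nat) :
  poly s -> poly d -> bdd rho (fun x => size (s x) ^ d x) ->
  poly (fun x => words (s x) (d x)).
Proof.
move=> ps pd bN; rewrite /words.
apply: (poly_iter (f := fun x => words_step (s x))
  (N := fun x => (size (s x) ^ d x + 1) * (rho (d x) * rho (s x) + 2) + 1)) => //.
- exact: poly_const.
- apply: poly_words_step; last by ptac.
  by apply: (poly_comp ps (f := fst)); ptac.
- apply: bdd_add; last exact: bdd_const.
  by apply: bdd_mul; [apply: bdd_add bN _; apply: bdd_const | bdd_tac].
move=> x i hi; rewrite -/(words (s x) i); apply: leq_trans (rho_words _ _ _) _.
rewrite leq_add2r; apply: leq_mul.
  have [e0|s0] := posnP (size (s x)); last by rewrite addn1 leqW // leq_pexp2l.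
  have : 0 ^ i <= 1 by case: (i) => // j; rewrite exp0n.
  by rewrite e0; lia.
by rewrite leq_add2r leq_mul2r; apply/orP; right; rewrite /=; lia.
Qed.

Lemma poly_words_const X A (cX : code X) (cA : code A) (s : X -> seq A) (d : nat) :
  poly s -> poly (fun x => words (s x) d).
Proof.
move=> ps; apply: poly_words => //; first by ptac.
by apply: bdd_exp; apply: bdd_le (poly_rho ps) _ => x; apply: ltnW; apply: size_rho.
Qed.

Lemma poly_upto X A (cX : code X) (cA : code A) (s : X -> seq A) (d : nat) :
  poly s -> poly (fun x => upto d (s x)).
Proof.
move=> ps; elim: d => [|d IH]; first exact: poly_const.
by apply: poly_cat IH _; apply: poly_words_const.
Qed.

Lemma poly_codes X (cX : code X) (n : X -> nat) : poly n -> poly (fun x => codes (n x)).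
Proof.
move=> pn; rewrite /codes.
(* The factor 9 is the measure of [bits]. *)
apply: (poly_iter (f := fun x => extend (n x))
  (N := fun x => (2 * rho (n x) + 1) * (rho (n x) * 9 + 2) + 1)) => //.
- exact: poly_const.
- have pe : poly (fun p : nat * seq (seq bool) => extend p.1 p.2).
    rewrite /extend; apply: poly_if; try by ptac.
    by apply: poly_words_step; ptac.
  by apply: (poly_comp pe (f := fun p => (n p.1, p.2))); ptac.
- by bdd_tac.
move=> x i hi; have [L Li [-> [_ h]]] := iter_extend (n x) i.
apply: leq_trans (rho_words _ _ _) _; rewrite leq_add2r; apply: leq_mul.
  by apply: leq_trans h _; rewrite /=; lia.
by rewrite leq_add2r; apply: leq_mul; rewrite //=; lia.
Qed.

Lemma poly_sel X (cX : code X) (b w : X -> seq bool) :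
  poly b -> poly w -> poly (fun x => sel (b x) (w x)).
Proof. by move=> pb pw; rewrite /sel; ptac. Qed.

Lemma poly_pairs X (cX : code X) (n : X -> nat) : poly n -> poly (fun x => pairs (n x)).
Proof.
move=> pn; rewrite /pairs; apply: poly_flatten.
apply: (poly_map (f := fun x u => [seq (u, v) | v <- iota 0 (n x)])); first by ptac.
have pn' : poly (fun p : X * nat => n p.1) by apply: (poly_comp pn (f := fst)); ptac.
by ptac.
Qed.

Lemma poly_edges X (cX : code X) (n : X -> nat) (l : X -> seq (nat * nat)) :
  poly n -> poly l -> poly (fun x => edges (n x) (l x)).
Proof.
move=> pn pl; have pp := poly_pairs pn; rewrite /edges; ptac.
Qed.

Lemma poly_vcol X (cX : code X) (n : X -> nat) (b : X -> seq bool) (v : X -> nat) :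
  poly n -> poly b -> poly v -> poly (fun x => vcol (n x) (b x) (v x)).
Proof.
move=> pn pb pv; apply: poly_sel => //.
by have pc := poly_codes pn; ptac.
Qed.

Lemma poly_cls X (cX : code X) (n : X -> nat) (b : X -> seq bool) (e : X -> nat * nat) :
  poly n -> poly b -> poly e -> poly (fun x => cls (n x) (b x) (e x)).
Proof. by move=> pn pb pe; apply: poly_pair; apply: poly_vcol => //; ptac. Qed.

Lemma poly_ends X (cX : code X) (v : X -> nat) (e : X -> nat * nat) :
  poly v -> poly e -> poly (fun x => ends (v x) (e x)).
Proof. by move=> pv pe; rewrite /ends; ptac. Qed.

Lemma poly_touch X (cX : code X) (n : X -> nat) (b : X -> seq bool)
    (h : X -> seq bool * seq bool) (v : X -> nat) :
  poly n -> poly b -> poly h -> poly v -> poly (fun x => touch (n x) (b x) (h x) (v x)).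
Proof. by move=> pn pb ph pv; have := poly_vcol pn pb pv; rewrite /touch => pc; ptac. Qed.

Lemma poly_induced X (cX : code X) (n : X -> nat) (l : X -> seq (nat * nat)) (S : X -> seq nat) :
  poly n -> poly l -> poly S -> poly (fun x => induced (n x) (l x) (S x)).
Proof. by move=> pn pl pS; have pe := poly_edges pn pl; rewrite /induced; ptac. Qed.

Ltac ptac_graph := lazymatch goal with
  | |- poly (fun x => pairs (@?n x)) => simple apply (poly_pairs (n := n))
  | |- poly (fun x => edges (@?n x) (@?l x)) => simple apply (poly_edges (n := n) (l := l))
  | |- poly (fun x => vcol (@?n x) (@?b x) (@?v x)) =>
      simple apply (poly_vcol (n := n) (b := b) (v := v))
  | |- poly (fun x => cls (@?n x) (@?b x) (@?e x)) =>
      simple apply (poly_cls (n := n) (b := b) (e := e))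
  | |- poly (fun x => ends (@?v x) (@?e x)) => simple apply (poly_ends (v := v) (e := e))
  | |- poly (fun x => touch (@?n x) (@?b x) (@?h x) (@?v x)) =>
      simple apply (poly_touch (n := n) (b := b) (h := h) (v := v))
  | |- poly (fun x => induced (@?n x) (@?l x) (@?s x)) =>
      simple apply (poly_induced (n := n) (l := l) (S := s))
  | |- poly (fun x => codes (@?n x)) => simple apply (poly_codes (n := n))
  | |- poly (fun x => upto ?d (@?s x)) => simple apply (poly_upto (s := s) d)
  end.

Ltac ptac_ext ::= first [ptac_lib | ptac_enc | ptac_graph].

Definition color2 := (seq bool * seq bool)%type.

Section Closure.

Context {X : Type} {cX : code X}.
Variables (n : X -> nat) (l : X -> seq (nat * nat)) (k : X -> nat) (b : X -> seq bool)
  (H : X -> seq color2).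
Hypotheses (pn : poly n) (pl : poly l) (pk : poly k) (pb : poly b) (pH : poly H).

Lemma poly_ground : poly (fun x => ground (n x) (l x) (b x) (H x)).
Proof. by rewrite /ground; ptac. Qed.

Lemma poly_base_idx : poly (fun x => base_idx (n x) (H x)).
Proof. by rewrite /base_idx; ptac. Qed.

Lemma poly_base_set (s : X -> color2 * (color2 * nat)) (e : X -> nat * nat) :
  poly s -> poly e -> poly (fun x => base_set (n x) (b x) (s x) (e x)).
Proof. by move=> ps pe; rewrite /base_set; ptac. Qed.

Lemma poly_lone (Y : X -> seq (nat * nat)) (v : X -> nat) :
  poly Y -> poly v -> poly (fun x => lone (n x) (b x) (Y x) (v x)).
Proof. by move=> pY pv; rewrite /lone; ptac. Qed.

Lemma poly_cand (P : X -> pred nat) : poly (fun p : X * nat => P p.1 p.2) ->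
  poly (fun x => cand (n x) (k x) (P x)).
Proof. by move=> pP; rewrite /cand; ptac. Qed.

Lemma poly_geom D : poly (fun x => geom D (n x)).
Proof.
rewrite /geom; elim: D.+1 1 => [|d IH] j; first exact: poly_const.
rewrite /=; apply: poly_addn (IH _); apply: poly_expn => //; first by ptac.
by apply: bdd_exp; apply: bdd_le (poly_rho pn) _ => x /=; lia.
Qed.

End Closure.

Lemma poly_inset X (cX : code X) (n : X -> nat) (b : X -> seq bool)
    (p w : X -> seq (nat * nat)) (s : X -> color2 * (color2 * nat)) :
  poly n -> poly b -> poly p -> poly w -> poly s ->
  poly (fun x => inset (0, 0) (base_set (n x) (b x)) (p x) (s x) (w x)).
Proof.
move=> pn pb pp pw ps; rewrite /inset.
have pB : poly (fun x => base_set (n x) (b x) (s x) (head (0, 0) (w x))).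
  by apply: poly_base_set => //; ptac.
by rewrite /child; ptac.
Qed.

Section Guess.

Context {X : Type} {cX : code X}.
Variables (n : X -> nat) (l : X -> seq (nat * nat)) (k : X -> nat) (g : X -> guess) (D : nat).
Hypotheses (pn : poly n) (pl : poly l) (pk : poly k) (pg : poly g).

Lemma poly_ghint : poly (fun x => ghint (k x) (g x)).
Proof. by rewrite /ghint; ptac. Qed.

Lemma poly_gground : poly (fun x => gground (n x) (l x) (k x) (g x)).
Proof. by have ph := poly_ghint; apply: poly_ground => //; ptac. Qed.

Lemma poly_gsize : poly (fun x => gsize D (n x) (l x) (k x) (g x)).
Proof. by have ph := poly_gground; rewrite /gsize; ptac. Qed.

Lemma poly_gcost : poly (fun x => gcost D (k x) (g x)).
Proof. by have ph := poly_ghint; apply: poly_geom; ptac. Qed.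

End Guess.

Ltac ptac_guess := lazymatch goal with
  | |- poly (fun x => ghint (@?k x) (@?g x)) => simple apply (poly_ghint (k := k) (g := g))
  | |- poly (fun x => gground (@?n x) (@?l x) (@?k x) (@?g x)) =>
      simple apply (poly_gground (n := n) (l := l) (k := k) (g := g))
  | |- poly (fun x => base_idx (@?n x) (@?h x)) =>
      refine (@poly_base_idx _ _ n h _ _)
  | |- poly (fun x => inset (0, 0) (base_set (@?n x) (@?b x)) (@?p x) (@?s x) (@?w x)) =>
      simple apply (poly_inset (n := n) (b := b) (p := p) (s := s) (w := w))
  | |- poly (fun x => lone (@?n x) (@?b x) (@?y x) (@?v x)) =>
      refine (@poly_lone _ _ n b _ _ y v _ _)
  | |- poly (fun x => cand (@?n x) (@?k x) (@?p x)) =>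
      refine (@poly_cand _ _ n k _ _ p _)
  end.

Ltac ptac_ext ::= first [ptac_lib | ptac_enc | ptac_graph | ptac_guess].

Section GuessSets.

Context {X : Type} {cX : code X}.
Variables (n : X -> nat) (l : X -> seq (nat * nat)) (k : X -> nat) (g : X -> guess) (D : nat).
Hypotheses (pn : poly n) (pl : poly l) (pk : poly k) (pg : poly g).

Lemma poly_gsets : poly (fun x => gsets D (n x) (l x) (k x) (g x)).
Proof. by rewrite /gsets /amp_sets; ptac. Qed.

Lemma poly_gcands (T : X -> seq nat) : poly T ->
  poly (fun x => gcands D (n x) (l x) (k x) (g x) (T x)).
Proof. by move=> pT; rewrite /gcands /over /wordsof; ptac. Qed.

End GuessSets.

(** * Parsing the graph input *)

Lemma tokens_dks n l k :
  tokens (dks_input n l k) = n :: size l :: flatten [seq [:: p.1; p.2] | p <- l] ++ [:: k].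
Proof.
rewrite -[RHS]tokensE; congr tokens.
rewrite /dks_input /enc_pairs /= map_cat flatten_cat /= cats0 -!catA.
by congr (_ ++ (_ ++ (_ ++ _))); elim: l => //= p l ->; rewrite catA.
Qed.

(** The first two tokens are [n] and the number of listed pairs, whence the offset 2. *)
Definition get_pairs (t : seq nat) : seq (nat * nat) :=
  [seq (nth 0 t (2 * i).+2, nth 0 t (2 * i).+3) | i <- iota 0 (nth 0 t 1)].

Lemma get_pairsE n l k : get_pairs (tokens (dks_input n l k)) = l.
Proof.
rewrite tokens_dks /get_pairs /=; apply: (@eq_from_nth _ (0, 0)).
  by rewrite size_map size_iota.
rewrite size_map size_iota => i hi; rewrite (nth_map 0) ?size_iota // nth_iota // add0n.
elim: l i hi => // -[u v] l IH [|i] hi; first by rewrite muln0.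
by rewrite mulnS /= IH.
Qed.

(** * The running time *)

Section Machine.

Variables (M : TM) (f : nat -> nat) (c D r : nat).

(* Bounds the numbers of colors and guesses and the factors [f K] of the oracle
   calls. *)
Definition steps (k : nat) : nat :=
  2 ^ k + 4 ^ (k * (k * k)) + sumn [seq f (geom D j) | j <- iota 0 (k * k).+1].

Record dks := Dks { dn : nat; dl : seq (nat * nat); dk : nat }.

Definition dks_bits (x : dks) : seq bool := dks_input (dn x) (dl x) (dk x).

(** The code is that of the input string itself, as [poly_halts] demands; [steps] enters only the
    measure. *)
#[local] Program Instance code_dks : code dks :=
  {| cod x := cod (dks_bits x); rho x := rho (dks_bits x) + steps (dk x) |}.
Next Obligation. by apply: leq_trans (leq_addr _ _); apply: (@rho_ge _ (code_seq code_bool)). Qed.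

Lemma poly_dks_bits : poly dks_bits.
Proof. by apply: poly_recode => //; apply: bdd_le (bdd_rho _) _ => x; apply: leq_addr. Qed.

Lemma poly_dn : poly dn.
Proof.
have pb := poly_dks_bits; apply: (poly_ext (f := fun x => nth 0 (tokens (dks_bits x)) 0)).
  by ptac.
by move=> x; rewrite tokens_dks.
Qed.

Lemma poly_dl : poly dl.
Proof.
have pb := poly_dks_bits; apply: (poly_ext (f := fun x => get_pairs (tokens (dks_bits x)))).
  by rewrite /get_pairs; ptac.
by move=> x; rewrite get_pairsE.
Qed.

Lemma poly_dk : poly dk.
Proof.
have pb := poly_dks_bits; apply: (poly_ext (f := fun x => head 0 (rev (tokens (dks_bits x))))).
  by ptac.
by move=> x; rewrite tokens_dks -!cat_cons rev_cat.
Qed.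

Lemma bdd_steps g : (forall x : dks, g x <= steps (dk x)) -> bdd rho g.
Proof. by move=> h; apply: bdd_le (bdd_rho _) _ => x; apply: leq_trans (h x) (leq_addl _ _). Qed.

Lemma steps_pow k j : j <= k -> 2 ^ j <= steps k.
Proof. by move=> h; rewrite /steps -addnA; apply: leq_trans (leq_addr _ _); rewrite leq_exp2l. Qed.

Lemma size_colpairs j : size (colpairs j) = 4 ^ j.
Proof.
have -> : 4 ^ j = size (words bits j) * size (words bits j).
  by rewrite size_words -expnMn.
exact: (size_allpairs pair (words bits j) (words bits j)).
Qed.

Lemma steps_words k i j : i <= k -> j <= k * k -> size (colpairs i) ^ j <= steps k.
Proof.
move=> hi hj; rewrite size_colpairs -expnM /steps.
apply: (@leq_trans (4 ^ (k * (k * k)))); first by rewrite leq_exp2l // leq_mul.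
by rewrite addnAC leq_addl.
Qed.

Lemma steps_f k j : j <= k * k -> f (geom D j) <= steps k.
Proof.
move=> hj; apply: leq_trans (leq_addl _ _).
have jI : j \in iota 0 (k * k).+1 by rewrite mem_iota /= add0n ltnS.
by rewrite (perm_sumn (perm_map _ (perm_to_rem jI))) leq_addr.
Qed.

Lemma poly_guesses : poly (fun x => guesses (dn x) (dk x)).
Proof.
have pn := poly_dn; have pk := poly_dk.
have sd Y (cY : code Y) (y : Y -> dks) : poly y -> bdd rho (fun z => steps (dk (y z))).
  move=> py; apply: (bdd_comp (f := y) (h := fun x => steps (dk x))) (poly_rho py).
  exact: bdd_steps.
have pC Y (cY : code Y) (y : Y -> dks) (d : Y -> nat) : poly y -> poly d ->
    poly (fun z => colpairs (minn (d z) (dk (y z)))).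
  move=> py pd; have pw : poly (fun z => words bits (minn (d z) (dk (y z)))).
    apply: poly_words; try by ptac.
    by apply: bdd_le (sd _ _ _ py) _ => z; apply: steps_pow; apply: geq_minr.
  by rewrite /colpairs; ptac.
have pW Y (cY : code Y) (y : Y -> dks) (i j : Y -> nat) : poly y -> poly i -> poly j ->
    poly (fun z => words (colpairs (minn (i z) (dk (y z)))) (minn (j z) (dk (y z) * dk (y z)))).
  move=> py pi pj; apply: poly_words; [exact: pC | by ptac |].
  by apply: bdd_le (sd _ _ _ py) _ => z; apply: steps_words; apply: geq_minr.
rewrite /guesses; apply: poly_flatten.
apply: (poly_map (f := fun x b => flatten [seq [seq (b, H) | H <-
    words (colpairs (minn (count id b) (dk x))) (minn d (dk x * dk x))]
    | d <- iota 0 (dk x * dk x).+1])); first by ptac.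
apply: poly_flatten.
apply: (poly_map (f := fun z d => [seq (z.2, H) | H <-
    words (colpairs (minn (count id z.2) (dk z.1))) (minn d (dk z.1 * dk z.1))])).
  by ptac.
apply: (poly_map (f := fun z H => (z.1.2, H))); last by ptac.
by apply: (pW _ _ (fun z => z.1.1)); ptac.
Qed.

Hypothesis hM : forall (u : nat) (F : seq (seq nat)) (K : nat), setsys_valid u F ->
  let x := oddset_input u F K in exists y : seq bool,
    halts_within M x (f K * size x ^ c) y /\
    ((exists T, [/\ odd_set_feasible u F T, size T <= r * K & y = true :: enc_seq T]) \/
     (y = [:: false] /\ forall T, odd_set_feasible u F T -> K < size T)).

Definition query (x : dks) (g : guess) : seq bool :=
  oddset_input (gsize D (dn x) (dl x) (dk x) g) (gsets D (dn x) (dl x) (dk x) g)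
    (gcost D (dk x) g).

Definition query_time (x : dks) (g : guess) : nat :=
  f (gcost D (dk x) g) * size (query x g) ^ c.

(** [hM] gives an output only existentially; running the machine for the allotted time makes it a
    function of the guess. *)
Definition reply (x : dks) (g : guess) : seq bool :=
  tm_output (iter (query_time x g) (@tm_step M) (tm_init M (query x g))).

Lemma replyP x g : halts_within M (query x g) (query_time x g) (reply x g) /\
  let T := behead (tokens (behead (reply x g))) in
  odd_set_feasible (gsize D (dn x) (dl x) (dk x) g) (gsets D (dn x) (dl x) (dk x) g) T /\
    size T <= r * gcost D (dk x) g \/
  forall T, odd_set_feasible (gsize D (dn x) (dl x) (dk x) g)
    (gsets D (dn x) (dl x) (dk x) g) T -> gcost D (dk x) g < size T.
Proof.
have [|y [[hs ho] hy]] := @hM (gsize D (dn x) (dl x) (dk x) g)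
  (gsets D (dn x) (dl x) (dk x) g) (gcost D (dk x) g); first exact: amp_valid.
have ey : reply x g = y by exact: ho.
rewrite ey; split; first by split.
case: hy => [[T [fT sT ->]]|[_ no]]; [left | by right].
by rewrite [tokens _](tokensE (size T :: T)).
Qed.

Lemma poly_oddset_input X (cX : code X) (u K : X -> nat) (F : X -> seq (seq nat)) :
  poly u -> poly F -> poly K -> poly (fun x => oddset_input (u x) (F x) (K x)).
Proof. by move=> pu pF pK; rewrite /oddset_input; ptac. Qed.

Lemma poly_reply : poly (fun p : dks * guess => reply p.1 p.2).
Proof.
have pn := poly_dn; have pk := poly_dk; have pl := poly_dl.
have pq : poly (fun p : dks * guess => query p.1 p.2).
  apply: poly_oddset_input.
  - by apply: poly_gsize; ptac.
  - by apply: poly_gsets; ptac.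
  - by apply: poly_gcost; ptac.
apply: (poly_run (M := M) (T := fun p => query_time p.1 p.2) pq) => [|[x g]]; last first.
  by have [] := replyP x g.
apply: bdd_mul; last first.
  by apply: bdd_exp; apply: bdd_le (poly_rho pq) _ => p; apply: ltnW; apply: size_rho.
have pf : poly (fun p : dks * guess => p.1) by ptac.
apply: bdd_le (bdd_comp (f := fst) (h := fun x => steps (dk x)) _ (poly_rho pf)) _.
  exact: bdd_steps.
(* By the truncation in [ghint], [f] is evaluated only at arguments counted in [steps]. *)
move=> [x g]; apply: steps_f; rewrite size_take; case: ifP => // /negbT; rewrite -leqNgt //.
Qed.

Definition dks_solution (x : dks) : seq nat :=
  search D (dn x) (dl x) (dk x) (fun g => behead (tokens (behead (reply x g)))).

Lemma poly_dks_solution : poly dks_solution.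
Proof.
have pn := poly_dn; have pk := poly_dk; have pl := poly_dl.
have pr := poly_reply; have pg := poly_guesses.
rewrite /dks_solution /search.
apply: (poly_foldl_step (f := fun x S => S) (step := fun x => better (dn x) (dl x))); try by ptac.
- apply: poly_flatten; apply: (poly_map (f := fun x g =>
    gcands D (dn x) (dl x) (dk x) g (behead (tokens (behead (reply x g)))))) => //.
  by apply: poly_gcands; ptac.
- by rewrite /better; ptac.
by move=> x S C; rewrite /better; case: ifP => _; lia.
Qed.

End Machine.

(** * Computability of the time factor *)

Section Computable.

Variables (f : nat -> nat) (D : nat) (Mf : TM).
Hypothesis cf : computes Mf f.

Let halts k t := (c_state (iter t (@tm_step Mf) (tm_init Mf (nseq k true))) == tm_halt Mf) &&
  (tm_output (iter t (@tm_step Mf) (tm_init Mf (nseq k true))) == nseq (f k) true).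

Let halts_ex k : exists t, halts k t.
Proof. by have [t [h1 h2]] := cf k; exists t; rewrite /halts h1 h2 !eqxx. Qed.

(** [computes] asserts some running time for each [k]. Halting with the right output after [t] steps
    is decidable, so the least such [t] defines a function. *)
Definition time_f (k : nat) : nat := ex_minn (halts_ex k).

Lemma time_fP k : halts_within Mf (nseq k true) (time_f k) (nseq (f k) true).
Proof. by rewrite /time_f; case: ex_minnP => t /andP[/eqP h1 /eqP h2] _. Qed.

(* Any measure will do, since computability does not bound the running time. *)
Definition unary_rho (k : nat) : nat :=
  steps f D k + sumn [seq time_f (geom D j) | j <- iota 0 (k * k).+1].

Record unary := Unary { un : nat }.

#[local] Program Instance code_unary : code unary :=
  {| cod x := cod (nseq (un x) true); rho x := rho (nseq (un x) true) + unary_rho (un x) |}.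
Next Obligation. by apply: leq_trans (leq_addr _ _); apply: (@rho_ge _ (code_seq code_bool)). Qed.

Lemma poly_un : poly un.
Proof.
have pb : poly (fun x => nseq (un x) true).
  by apply: poly_recode => //; apply: bdd_le (bdd_rho _) _ => x; apply: leq_addr.
by apply: (poly_ext (f := fun x => size (nseq (un x) true))) => [|x]; [ptac | rewrite size_nseq].
Qed.

Lemma bdd_unary g : (forall x, g x <= unary_rho (un x)) -> bdd rho g.
Proof. by move=> h; apply: bdd_le (bdd_rho _) _ => x; apply: leq_trans (h x) (leq_addl _ _). Qed.

Lemma unary_rho_time k j : j <= k * k -> time_f (geom D j) <= unary_rho k.
Proof.
move=> hj; apply: leq_trans (leq_addl _ _).
have jI : j \in iota 0 (k * k).+1 by rewrite mem_iota /= add0n ltnS.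
by rewrite (perm_sumn (perm_map _ (perm_to_rem jI))) leq_addr.
Qed.

Lemma poly_steps : poly (fun x => steps f D (un x)).
Proof.
have pu := poly_un.
have b1 : bdd rho (fun x => steps f D (un x)).
  by apply: bdd_unary => x; apply: leq_addr.
apply: poly_addn; first apply: poly_addn.
- apply: poly_expn; try by ptac.
  by apply: bdd_le b1 _ => x; apply: steps_pow.
- apply: poly_expn; try by ptac.
  by apply: bdd_le b1 _ => x; rewrite /steps addnAC leq_addl.
(* Clamping [j] changes nothing for the [j] in the sum, and it bounds the time of [Mf] for every
   pair [(x, j)]. *)
pose m (p : unary * nat) := minn p.2 (un p.1 * un p.1).
apply: (poly_ext (f := fun x =>
    sumn [seq f (geom D (m (x, j))) | j <- iota 0 (un x * un x).+1])); last first.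
  move=> x; congr sumn; apply/eq_in_map => j.
  by rewrite mem_iota /= add0n ltnS => hj; rewrite /m (minn_idPl _).
have pm : poly m by rewrite /m; ptac.
have pg : poly (fun p => geom D (m p)) by apply: poly_geom.
have pf : poly (fun p => nseq (f (geom D (m p))) true).
  apply: (poly_run (M := Mf) (input := fun p => nseq (geom D (m p)) true)
    (T := fun p => time_f (geom D (m p)))); first by ptac.
    have p1 : poly (fun p : unary * nat => p.1) by ptac.
    apply: bdd_le (bdd_comp (f := fst) (h := fun x => unary_rho (un x)) _ (poly_rho p1)) _.
      exact: bdd_unary.
    by move=> [x j]; apply: unary_rho_time; apply: geq_minr.
  by move=> p; apply: time_fP.
apply: poly_sumn; apply: (poly_map (f := fun x j => f (geom D (m (x, j))))); first by ptac.
apply: (poly_ext (f := fun p => size (nseq (f (geom D (m p))) true))); first by ptac.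
by move=> [x j]; rewrite size_nseq.
Qed.

Lemma computable_bound e : computable (fun k => (7 + steps f D k) ^ e).
Proof.
have ps := poly_steps.
have pF : poly (fun x => nseq ((7 + steps f D (un x)) ^ e) true).
  apply: poly_nseq; last by ptac.
  apply: poly_expn; try by ptac.
  apply: bdd_exp; apply: bdd_add; first exact: bdd_const.
  by apply: bdd_unary => x; apply: leq_addr.
have hc (x : unary) : cod x = cod (nseq (un x) true) by [].
have [M [T [_ hT]]] := poly_halts hc pF.
by exists M => k; exists (T (Unary k)); apply: (hT (Unary k)).
Qed.

End Computable.

(** As [(1 + 1/m)^m >= 2], the power [(1 + 1/m)^(D+1)] is exponential in [(D + 1) / m] and overtakes
    the linear [r * (D + 1)]. *)
Lemma power_gap r m : 0 < m -> exists D, r * D.+1 * m ^ D.+1 < m.+1 ^ D.+1.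
Proof.
move=> m0.
have bern : 2 * m ^ m <= m.+1 ^ m.
  (* Bernoulli's inequality [(1 + 1/m)^j >= 1 + j/m], cleared of denominators. *)
  have h j : m ^ j * (m + j) <= m * m.+1 ^ j.
    elim: j => [|j IH]; first by rewrite !expn0 addn0 mul1n muln1.
    have : m * m ^ j <= m * m.+1 ^ j by rewrite leq_mul // leq_expl.
    by rewrite !expnS; nia.
  rewrite -(leq_pmul2l m0); apply: leq_trans (h m).
  by move: (m ^ m) => u; nia.
(* For [D + 1 = 2 * i * m] the gain is at least [2^i * 2^i > i * i], and [i * i >= r * (D + 1)]
   because [i > 2 * r * m]. *)
pose i := (2 * r * m).+1; exists (m * (2 * i)).-1.
have D0 : 0 < m * (2 * i) by rewrite muln_gt0 m0.
rewrite prednK //.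
have : 2 ^ (2 * i) * m ^ (m * (2 * i)) <= m.+1 ^ (m * (2 * i)).
  by rewrite [m ^ _]expnM [m.+1 ^ _]expnM -expnMn leq_expl.
apply: leq_trans; rewrite ltn_pmul2r ?expn_gt0 ?m0 //.
have h := ltn_expl i (ltnSn 1).
have -> : 2 ^ (2 * i) = 2 ^ i * 2 ^ i by rewrite mul2n -addnn expnD.
apply: (@leq_ltn_trans (i * i)); last by rewrite ltn_mul.
by rewrite /i; nia.
Qed.

(** An integral [r] and the ratio [(m - 1) / m] keep the reduction within the natural numbers. *)
Lemma oddset_to_dks (r : nat) (m : nat) : 0 < m ->
  (exists (M : TM) (f : nat -> nat) (c : nat), computable f /\
    forall (u : nat) (F : seq (seq nat)) (K : nat), setsys_valid u F ->
    let x := oddset_input u F K in exists y : seq bool,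
    halts_within M x (f K * size x ^ c) y /\
    ((exists T, [/\ odd_set_feasible u F T, size T <= r * K & y = true :: enc_seq T]) \/
     (y = [:: false] /\ forall T, odd_set_feasible u F T -> K < size T))) ->
  exists (M : TM) (f : nat -> nat) (c : nat), computable f /\
    forall n l k, k <= n -> let x := dks_input n l k in
    exists S, [/\ k_subset n k S, halts_within M x (f k * size x ^ c) (enc_seq S)
     & forall T, k_subset n k T -> m.-1 * induced_edges n l T <= m * induced_edges n l S].
Proof.
move=> m0 [M [f [c [[Mf cf] hM]]]]; have [D hD] := power_gap r m0.
have pS := poly_dks_solution D hM.
have pE : poly (cA := code_dks f D) (fun x => enc_seq (dks_solution M f c D x)).
  by ptac.
have hc (x : dks) : @cod _ (code_dks f D) x = cod (dks_bits x) by [].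
have [M' [T [[e bT] hT]]] := poly_halts hc pE.
(* With [s >= 1] the input size and [u] the value of [steps], the time bound is a power of
   [4 * s + 1 + u + 2 <= (7 + u) * s], which separates the parameter from the size. *)
exists M', (fun k => (7 + steps f D k) ^ e), e; split.
  exact: computable_bound cf e.
move=> n l k kn; exists (dks_solution M f c D (Dks n l k)); split.
- exact: search_subset.
- apply: halts_within_mono (hT (Dks n l k)) _; apply: leq_trans (bT _) _.
  rewrite -expnMn; apply: leq_expl.
  have rb (y : seq bool) : rho y = 4 * size y + 1.
    by rewrite /= addn1; congr _.+1; elim: y => //= b y ->; rewrite mulnS.
  rewrite [rho _]/(rho (dks_input n l k) + steps f D k) rb.
  have : 0 < size (dks_input n l k) by rewrite size_cat size_rcons.
  by set s := size _; set u := steps _ _ _; nia.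
move=> S hS; apply: (search_approx kn m0 hD _ hS) => g.
by have [] := replyP D hM (Dks n l k) g.
Qed.

Theorem theorem11 :
  (exists eps : R, Rlt 0 eps /\ ~ dks_fpt_approx eps) ->
  forall r : R, ~ oddset_fpa r.
Proof.
move=> [eps [eps0 noapx]] r [M [f [c [cf hM]]]]; apply: noapx.
(* A larger ratio only weakens what the oracle promises, so [r] may be rounded up to a natural
   number. The [m] chosen next satisfies [1/m < eps]. *)
have [rn /Rlt_le hr] := INR_unbounded r.
have [m hm] := INR_archimed eps 1 eps0.
have m0 : 0 < m.
  by rewrite lt0n; apply/eqP => e; move: hm; rewrite e /=; lra.
have [|M' [f' [c' [cf' h']]]] := @oddset_to_dks rn m m0.
  exists M, f, c; split=> // u F K vF; have [y [hy h]] := hM u F K vF.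
  exists y; split=> //; case: h => [[T [fT sT ey]]|no]; [left | by right].
  exists T; split=> //; apply/leP/INR_le; rewrite mult_INR.
  apply: Rle_trans sT _; apply: Rmult_le_compat_r hr; exact: pos_INR.
exists M', f', c'; split=> // n l k _ kn; have [S [h1 h2 h3]] := h' n l k kn.
exists S; split=> // T hT; have /leP/le_INR := h3 T hT.
rewrite !mult_INR -subn1 minus_INR; last exact/leP.
set x := INR (induced_edges n l T); set y := INR (induced_edges n l S) => hxy.
have x0 : Rle 0 x by apply: pos_INR.
have m1 : Rlt 0 (INR m) by apply/lt_0_INR/ltP.
rewrite /= in hxy; apply: (Rmult_le_reg_l (INR m)) => //.
by nra.
Qed.
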